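(* Let $\alpha,\beta\in\mathbb{C}$, where $\alpha$ is understood modulo $\mathbb{Z}$ (so an equality $(\alpha,\beta)=(a,b)$ below means $\alpha-a\in\mathbb{Z}$ and $\beta=b$). (1) The $\mathrm{Vir}$-module $V'_{\alpha,\beta}\otimes L(-\frac{22}{5},-\frac15)$ is irreducible if and only if $(\alpha,\beta)\neq(-\frac25,\frac65),(-\frac15,\frac65)$. (2) The $\mathrm{Vir}$-module $V'_{\alpha,\beta}\otimes L(\frac12,\frac12)$ is irreducible if and only if $(\alpha,\beta)\neq(0,\frac12),(\frac12,\frac{15}{16})$. (3) The $\mathrm{Vir}$-module $V'_{\alpha,\beta}\otimes L(\frac12,\frac1{16})$ is irreducible if and only if $(\alpha,\beta)\neq(\frac18,\frac{15}{16}),(-\frac38,\frac{15}{16}),(\frac12,\frac12)$.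
   Context: $\mathrm{Vir}$ is the complex Lie algebra with basis $\{C,L_i:i\in\mathbb{Z}\}$, $C$ central, $[L_n,L_m]=(n-m)L_{m+n}+\delta_{m,-n}\frac{n^3-n}{12}C$. The Verma module $V(c,h)$ is the universal $\mathrm{Vir}$-module generated by a vector $v$ with $Cv=cv$, $L_0v=hv$, $L_nv=0$ for $n>0$; $L(c,h)$ is its unique irreducible quotient. For $\alpha,\beta\in\mathbb{C}$, $V_{\alpha,\beta}=\bigoplus_{m\in\mathbb{Z}}\mathbb{C}v_m$ with $L_nv_m=-(m+\alpha+\beta+n\beta)v_{m+n}$, $Cv_m=0$. One has $V_{\alpha,\beta}\cong V_{\alpha+k,\beta}$ for $k\in\mathbb{Z}$, and by convention $\alpha$ is taken to be $0$ whenever $\alpha\in\mathbb{Z}$. Put $V'_{0,0}=V_{0,0}/\mathbb{C}v_0$, $V'_{0,1}=\bigoplus_{m\neq-1}\mathbb{C}v_m\subset V_{0,1}$, and $V'_{\alpha,\beta}=V_{\alpha,\beta}$ for all other pairs. The tensor product has the action $L_n(v_k\otimes x)=(L_nv_k)\otimes x+v_k\otimes(L_nx)$, and $C$ acts as $c$. *)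

(* Defs.v *)
From HB Require Import structures.
From mathcomp Require Import all_boot all_order all_algebra finmap ring.
From mathcomp Require Import generic_quotient ring_quotient boolp monalg.

Set Implicit Arguments.
Unset Strict Implicit.
Unset Printing Implicit Defensive.

Import GRing.Theory.
Local Open Scope ring_scope.
Local Open Scope quotient_scope.

(* [{malg K[I]}] (finitely supported functions I -> K) is used throughout as
   the K-vector space with basis [<< i >>], i : I. *)

Section LinearExtension.
Variables (K : fieldType) (I : choiceType) (V : lmodType K).

Definition lext (f : I -> V) (x : {malg K[I]}) : V :=
  \sum_(i <- msupp x) x@_i *: f i.

Lemma lextEw (f : I -> V) (d : {fset I}) (x : {malg K[I]}) :
  {subset msupp x <= d} -> lext f x = \sum_(i <- d) x@_i *: f i.
Proof.
move=> sxd; rewrite /lext; apply: big_fset_incl; first exact/fsubsetP.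
by move=> i _ /mcoeff_outdom ->; rewrite scale0r.
Qed.

Lemma lext_is_linear (f : I -> V) : linear (lext f).
Proof.
move=> a x y; pose d := (msupp x `|` msupp y `|` msupp (a *: x + y))%fset.
rewrite !(@lextEw _ d); try by move=> i ix; rewrite !in_fsetE ix ?orbT.
rewrite scaler_sumr -big_split /=; apply: eq_bigr => i _.
by rewrite mcoeffD mcoeffZ scalerDl scalerA.
Qed.

HB.instance Definition _ f :=
  GRing.isLinear.Build K {malg K[I]} V *:%R (lext f) (lext_is_linear f).

Lemma lextU (f : I -> V) i : lext f << i >> = f i.
Proof. by rewrite /lext msuppU oner_eq0 big_seq_fset1 mcoeffUU scale1r. Qed.

Lemma lextZU (f : I -> V) a i : lext f (a *: << i >>) = a *: f i.
Proof. by rewrite linearZ /= lextU. Qed.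

Lemma lext0 (f : I -> V) : lext f 0 = 0. Proof. exact: linear0. Qed.

Lemma lext_cst0 x : lext (fun=> 0) x = 0.
Proof. by rewrite /lext big1 // => i _; rewrite scaler0. Qed.

Lemma malg_linear_ext (f g : {malg K[I]} -> V) :
  linear f -> linear g -> (forall i, f << i >> = g << i >>) -> f =1 g.
Proof.
move=> fL gL fg x.
pose f' : {linear {malg K[I]} -> V} := HB.pack f (GRing.isLinear.Build _ _ _ _ f fL).
pose g' : {linear {malg K[I]} -> V} := HB.pack g (GRing.isLinear.Build _ _ _ _ g gL).
rewrite -[f x]/(f' x) -[g x]/(g' x) [x]monalgE !linear_sum.
apply: eq_bigr => i _.
have -> : << x@_i *g i >> = x@_i *: << i >> :> {malg K[I]}.
  by apply/malgP => k; rewrite mcoeffZ !mcoeffU mulrnAr mulr1.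
by rewrite !linearZ /= fg.
Qed.

End LinearExtension.
Arguments lext : simpl never.

Variant vir_basis := VirC | VirL of int.

Definition vir_basis_opt (x : vir_basis) : option int :=
  if x is VirL n then Some n else None.
Definition opt_vir_basis (x : option int) : vir_basis :=
  if x is Some n then VirL n else VirC.
Lemma vir_basis_optK : cancel vir_basis_opt opt_vir_basis.
Proof. by case. Qed.
HB.instance Definition _ := Countable.copy vir_basis (can_type vir_basis_optK).

Definition vir (K : fieldType) := {malg K[vir_basis]}.

Definition vir_bracket (K : fieldType) (x y : vir_basis) : vir K :=
  match x, y with
  | VirL n, VirL m =>
      (n - m)%:~R *: << VirL (m + n) >>
      + (if m == - n then ((n ^+ 3 - n)%:~R / 12%:R) *: << VirC >> else 0)
  | _, _ => 0
  end.

(* A vector space with one operator for each basis element of Vir, subject to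
   no relation: a module over the free associative algebra on [vir_basis]. *)
Record opMod (K : fieldType) := OpMod {
  opMod_car :> lmodType K;
  op : vir_basis -> {linear opMod_car -> opMod_car}
}.

Definition bracket_act (K : fieldType) (M : opMod K) (x y : vir_basis) (u : M) :
  M := lext (fun z => op M z u) (vir_bracket K x y).

(* By bilinearity of the bracket it is enough to compare commutators on basis
   elements of Vir; a Vir-module is an [opMod] satisfying this. *)
Definition vir_axiom (K : fieldType) (M : opMod K) :=
  forall (x y : vir_basis) (u : M),
    op M x (op M y u) - op M y (op M x u) = bracket_act x y u.

Lemma commutator_linear (K : fieldType) (M : opMod K) x y :
  linear (fun u : M => op M x (op M y u) - op M y (op M x u)).
Proof. by move=> a u v /=; rewrite !linearP addrACA scalerDr. Qed.

Lemma bracket_act_linear (K : fieldType) (M : opMod K) x y :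
  linear (bracket_act (M := M) x y).
Proof.
move=> a u v; rewrite /bracket_act /lext scaler_sumr -big_split /=.
by apply: eq_bigr => z _; rewrite linearP scalerDr !scalerA mulrC.
Qed.

Arguments commutator_linear {K} M x y.
Arguments bracket_act_linear {K} M x y.

Record virMod (K : fieldType) := VirMod {
  virMod_op :> opMod K;
  virModP : vir_axiom virMod_op
}.

Record submod (K : fieldType) (M : opMod K) := Submod {
  submod_mem :> M -> Prop;
  submod0 : submod_mem 0;
  submodD : forall (a : K) (u v : M),
    submod_mem u -> submod_mem v -> submod_mem (a *: u + v);
  submod_op : forall (x : vir_basis) (u : M),
    submod_mem u -> submod_mem (op M x u)
}.

Definition irreducible (K : fieldType) (M : virMod K) : Prop :=
  (exists u : M, u != 0) /\
  (forall S : submod M, (forall u, S u -> u = 0) \/ (forall u, S u)).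

Section SubmodGen.
Variables (K : fieldType) (M : opMod K) (A : M -> Prop).

Definition gen_mem (u : M) : Prop :=
  forall S : submod M, (forall v, A v -> S v) -> S u.

Lemma gen_mem0 : gen_mem 0. Proof. by move=> S _; exact: submod0. Qed.
Lemma gen_memD (a : K) (u v : M) :
  gen_mem u -> gen_mem v -> gen_mem (a *: u + v).
Proof. by move=> gu gv S AS; apply: submodD; [exact: gu|exact: gv]. Qed.
Lemma gen_mem_op x (u : M) : gen_mem u -> gen_mem (op M x u).
Proof. by move=> gu S AS; apply: submod_op; exact: gu. Qed.

Definition gen : submod M := Submod gen_mem0 gen_memD gen_mem_op.

Lemma mem_gen u : A u -> gen u. Proof. by move=> Au S; apply. Qed.

End SubmodGen.

Section SubAndQuotient.
Variables (K : fieldType) (M : opMod K) (S : submod M).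

Definition submod_pred : {pred M} := fun u => `[< S u >].

Lemma submod_pred_closed : submod_closed submod_pred.
Proof.
split; first exact/asboolP/submod0.
by move=> a u v /asboolP Su /asboolP Sv; apply/asboolP/submodD.
Qed.
HB.instance Definition _ :=
  GRing.isSubmodClosed.Build K M submod_pred submod_pred_closed.

Record sub_car := SubCar { sub_val : M; _ : sub_val \in submod_pred }.
HB.instance Definition _ := [isSub for sub_val].
HB.instance Definition _ := [Choice of sub_car by <:].
HB.instance Definition _ := [SubChoice_isSubLmodule of sub_car by <:].

Lemma sub_op_subproof x (u : sub_car) : op M x (val u) \in submod_pred.
Proof. by have /asboolP Su := valP u; apply/asboolP/submod_op. Qed.

Definition sub_op x (u : sub_car) : sub_car := SubCar (sub_op_subproof x u).

Lemma sub_op_is_linear x : linear (sub_op x).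
Proof. by move=> a u v; apply: val_inj; rewrite /= !linearP. Qed.
HB.instance Definition _ x :=
  GRing.isLinear.Build K sub_car sub_car *:%R (sub_op x) (sub_op_is_linear x).

Definition subMod : opMod K := @OpMod K sub_car (fun x => sub_op x).

Lemma sub_bracket_act x y (u : subMod) :
  sub_val (bracket_act x y u) = bracket_act x y (sub_val u).
Proof.
have valL : linear (sub_val : subMod -> M) by [].
pose f : {linear subMod -> M} :=
  HB.pack (sub_val : subMod -> M)
    (GRing.isLinear.Build K subMod M *:%R (sub_val : subMod -> M) valL).
rewrite -[sub_val _]/(f _) /bracket_act /lext linear_sum.
by apply: eq_bigr => z _; rewrite linearZ.
Qed.

Definition quot_car := Quotient.quot submod_pred.
HB.instance Definition _ := GRing.Zmodule.on quot_car.
HB.instance Definition _ := Choice.on quot_car.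

Definition quot_pi (u : M) : quot_car := \pi_quot_car u.

Lemma quot_piP u v : quot_pi u = quot_pi v <-> S (u - v).
Proof.
split=> [/eqP|Suv].
  by rewrite /quot_pi -[_ == _]Quotient.idealrBE => /asboolP.
by apply/eqP; rewrite /quot_pi -[_ == _]Quotient.idealrBE; apply/asboolP.
Qed.

Lemma quot_pi0 u : S u -> quot_pi u = 0.
Proof.
move=> Su; have -> : (0 : quot_car) = quot_pi 0 by rewrite /quot_pi !piE.
by apply/quot_piP; rewrite subr0.
Qed.

Lemma quot_piD u v : quot_pi (u + v) = quot_pi u + quot_pi v.
Proof. by rewrite /quot_pi !piE. Qed.

Lemma quot_reprK (q : quot_car) : quot_pi (repr q) = q.
Proof. exact: reprK. Qed.

Definition quot_scale (a : K) (q : quot_car) : quot_car :=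
  quot_pi (a *: repr q).

Lemma quot_scaleE a u : quot_scale a (quot_pi u) = quot_pi (a *: u).
Proof.
apply/quot_piP; rewrite -scalerBr -[_ *: _]addr0.
by apply: submodD; [apply/quot_piP; exact: quot_reprK | exact: submod0].
Qed.

Lemma quot_scaleA a b q : quot_scale a (quot_scale b q) = quot_scale (a * b) q.
Proof. by rewrite -[q]quot_reprK !quot_scaleE scalerA. Qed.
Lemma quot_scale1 : left_id 1 quot_scale.
Proof. by move=> q; rewrite -[q]quot_reprK !quot_scaleE scale1r. Qed.
Lemma quot_scaleDr : right_distributive quot_scale +%R.
Proof.
move=> a p q; rewrite -[p]quot_reprK -[q]quot_reprK.
by rewrite -quot_piD !quot_scaleE -quot_piD scalerDr.
Qed.
Lemma quot_scaleDl q : {morph quot_scale^~ q : a b / a + b}.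
Proof.
by move=> a b /=; rewrite -[q]quot_reprK !quot_scaleE -quot_piD scalerDl.
Qed.

HB.instance Definition _ :=
  GRing.Zmodule_isLmodule.Build K quot_car
    quot_scaleA quot_scale1 quot_scaleDr quot_scaleDl.

Lemma quot_pi_is_linear : linear quot_pi.
Proof. by move=> a u v; rewrite quot_piD -quot_scaleE. Qed.
HB.instance Definition _ :=
  GRing.isLinear.Build K M quot_car *:%R quot_pi quot_pi_is_linear.

Definition quot_op x (q : quot_car) : quot_car := quot_pi (op M x (repr q)).

Lemma quot_opE x u : quot_op x (quot_pi u) = quot_pi (op M x u).
Proof.
by apply/quot_piP; rewrite -linearB; apply/submod_op/quot_piP/quot_reprK.
Qed.

Lemma quot_op_is_linear x : linear (quot_op x).
Proof.
move=> a p q; rewrite -[p]quot_reprK -[q]quot_reprK.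
by rewrite -linearP !quot_opE -linearP linearP.
Qed.
HB.instance Definition _ x :=
  GRing.isLinear.Build K quot_car quot_car *:%R (quot_op x)
    (quot_op_is_linear x).

Definition quotMod : opMod K := @OpMod K quot_car (fun x => quot_op x).

Lemma quot_bracket_act x y u :
  bracket_act (M := quotMod) x y (quot_pi u) = quot_pi (bracket_act x y u).
Proof.
rewrite /bracket_act /lext linear_sum; apply: eq_bigr => z _.
by rewrite linearZ /= quot_opE.
Qed.

Lemma quot_vir_axiom :
  (forall x y u, S (op M x (op M y u) - op M y (op M x u) - bracket_act x y u))
  -> vir_axiom quotMod.
Proof.
move=> SM x y q; rewrite -[q]quot_reprK quot_bracket_act /= !quot_opE -linearB.
exact/quot_piP.
Qed.

End SubAndQuotient.

Section SubAndQuotientVir.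
Variables (K : fieldType) (M : virMod K) (S : submod M).

Lemma subVir_axiom : vir_axiom (subMod S).
Proof.
by move=> x y u; apply: val_inj; rewrite /= sub_bracket_act -virModP.
Qed.
Definition subVir : virMod K := VirMod subVir_axiom.

Lemma quotVir_axiom : vir_axiom (quotMod S).
Proof.
by apply: quot_vir_axiom => x y u; rewrite virModP subrr; exact: submod0.
Qed.
Definition quotVir : virMod K := VirMod quotVir_axiom.

End SubAndQuotientVir.

Section HighestWeight.
Variables (K : fieldType) (c h : K).

Definition free_op (x : vir_basis) :
    {malg K[seq vir_basis]} -> {malg K[seq vir_basis]} :=
  lext (fun w => << x :: w >>).
HB.instance Definition _ x := GRing.Linear.on (free_op x).

(* The word [:: x1; ...; xk] stands for x1 ... xk v, v the generator. *)
Definition freeMod : opMod K :=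
  @OpMod K {malg K[seq vir_basis]} (fun x => free_op x).

Definition free_gen : freeMod := << [::] >> : {malg K[seq vir_basis]}.

Inductive verma_rel : freeMod -> Prop :=
| VermaBracket x y u :
    verma_rel (op freeMod x (op freeMod y u) - op freeMod y (op freeMod x u)
               - bracket_act x y u)
| VermaC : verma_rel (op freeMod VirC free_gen - c *: free_gen)
| VermaL0 : verma_rel (op freeMod (VirL 0) free_gen - h *: free_gen)
| VermaLpos (n : int) : 0 < n -> verma_rel (op freeMod (VirL n) free_gen).

Lemma verma_axiom : vir_axiom (quotMod (gen verma_rel)).
Proof. by apply: quot_vir_axiom => x y u; apply/mem_gen/VermaBracket. Qed.

Definition verma : virMod K := VirMod verma_axiom.

(* The sum of all proper submodules, which is the greatest proper one. *)
Definition verma_radical : submod verma :=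
  gen (fun u => exists S : submod verma, ~ (forall w, S w) /\ S u).

Definition irr_hw : virMod K := quotVir verma_radical.

End HighestWeight.

Section IntermediateSeries.
Variable K : fieldType.

Definition ivec (m : int) : {malg K[int]} := << m >>.

Section Def.
Variables (alpha beta : K).

Definition inter_op (x : vir_basis) : {malg K[int]} -> {malg K[int]} :=
  lext (fun m : int =>
    if x is VirL n then
      - (m%:~R + alpha + beta + n%:~R * beta) *: ivec (m + n)
    else 0).
HB.instance Definition _ x := GRing.Linear.on (inter_op x).

Definition interMod : opMod K :=
  @OpMod K {malg K[int]} (fun x => inter_op x).

Lemma bracket_act_inter x y m :
  bracket_act (M := interMod) x y (ivec m) =
  if (x, y) is (VirL n, VirL k) then
    (n - k)%:~R *: (- (m%:~R + alpha + beta + (k + n)%:~R * beta) *: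
      ivec (m + (k + n)))
  else 0 :> {malg K[int]}.
Proof.
rewrite /bracket_act; case: x y => [|n] [|k]; rewrite ?lext0 //.
rewrite linearP /= lextU /inter_op lextU; case: ifP => _; last first.
  by rewrite lext0 addr0.
by rewrite lextZU lextU scaler0 addr0.
Qed.

Lemma inter_axiom : vir_axiom interMod.
Proof.
move=> x y; apply: (malg_linear_ext (commutator_linear interMod x y)
  (bracket_act_linear interMod x y)) => m.
rewrite bracket_act_inter /= /inter_op.
case: x y => [|n] [|k].
- by rewrite !lext_cst0 subrr.
- by rewrite !lext_cst0 lext0 subrr.
- by rewrite !lext_cst0 lext0 subrr.
rewrite !lextU !lextZU !scalerA [k + n]addrC !addrA [m + n + k]addrAC.
rewrite -scalerBl addrAC; congr (_ *: _); rewrite !rmorphD ?rmorphN /=.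
ring.
Qed.

Definition inter : virMod K := VirMod inter_axiom.

End Def.

(* In V_{0,0}, [ivec 0] spans a trivial submodule. *)
Definition inter00_triv_mem (u : inter 0 0) : Prop :=
  exists a : K, u = a *: ivec 0.

Lemma inter00_triv0 : inter00_triv_mem 0.
Proof. by exists 0; rewrite scale0r. Qed.
Lemma inter00_trivD (a : K) (u v : inter 0 0) :
  inter00_triv_mem u -> inter00_triv_mem v -> inter00_triv_mem (a *: u + v).
Proof. by move=> [b ->] [d ->]; exists (a * b + d); rewrite scalerDl scalerA. Qed.
Lemma inter00_triv_op x (u : inter 0 0) :
  inter00_triv_mem u -> inter00_triv_mem (op _ x u).
Proof.
move=> [a ->]; exists 0; rewrite scale0r linearZ /= /inter_op lextU.
case: x => [|n]; rewrite ?scaler0 //.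
by rewrite mulr0 !addr0 oppr0 scale0r scaler0.
Qed.

Definition inter00_triv : submod (inter 0 0) :=
  Submod inter00_triv0 inter00_trivD inter00_triv_op.

(* The span of the v_m, m != -1, in V_{0,1}. *)
Definition inter01_sub_mem (u : inter 0 1) : Prop :=
  (u : {malg K[int]})@_(-1) = 0.

Lemma inter01_sub0 : inter01_sub_mem 0.
Proof. exact: mcoeff0. Qed.
Lemma inter01_subD (a : K) (u v : inter 0 1) :
  inter01_sub_mem u -> inter01_sub_mem v -> inter01_sub_mem (a *: u + v).
Proof.
rewrite /inter01_sub_mem => u0 v0.
by rewrite mcoeffD mcoeffZ u0 v0 mulr0 addr0.
Qed.
Lemma inter01_sub_op x (u : inter 0 1) :
  inter01_sub_mem u -> inter01_sub_mem (op _ x u).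
Proof.
move=> _; rewrite /inter01_sub_mem /= /inter_op /lext raddf_sum big1 //= => m _.
rewrite mcoeffZ; case: x => [|n]; first by rewrite mcoeff0 mulr0.
rewrite mcoeffZ mcoeffU; case: eqP => [mn|_]; last by rewrite !mulr0.
by rewrite !mulr1 addr0 addrAC -rmorphD /= mn addNr oppr0 mulr0.
Qed.

Definition inter01_sub : submod (inter 0 1) :=
  Submod inter01_sub0 inter01_subD inter01_sub_op.

(* The convention that alpha is replaced by 0 as soon as it is an integer. *)
Definition normalize_alpha (alpha : K) : K :=
  if `[< exists k : int, alpha = k%:~R >] then 0 else alpha.

Definition inter' (alpha beta : K) : virMod K :=
  let alpha := normalize_alpha alpha in
  if (alpha == 0) && (beta == 0) then quotVir inter00_triv
  else if (alpha == 0) && (beta == 1) then subVir inter01_sub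
  else inter alpha beta.

End IntermediateSeries.

Section Tensor.
Variables (K : fieldType) (M N : virMod K).

Definition pair_vec (u : M) (v : N) : {malg K[(M * N)%type]} := << (u, v) >>.

Definition pair_op (x : vir_basis) :
    {malg K[(M * N)%type]} -> {malg K[(M * N)%type]} :=
  lext (fun p => pair_vec (op M x p.1) p.2 + pair_vec p.1 (op N x p.2)).
HB.instance Definition _ x := GRing.Linear.on (pair_op x).

Definition pairMod : opMod K :=
  @OpMod K {malg K[(M * N)%type]} (fun x => pair_op x).

Inductive bilin_rel : pairMod -> Prop :=
| BilinL (a : K) u u' v :
    bilin_rel (pair_vec (a *: u + u') v - (a *: pair_vec u v + pair_vec u' v))
| BilinR (a : K) u v v' :
    bilin_rel (pair_vec u (a *: v + v') - (a *: pair_vec u v + pair_vec u v')).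

(* The linear span of [bilin_rel] is already stable under [pair_op], so it is
   the submodule generated by [bilin_rel], and the quotient is the usual tensor
   product of vector spaces. *)
Definition tensor_rel : submod pairMod := gen bilin_rel.

Definition tensor_mk (u : M) (v : N) : quotMod tensor_rel :=
  quot_pi tensor_rel (pair_vec u v).

Lemma tensor_mk_linearl v : linear (tensor_mk^~ v).
Proof.
move=> a u u'; rewrite /tensor_mk -linearP; apply/quot_piP.
exact/mem_gen/BilinL.
Qed.

Lemma tensor_mk_linearr u : linear (tensor_mk u).
Proof.
move=> a v v'; rewrite /tensor_mk -linearP; apply/quot_piP.
exact/mem_gen/BilinR.
Qed.

Lemma tensor_mkBl u u' v :
  tensor_mk (u - u') v = tensor_mk u v - tensor_mk u' v.
Proof.
by rewrite addrC -scaleN1r tensor_mk_linearl scaleN1r addrC.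
Qed.

Lemma tensor_mkBr u v v' :
  tensor_mk u (v - v') = tensor_mk u v - tensor_mk u v'.
Proof.
by rewrite addrC -scaleN1r tensor_mk_linearr scaleN1r addrC.
Qed.

Lemma tensor_mk_op x u v :
  op (quotMod tensor_rel) x (tensor_mk u v) =
  tensor_mk (op M x u) v + tensor_mk u (op N x v).
Proof. by rewrite /= quot_opE /= /pair_op lextU linearD. Qed.

Lemma tensor_mk_bracket x y u v :
  bracket_act (M := quotMod tensor_rel) x y (tensor_mk u v) =
  tensor_mk (bracket_act x y u) v + tensor_mk u (bracket_act x y v).
Proof.
pose f : {linear M -> quotMod tensor_rel} :=
  HB.pack (tensor_mk^~ v)
    (GRing.isLinear.Build K _ _ _ (tensor_mk^~ v) (tensor_mk_linearl v)).
pose g : {linear N -> quotMod tensor_rel} :=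
  HB.pack (tensor_mk u)
    (GRing.isLinear.Build K _ _ _ (tensor_mk u) (tensor_mk_linearr u)).
rewrite -[tensor_mk (bracket_act _ _ _) _]/(f _).
rewrite -[tensor_mk _ (bracket_act _ _ _)]/(g _).
rewrite /bracket_act /lext !linear_sum -big_split; apply: eq_bigr => z _.
by rewrite tensor_mk_op scalerDr !linearZ.
Qed.

Fact tensor_AC (V : zmodType) (a b c d e f : V) :
  a + b + (c + d) - (e + c + (b + f)) = a - e + (d - f).
Proof.
have -> : a + b + (c + d) = (b + c) + (a + d) by rewrite [a + b]addrC addrACA.
have -> : e + c + (b + f) = (b + c) + (e + f).
  by rewrite [e + c]addrC addrACA [c + b]addrC.
by rewrite opprD addrACA subrr add0r opprD addrACA.
Qed.

Lemma tensor_axiom : vir_axiom (quotMod tensor_rel).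
Proof.
move=> x y q; rewrite -[q]quot_reprK; move: (repr q) => {q}.
apply: malg_linear_ext => [a p q|a p q|[u v]].
- by rewrite linearP; exact: (commutator_linear (quotMod tensor_rel)).
- by rewrite linearP; exact: (bracket_act_linear (quotMod tensor_rel)).
rewrite -[quot_pi _ _]/(tensor_mk u v) tensor_mk_bracket !tensor_mk_op.
rewrite [op _ x _]linearD [op _ y (_ + _)]linearD !tensor_mk_op -!virModP.
rewrite tensor_mkBl tensor_mkBr.
exact: tensor_AC.
Qed.

Definition tensor : virMod K := VirMod tensor_axiom.

End Tensor.

Definition eq_modZ (K : fieldType) (p q : K * K) : Prop :=
  (exists k : int, p.1 - q.1 = k%:~R) /\ p.2 = q.2.

(* Main.v *)
(* Let w be the highest weight vector of L = L(c,h) and e_k the basis of V'. A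
   nonzero submodule of V' (x) L contains some e_k (x) x with x <> 0: for large a
   and b with a + b fixed, L_a L_b annihilates the second factors, and its
   coefficient on e_k is quadratic in a with coefficients separating the k. By
   simplicity of L it then contains e_m (x) w for m large, and the null vectors
   of L (levels 2 and 3, or 2 and 4 when h = 1/16) allow to descend from
   e_(k+1) (x) w, e_(k+2) (x) w, ... to e_k (x) w, except when two polynomials in
   k + alpha and beta both vanish; this happens at the exceptional pairs only.

   At an exceptional pair there is a functional F on V' (x) L with
   F o L_n = 0 for n < 0 and F (e_n0 (x) w) = 1, namely
   F (e_m (x) x) = phi_(m - n0) (x) for matrix elements phi_j of a primary field.
   The largest submodule in the kernel of F contains e_(n0+1) (x) w but not
   e_n0 (x) w. The phi_j come from the Fock module of polynomials in x_1, x_2, ...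
   with the background charge giving (c,h), where phi_j (u) is the value at
   x = (1, 1, ...) of the component of degree j of u; they descend to L because
   (kappa and lam being fitted to the exceptional pair) phi_j is determined by
   lower ones applied to L_1 x, L_1^2 x and L_2 x, and so vanishes on the radical
   of the Verma module. *)
Require Import Defs.
From HB Require Import structures.
From mathcomp Require Import all_boot all_order all_algebra finmap ring zify.
From mathcomp Require Import boolp monalg.
From mathcomp Require Import reals complex.

Set Implicit Arguments.
Unset Strict Implicit.
Unset Printing Implicit Defensive.

Import Order.TTheory GRing.Theory Num.Theory.
Local Open Scope ring_scope.

(** * Linear combinations in modules *)

(** No PBW basis is used, so it is not clear beforehand that the Verma module is non-zero or that
    the sum of its proper submodules is proper. Both follow from [phi 0], pulled back from a Fock
    module along the universal map: it vanishes on the image of every L_n with n < 0 and equals 1 on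
    the highest weight vector. The same form shows that singular vectors of positive level vanish in
    L. Hence the irreducibility half rests on Fock modules as well.

    The exceptional pairs are fusion rules. A primary field of weight Delta from L(c,h) to highest
    weight h' yields beta = 1 - Delta and gamma = h - h', and F exists when gamma - alpha - beta is
    an integer. For h = -1/5 the pairs (Delta, h') are (-1/5, 0) and (-1/5, -1/5); for h = 1/2 they
    are (1/2, 0) and (1/16, 1/16); for h = 1/16 they are (1/16, 0), (1/16, 1/2) and (1/2, 1/16).
    With q = 1/(2 kappa) and T = kappa tau, the Fock field has Delta = q (1 - 2 T) and h' = q ((lam
    - 1)^2 - T^2); together with c and h this leads to the constants of each case. *)

Section LinearCombinations.
Variables (K : comNzRingType) (V : lmodType K).

Inductive lexpr :=
  LVar of nat | LAdd of lexpr & lexpr | LOpp of lexpr | LScale of K & lexpr | LZero.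

Fixpoint linterp (env : seq V) (e : lexpr) : V :=
  match e with
  | LVar i => nth 0 env i
  | LAdd x y => linterp env x + linterp env y
  | LOpp x => - linterp env x
  | LScale b x => b *: linterp env x
  | LZero => 0
  end.

Fixpoint lcoef (i : nat) (e : lexpr) : K :=
  match e with
  | LVar j => if eqn i j then 1 else 0
  | LAdd x y => lcoef i x + lcoef i y
  | LOpp x => - lcoef i x
  | LScale b x => b * lcoef i x
  | LZero => 0
  end.

(** Computes to a conjunction with one scalar identity per atom, each of which is then left to
    [ring]. *)
Fixpoint lcoefs_eq (n : nat) (x y : lexpr) : Prop :=
  if n is n'.+1 then lcoefs_eq n' x y /\ lcoef n' x = lcoef n' y else True.

Lemma linterpE env e :
  linterp env e = \sum_(i < size env) lcoef i e *: nth 0 env i.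
Proof.
elim: e => [j|x IHx y IHy|x IHx|b x IHx|] /=.
- have [lt_j|le_j] := ltnP j (size env); last first.
    rewrite nth_default // big1 // => i _; case: eqnP => [ij|_].
      by have := ltn_ord i; rewrite ij ltnNge le_j.
    by rewrite scale0r.
  rewrite (bigD1 (Ordinal lt_j)) //=; case: eqnP => // _; rewrite scale1r.
  rewrite big1 ?addr0 // => i ij; case: eqnP => [ij'|_]; last by rewrite scale0r.
  by case/negP: ij; apply/eqP/val_inj.
- by rewrite IHx IHy -big_split; apply: eq_bigr => i _; rewrite scalerDl.
- by rewrite IHx -sumrN; apply: eq_bigr => i _; rewrite scaleNr.
- by rewrite IHx scaler_sumr; apply: eq_bigr => i _; rewrite scalerA.
- by rewrite big1 // => i _; rewrite scale0r.
Qed.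

Lemma linterp_eq env x y :
  lcoefs_eq (size env) x y -> linterp env x = linterp env y.
Proof.
move=> xy; rewrite !linterpE; apply: eq_bigr => i _; congr (_ *: _).
elim: (size env) xy (nat_of_ord i) (ltn_ord i) => //= n IHn [/IHn xy n_xy] j.
by rewrite ltnS leq_eqVlt => /predU1P[->|/xy].
Qed.

End LinearCombinations.

(* Atoms are compared up to conversion: the same operation can be reached
   through different structure instances. *)
Ltac l_index x l :=
  match l with
  | ?y :: _ => let _ := match goal with _ => unify x y end in constr:(0%N)
  | _ :: ?l' => let n := l_index x l' in constr:(S n)
  end.
Ltac l_mem x l :=
  match l with
  | [::] => constr:(false)
  | ?y :: _ => let _ := match goal with _ => unify x y end in constr:(true)
  | _ :: ?l' => l_mem x l'
  end.
Ltac l_atoms t l :=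
  lazymatch t with
  | (?x + ?y)%R => let l1 := l_atoms x l in l_atoms y l1
  | (- ?x)%R => l_atoms x l
  | (_ *: ?x)%R => l_atoms x l
  | (0)%R => l
  | _ => lazymatch l_mem t l with true => l | false => constr:(t :: l) end
  end.
Ltac l_reify K t l :=
  lazymatch t with
  | (?x + ?y)%R =>
    let ex := l_reify K x l in let ey := l_reify K y l in constr:(@LAdd K ex ey)
  | (- ?x)%R => let ex := l_reify K x l in constr:(@LOpp K ex)
  | (?b *: ?x)%R => let ex := l_reify K x l in constr:(@LScale K b ex)
  | (0)%R => constr:(@LZero K)
  | _ => let n := l_index t l in constr:(@LVar K n)
  end.

(* Decides equalities of linear combinations of atoms in a module over [K]. *)
Ltac module K :=
  lazymatch goal with
  |- @eq ?V ?x ?y =>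
    let l1 := l_atoms x (@nil V) in let l := l_atoms y l1 in
    let ex := l_reify K x l in let ey := l_reify K y l in
    change (@linterp K _ l ex = @linterp K _ l ey);
    apply: linterp_eq;
    cbv [lcoefs_eq lcoef eqn size]; repeat split; ring
  end.


(** * Submodules, commutators, properties of large integers *)

Section Submod.
Variables (K : fieldType) (M : opMod K) (S : submod M).

Lemma submodZ a u : S u -> S (a *: u).
Proof. by move=> Su; rewrite -[_ *: _]addr0; apply: submodD Su (submod0 S). Qed.

Lemma submod_add u v : S u -> S v -> S (u + v).
Proof. by move=> Su Sv; rewrite -[u]scale1r; exact: submodD. Qed.

Lemma submodB u v : S u -> S v -> S (u - v).
Proof. by move=> Su Sv; rewrite addrC -scaleN1r; exact: submodD. Qed.

Lemma submod_scaleI a u : a != 0 -> S (a *: u) -> S u.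
Proof. by move=> a0 /(submodZ a^-1); rewrite scalerA mulVf // scale1r. Qed.

End Submod.

Section Commutators.
Variables (K : fieldType) (M : virMod K).

Lemma vir_comm (n m : int) (u : M) :
  op M (VirL n) (op M (VirL m) u) =
  op M (VirL m) (op M (VirL n) u) + (n - m)%:~R *: op M (VirL (m + n)) u +
  (if m == - n then ((n ^+ 3 - n)%:~R / 12%:R) *: op M VirC u else 0).
Proof.
apply/eqP; rewrite -addrA addrC -subr_eq virModP /bracket_act /=; apply/eqP.
rewrite linearD /= lextZU; congr (_ + _).
by case: ifP => _; rewrite ?lextZU ?lext0.
Qed.

Lemma vir_commC (n : int) (u : M) :
  op M (VirL n) (op M VirC u) = op M VirC (op M (VirL n) u).
Proof.
by apply/eqP; rewrite -subr_eq0 virModP /bracket_act /= lext0.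
Qed.

End Commutators.

Section Eventually.
Implicit Types P Q : nat -> Prop.

Definition eventually P := exists N, forall n, (N <= n)%N -> P n.

Lemma eventually_and P Q :
  eventually P -> eventually Q -> eventually (fun n => P n /\ Q n).
Proof.
move=> [N HN] [N' HN']; exists (maxn N N') => n; rewrite geq_max => /andP[h h'].
by split; [exact: HN|exact: HN'].
Qed.

Lemma eventually_all (I : eqType) (r : seq I) (P : I -> nat -> Prop) :
  (forall i, i \in r -> eventually (P i)) ->
  eventually (fun n => forall i, i \in r -> P i n).
Proof.
elim: r => [|i r IHr] H; first by exists 0%N.
have [||N HN] := @eventually_and (P i) (fun n => forall j, j \in r -> P j n).
- by apply: H; rewrite mem_head.
- by apply: IHr => j jr; apply: H; rewrite in_cons jr orbT.
exists N => n /HN[Pi Pr] j; rewrite in_cons => /predU1P[->//|]; exact: Pr.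
Qed.

Lemma eventually_neq0 (K : numFieldType) (a b : K) :
  (a != 0) || (b != 0) -> eventually (fun n => a + n%:R * b != 0).
Proof.
have [-> |b0 _] := eqVneq b 0.
  by rewrite orbF => a0; exists 0%N => n _; rewrite mulr0 addr0.
have [[n0 /eqP Hn0]|H] := pselect (exists n0 : nat, a + n0%:R * b == 0).
  exists n0.+1 => n lt_n; apply/eqP => Hn; move: lt_n.
  have /addrI/(mulIf b0)/eqP : a + n%:R * b = a + n0%:R * b by rewrite Hn Hn0.
  by rewrite eqr_nat => /eqP ->; rewrite ltnn.
by exists 0%N => n _; apply/negP => Hn; apply: H; exists n.
Qed.

End Eventually.

Section TensorSpan.
Variables (K : fieldType) (M N : virMod K).

Lemma tensor_mk0r (u : M) : tensor_mk u (0 : N) = 0.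
Proof. by rewrite -(subrr (0 : N)) tensor_mkBr subrr. Qed.

Lemma tensor_mk0l (v : N) : tensor_mk (0 : M) v = 0.
Proof. by rewrite -(subrr (0 : M)) tensor_mkBl subrr. Qed.

Lemma tensor_mkZl a (u : M) (v : N) : tensor_mk (a *: u) v = a *: tensor_mk u v.
Proof. by have := tensor_mk_linearl v a u 0; rewrite tensor_mk0l !addr0. Qed.

Lemma tensor_ind (P : tensor M N -> Prop) :
  (forall a y z, P y -> P z -> P (a *: y + z)) ->
  (forall u v, P (tensor_mk u v)) -> forall z, P z.
Proof.
move=> PD Pmk z; have P0 : P 0 by rewrite -(tensor_mk0r 0).
rewrite -[z]quot_reprK; move: (repr z) => {}z; rewrite [z]monalgE.
rewrite linear_sum; elim/big_rec: _ => // -[u v] y _ Py.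
have -> : << z@_(u, v) *g (u, v) >> = z@_(u, v) *: pair_vec u v.
  by apply/malgP => k; rewrite mcoeffZ !mcoeffU mulrnAr mulr1.
by rewrite linearZ; apply: PD => //; exact: Pmk.
Qed.

End TensorSpan.

(** * Tensor products with an intermediate series *)

(* [tm k x] stands for [e k (x) x], where [e] spans an intermediate series
   module; T stays abstract to keep terms small. *)
Section IntermediateTensor.
Variables (K : numFieldType) (L T : virMod K).
Variables (alpha beta : K) (tm : int -> L -> T).

Definition wt (n m : int) : K := m%:~R + alpha + beta + n%:~R * beta.

Hypothesis tm_linear : forall k, linear (tm k).
Hypothesis tm_op : forall n k x,
  op T (VirL n) (tm k x) = - wt n k *: tm (k + n) x + tm k (op L (VirL n) x).
Hypothesis tm_opC : forall k x, op T VirC (tm k x) = tm k (op L VirC x).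
Hypothesis tm_span : forall P : T -> Prop,
  (forall a y z, P y -> P z -> P (a *: y + z)) -> (forall k x, P (tm k x)) ->
  forall z, P z.

Lemma tm0 k : tm k 0 = 0.
Proof. by have := tm_linear k (-1) 0 0; rewrite scaleN1r oppr0 addr0 scaleN1r addNr. Qed.

Lemma tmZ k a x : tm k (a *: x) = a *: tm k x.
Proof. by have := tm_linear k a x 0; rewrite tm0 !addr0. Qed.

Lemma tmD k x y : tm k (x + y) = tm k x + tm k y.
Proof. by have := tm_linear k 1 x y; rewrite !scale1r. Qed.

Lemma S_shift (S : submod T) n m (x : L) :
  S (tm m x) -> S (tm (m + n) x) -> S (tm m (op L (VirL n) x)).
Proof.
move=> /(submod_op (VirL n)); rewrite tm_op => Sx /(submodZ (wt n m)) Sy.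
by have := submod_add Sx Sy; rewrite scaleNr addrAC addNr add0r.
Qed.

Section Residue.
Variables (S : submod T) (w : L) (k : int).
Hypothesis S_above : forall m, k < m -> S (tm m w).

(** Congruence to a multiple of [tm k w] modulo [S]. If 0 is congruent to a non-zero multiple, then
    [tm k w] lies in [S]; a null vector is used in this way. *)
Definition res (z : T) (a : K) := S (z - a *: tm k w).

Lemma res_refl : res (tm k w) 1.
Proof. by rewrite /res scale1r subrr; exact: submod0. Qed.

Lemma res_shift n m (x : L) a :
  S (tm m x) -> res (tm (m + n) x) a ->
  res (tm m (op L (VirL n) x)) (wt n m * a).
Proof.
move=> /(submod_op (VirL n)); rewrite tm_op => Sx /(submodZ (wt n m)) ra.
have := submod_add Sx ra; rewrite scalerBr scalerA scaleNr addrACA addNr add0r.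
by [].
Qed.

Lemma resD y z a b : res y a -> res z b -> res (y + z) (a + b).
Proof.
by move=> ya zb; have := submod_add ya zb; rewrite addrACA -opprD -scalerDl.
Qed.

Lemma resZ c z a : res z a -> res (c *: z) (c * a).
Proof. by rewrite /res -scalerA -scalerBr; exact: submodZ. Qed.

Lemma res_eq0 a : res 0 a -> a != 0 -> S (tm k w).
Proof.
rewrite /res sub0r -scaleNr => Sa a0; apply: submod_scaleI Sa.
by rewrite oppr_eq0.
Qed.

(* On [e k (x) w], each null vector of L contributes a polynomial in
   r = k + alpha and beta, obtained by moving its operators onto [e]. *)
Lemma null_vector2 (t : K) (r := k%:~R + alpha) :
  op L (VirL (-1)) (op L (VirL (-1)) w) = t *: op L (VirL (-2)) w ->
  (r + 2) * (r + 1) - t * (r + 2 - beta) != 0 -> S (tm k w).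
Proof.
move=> w2; apply: res_eq0.
have k2 : k + 2 + (-2) = k by rewrite addrK.
have k1 : k + 2 + (-1) = k + 1 by rewrite -addrA.
have k0 : k + 1 + (-1) = k by rewrite addrK.
have S1 : S (tm (k + 1) w) by apply: S_above; rewrite ltrDl.
have S2 : S (tm (k + 2) w) by apply: S_above; rewrite ltrDl.
(* Lowering by two levels must end at index k, so the computation starts at [e (k + 2)]; every term
   with an index above k lies in [S]. *)
have r11 : res (tm (k + 2) (op L (VirL (-1)) (op L (VirL (-1)) w)))
    (wt (-1) (k + 2) * (wt (-1) (k + 1) * 1)).
  apply: res_shift; first by apply: S_shift; rewrite ?k1.
  by rewrite k1; apply: res_shift; rewrite ?k0 //; exact: res_refl.
have r2 : res (tm (k + 2) (op L (VirL (-2)) w)) (wt (-2) (k + 2) * 1).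
  by apply: res_shift; rewrite ?k2 //; exact: res_refl.
have := resD r11 (resZ (- t) r2).
rewrite w2 tmZ scaleNr subrr.
have -> : (r + 2) * (r + 1) - t * (r + 2 - beta) =
  wt (-1) (k + 2) * (wt (-1) (k + 1) * 1) + - t * (wt (-2) (k + 2) * 1).
  by rewrite /wt /r !rmorphD /=; ring.
by [].
Qed.

Lemma null_vector3 (b : K) (r := k%:~R + alpha) :
  op L (VirL (-2)) (op L (VirL (-1)) w) + b *: op L (VirL (-3)) w = 0 ->
  (r + 3 - beta) * (r + 1) + b * (r + 3 - 2 * beta) != 0 -> S (tm k w).
Proof.
move=> w3; apply: res_eq0.
have k3 : k + 3 + (-3) = k by rewrite addrK.
have k2 : k + 3 + (-1) = k + 2 by rewrite -addrA.
have k1 : k + 3 + (-2) = k + 1 by rewrite -addrA.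
have k0 : k + 1 + (-1) = k by rewrite addrK.
have S1 : S (tm (k + 1) w) by apply: S_above; rewrite ltrDl.
have S2 : S (tm (k + 2) w) by apply: S_above; rewrite ltrDl.
have S3 : S (tm (k + 3) w) by apply: S_above; rewrite ltrDl.
have r21 : res (tm (k + 3) (op L (VirL (-2)) (op L (VirL (-1)) w)))
    (wt (-2) (k + 3) * (wt (-1) (k + 1) * 1)).
  apply: res_shift; first by apply: S_shift; rewrite ?k2.
  by rewrite k1; apply: res_shift; rewrite ?k0 //; exact: res_refl.
have r3 : res (tm (k + 3) (op L (VirL (-3)) w)) (wt (-3) (k + 3) * 1).
  by apply: res_shift; rewrite ?k3 //; exact: res_refl.
have := resD r21 (resZ b r3).
rewrite -tmZ -tmD w3 tm0.
have -> : (r + 3 - beta) * (r + 1) + b * (r + 3 - 2 * beta) =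
  wt (-2) (k + 3) * (wt (-1) (k + 1) * 1) + b * (wt (-3) (k + 3) * 1).
  by rewrite /wt /r !rmorphD /=; ring.
by [].
Qed.

Lemma null_vector4 (a b : K) (r := k%:~R + alpha) :
  op L (VirL (-2)) (op L (VirL (-2)) w)
  + a *: op L (VirL (-3)) (op L (VirL (-1)) w) + b *: op L (VirL (-4)) w = 0 ->
  (r + 4 - beta) * (r + 2 - beta) + a * ((r + 4 - 2 * beta) * (r + 1))
  + b * (r + 4 - 3 * beta) != 0 -> S (tm k w).
Proof.
move=> w4; apply: res_eq0.
have k4 : k + 4 + (-4) = k by rewrite addrK.
have k3 : k + 4 + (-1) = k + 3 by rewrite -addrA.
have k2 : k + 4 + (-2) = k + 2 by rewrite -addrA.
have k1 : k + 4 + (-3) = k + 1 by rewrite -addrA.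
have k20 : k + 2 + (-2) = k by rewrite addrK.
have k10 : k + 1 + (-1) = k by rewrite addrK.
have S1 : S (tm (k + 1) w) by apply: S_above; rewrite ltrDl.
have S2 : S (tm (k + 2) w) by apply: S_above; rewrite ltrDl.
have S3 : S (tm (k + 3) w) by apply: S_above; rewrite ltrDl.
have S4 : S (tm (k + 4) w) by apply: S_above; rewrite ltrDl.
have r22 : res (tm (k + 4) (op L (VirL (-2)) (op L (VirL (-2)) w)))
    (wt (-2) (k + 4) * (wt (-2) (k + 2) * 1)).
  apply: res_shift; first by apply: S_shift; rewrite ?k2.
  by rewrite k2; apply: res_shift; rewrite ?k20 //; exact: res_refl.
have r31 : res (tm (k + 4) (op L (VirL (-3)) (op L (VirL (-1)) w)))
    (wt (-3) (k + 4) * (wt (-1) (k + 1) * 1)).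
  apply: res_shift; first by apply: S_shift; rewrite ?k3.
  by rewrite k1; apply: res_shift; rewrite ?k10 //; exact: res_refl.
have r4 : res (tm (k + 4) (op L (VirL (-4)) w)) (wt (-4) (k + 4) * 1).
  by apply: res_shift; rewrite ?k4 //; exact: res_refl.
have := resD (resD r22 (resZ a r31)) (resZ b r4).
rewrite -!tmZ -!tmD w4 tm0.
have -> : (r + 4 - beta) * (r + 2 - beta) + a * ((r + 4 - 2 * beta) * (r + 1))
    + b * (r + 4 - 3 * beta) =
  wt (-2) (k + 4) * (wt (-2) (k + 2) * 1)
  + a * (wt (-3) (k + 4) * (wt (-1) (k + 1) * 1)) + b * (wt (-4) (k + 4) * 1).
  by rewrite /wt /r !rmorphD /=; ring.
by [].
Qed.

End Residue.

Hypothesis loc_nilp : forall x : L, eventually (fun n => op L (VirL n) x = 0).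

(** Fails only if beta = 0 and k + alpha = 0, that is, when every L_n kills [e k]. In the modules V'
    such an [e k] is zero. *)
Definition nondeg k := (beta != 0) || (k%:~R + alpha != 0).

Section Separation.
Variable S : submod T.

Lemma op2_sum (D : seq int) (x : int -> L) (N a b : nat) :
  (forall k, k \in D -> forall n, (N <= n)%N -> op L (VirL n) (x k) = 0) ->
  (N <= a)%N -> (N <= b)%N -> S (\sum_(k <- D) tm k (x k)) ->
  S (\sum_(k <- D) (wt b k * wt a (k + b)) *: tm (k + (a + b)%N) (x k)).
Proof.
move=> xN Na Nb /(submod_op (VirL b))/(submod_op (VirL a)).
rewrite !linear_sum /= !big_seq (eq_bigr (fun k =>
  (wt b k * wt a (k + b)) *: tm (k + (a + b)%N) (x k))) // => k kD.
rewrite tm_op xN // tm0 addr0 linearZ /= tm_op xN // tm0 addr0 scalerA mulrNN.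
by congr (_ *: tm _ _); lia.
Qed.

(* For a + b = p fixed, the coefficient of [L_a L_b] on [e k] is quadratic in a:
   its second difference is 2 beta (1 - beta) and its first difference is
   k up to a constant. *)
Lemma separate (D : seq int) (x : int -> L) (k1 : int) (P : nat) :
  beta != 1 -> (forall k, k \in D -> nondeg k) ->
  S (\sum_(k <- D) tm k (x k)) ->
  exists p : nat, exists2 c : int -> K, (P <= p)%N /\
    (forall k, k \in D -> k != k1 -> c k != 0) /\ c k1 = 0 &
    S (\sum_(k <- D) c k *: tm (k + p) (x k)).
Proof.
move=> beta1 Dnd Sz.
have [|N HN] := @eventually_all _ D (fun k n => op L (VirL n) (x k) = 0).
  by move=> k _; exact: loc_nilp.
have xN k : k \in D -> forall n, (N <= n)%N -> op L (VirL n) (x k) = 0.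
  by move=> kD n /HN; apply.
pose p := (N + (N + 2 + P))%N.
pose Z (c : int -> K) := \sum_(k <- D) c k *: tm (k + p) (x k).
have ZD c d a : S (Z c) -> S (Z d) -> S (Z (fun k => a * c k + d k)).
  move=> Sc Sd; have -> : Z (fun k => a * c k + d k) = a *: Z c + Z d.
    rewrite /Z scaler_sumr -big_split; apply: eq_bigr => k _.
    by rewrite scalerDl scalerA.
  exact: submodD.
have Zeq c d : c =1 d -> S (Z c) -> S (Z d).
  by move=> cd; rewrite /Z (eq_bigr _ (fun k _ => congr1 (fun a => a *: _) (cd k))).
pose q (a b : nat) (k : int) := wt b k * wt a (k + b).
(* [S0], [S1], [S2] are three consecutive splittings of p, with both indices at least [N] so that
   the second factors are killed. *)
have Sq a b : (N <= a)%N -> (N <= b)%N -> (a + b = p)%N -> S (Z (q a b)).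
  by move=> Na Nb abp; rewrite /Z -abp; exact: (op2_sum xN Na Nb Sz).
have S0 : S (Z (q N (N + 2 + P)%N)) by apply: Sq; rewrite ?/p; lia.
have S1 : S (Z (q N.+1 (N + 1 + P)%N)).
  by apply: Sq; rewrite ?/p; lia.
have S2 : S (Z (q N.+2 (N + P)%N)) by apply: Sq; rewrite ?/p; lia.
pose g := beta * (1 - beta).
have intrN (n : nat) : n%:Z%:~R = n%:R :> K by [].
have Slin : S (Z (fun k => k%:~R + (alpha + beta - g * (2 * N%:R + 1)
                 - p%:R * beta ^+ 2 + 2 * p%:R * beta))).
  apply: Zeq (ZD _ _ (-1) S1 S0) => k.
  by rewrite /q /wt /g !rmorphD /= !intrN /p -addn1 !natrD; ring.
have Squad : S (Z (fun=> 2 * g)).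
  apply: Zeq (ZD _ _ (-2) S1 (ZD _ _ 1 S2 S0)) => k.
  by rewrite /q /wt /g !rmorphD /= !intrN /p -addn2 -addn1 !natrD; ring.
have Pp : (P <= p)%N by rewrite /p !addnA leq_addl.
have [b0|b0] := eqVneq beta 0; last first.
  exists p, (fun k => (k - k1)%:~R).
    split=> //; split=> [k _ kk1|]; last by rewrite subrr.
    by rewrite intr_eq0 subr_eq0.
  have g0 : 2 * g != 0.
    by rewrite mulf_neq0 ?pnatr_eq0 // mulf_neq0 // subr_eq0 eq_sym.
  move: Slin; set c0 := (X in S (Z (fun k => _ + X))) => Slin.
  apply: Zeq (ZD _ _ (- (k1%:~R + c0) / (2 * g)) Squad Slin) => k.
  by rewrite divfK // rmorphB /=; ring.
(* For beta = 0 the constant [2 * g] is zero and cannot be used to cancel. Here L_a L_b has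
   coefficient (k + alpha)(k + alpha + b), and a multiple of k + alpha, given by [Slin], is
   subtracted. The extra factor is non-zero by nondegeneracy. *)
exists p, (fun k => (k%:~R + alpha) * (k - k1)%:~R).
  split=> //; split=> [k kD kk1|]; last by rewrite subrr mulr0.
  rewrite mulf_neq0 ?intr_eq0 ?subr_eq0 //.
  by have := Dnd k kD; rewrite /nondeg b0 eqxx.
apply: Zeq (ZD _ _ (- (N + 2 + P)%:R - (k1%:~R + alpha)) Slin S0) => k.
by rewrite /q /wt /g b0 !rmorphD !rmorphN /= !intrN; ring.
Qed.

(** Induction on the number of terms: [separate] removes the index k1, keeps all others and shifts
    them by a common p. *)
Lemma single_term (D : seq int) (x : int -> L) :
  beta != 1 -> uniq D -> D != [::] ->
  (forall k, k \in D -> x k != 0 /\ nondeg k) -> S (\sum_(k <- D) tm k (x k)) ->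
  exists k y, [/\ y != 0, nondeg k & S (tm k y)].
Proof.
move=> beta1; have [n] := ubnP (size D); elim: n => // n IHn in D x *.
case: D => // k1 [|k2 D] szD Du _ Dx Sz.
  exists k1, (x k1); rewrite big_seq1 in Sz.
  by have [|? ?] := Dx k1 _; rewrite ?mem_head.
(* For shifts p >= P every index k + p is nondegenerate, whatever beta is, so the induction can
   continue. *)
have [P HP] : eventually (fun n => forall k, k \in k1 :: k2 :: D ->
    k%:~R + alpha + n%:R * 1 != 0 :> K).
  apply: eventually_all => k _; apply: eventually_neq0.
  by rewrite oner_eq0 orbT.
have [|p [c [Pp [c0 ck1]] Sc]] := separate k1 P beta1 _ Sz.
  by move=> k /Dx[].
pose D' := k2 :: D.
apply: (IHn [seq k + p%:Z | k <- D'] (fun k : int => c (k - p%:Z) *: x (k - p%:Z))) => //.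
- by rewrite size_map -ltnS.
- rewrite map_inj_uniq; last exact: addIr.
  by move: Du; rewrite /= => /andP[].
- move=> _ /mapP[k kD' ->]; rewrite addrK.
  have kD : k \in k1 :: D' by rewrite in_cons kD' orbT.
  have kk1 : k != k1 by apply: contraTneq kD' => ->; case/andP: Du.
  have [xk _] := Dx k kD; split; first by rewrite scaler_eq0 negb_or c0.
  rewrite /nondeg rmorphD /= addrAC.
  by have := HP p Pp k kD; rewrite mulr1 => ->; rewrite orbT.
- have E (k : int) : tm (k + p) (c (k + p%:Z - p%:Z) *: x (k + p%:Z - p%:Z))
      = c k *: tm (k + p) (x k) by rewrite tmZ addrK.
  rewrite big_map (eq_bigr _ (fun k _ => E k)).
  by move: Sc; rewrite big_cons ck1 scale0r add0r.
Qed.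

End Separation.

Hypothesis tm_deg : forall k x, ~~ nondeg k -> tm k x = 0.

Lemma tm_repr (z : T) : exists (D : seq int) (x : int -> L),
  uniq D /\ z = \sum_(k <- D) tm k (x k).
Proof.
move: z; apply: tm_span => [a y z [D [x [Du ->]]] [D' [x' [Du' ->]]]|k x].
  pose ext (D : seq int) (x : int -> L) k := if k \in D then x k else 0.
  have extE (E F : seq int) (x0 : int -> L) : uniq E -> {subset E <= F} -> uniq F ->
      \sum_(k <- E) tm k (x0 k) = \sum_(k <- F) tm k (ext E x0 k).
    move=> Eu EF Fu; rewrite [RHS](bigID (mem E) predT) /= [X in _ + X]big1.
      rewrite addr0 -[RHS]big_filter (perm_big [seq k <- F | k \in E]) /=.
        by rewrite !big_filter; apply: eq_bigr => k kE; rewrite /ext kE.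
      apply: uniq_perm; rewrite ?filter_uniq // => k.
      by rewrite mem_filter; case: (boolP (k \in E)) => // /EF ->.
    by move=> k /negPf kE; rewrite /ext kE tm0.
  pose F := undup (D ++ D'); have Fu : uniq F by exact: undup_uniq.
  exists F, (fun k => a *: ext D x k + ext D' x' k); split=> //.
  rewrite (extE D F) // => [|k kD]; last by rewrite mem_undup mem_cat kD.
  rewrite (extE D' F) // => [|k kD]; last by rewrite mem_undup mem_cat kD orbT.
  by rewrite scaler_sumr -big_split; apply: eq_bigr => k _; rewrite tm_linear.
by exists [:: k], (fun=> x); rewrite big_seq1.
Qed.

Lemma submod_tm (S : submod T) (z : T) : beta != 1 -> z != 0 -> S z ->
  exists k y, [/\ y != 0, nondeg k & S (tm k y)].
Proof.
have [D [x [Du ->]]] := tm_repr z => beta1 z0 Sz.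
pose P k := (x k != 0) && nondeg k.
have DE : \sum_(k <- D) tm k (x k) = \sum_(k <- D | P k) tm k (x k).
  rewrite (bigID P) /= [X in _ + X]big1 ?addr0 // => k.
  rewrite /P negb_and negbK => /orP[/eqP->|kd]; first exact: tm0.
  by rewrite tm_deg.
rewrite DE -big_filter in Sz z0.
apply: single_term Sz => //; first exact: filter_uniq.
  by apply: contraNneq z0 => ->; rewrite big_nil.
by move=> k; rewrite mem_filter => /andP[/andP[]].
Qed.

Section Irreducible.
Variables (w : L).
Hypothesis beta1 : beta != 1.
Hypothesis L_simple : forall S : submod L,
  (exists2 u : L, u != 0 & S u) -> forall u, S u.
Hypothesis w0 : w != 0.
Hypothesis down : forall (S : submod T) k,
  nondeg k -> (forall m, k < m -> S (tm m w)) -> S (tm k w).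

Lemma tm_irreducible (S : submod T) :
  (forall u, S u -> u = 0) \/ (forall u, S u).
Proof.
have [[z [Sz z0]]|H] := pselect (exists z, S z /\ z != 0); last first.
  by left=> u Su; apply/eqP; apply: contrapT => /negP u0; apply: H; exists u.
right; have [k [y [y0 kd Sky]]] := submod_tm beta1 z0 Sz.
pose A (x : L) := exists N : int, forall m, N <= m -> S (tm m x).
have A0 : A 0 by exists 0 => m _; rewrite tm0; exact: submod0.
have AD a (x x' : L) : A x -> A x' -> A (a *: x + x').
  move=> [N HN] [N' HN']; exists (Num.max N N') => m.
  rewrite ge_max => /andP[h h']; rewrite tm_linear.
  by apply: submodD; [exact: HN|exact: HN'].
have AL b (x : L) : A x -> A (op L b x).
  case: b => [|n] [N HN].
    by exists N => m h; rewrite -tm_opC; apply: submod_op; exact: HN.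
  exists (N + `|n|) => m h; apply: S_shift; apply: HN; lia.
(* For n large, L_n kills y, so it maps [tm k y] to a multiple of [tm (k + n) y]. The factor is
   [wt n k], affine in n and not identically zero because k is nondegenerate. *)
have Ay : A y.
  have [N HN] := loc_nilp y.
  have [|N' HN'] := @eventually_neq0 K (k%:~R + alpha + beta) beta.
    apply: contraTT kd; rewrite /nondeg negb_or !negbK => /andP[h /eqP b0].
    by rewrite b0 eqxx /=; rewrite b0 addr0 in h; rewrite h.
  exists (k + (maxn N N')%:Z) => m h.
  have [n mE] : exists n : nat, m = k + n%:Z by exists `|m - k|%N; lia.
  have /andP[Nn N'n] : (N <= n)%N && (N' <= n)%N by rewrite -geq_max; lia.
  have := submod_op (VirL n) Sky; rewrite tm_op HN // tm0 addr0 -mE.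
  by apply: submod_scaleI; rewrite oppr_eq0; exact: HN'.
have Aall x : A x by apply: (@L_simple (Submod A0 AD AL)); exists y.
have [N HN] := Aall w.
have Sw m : S (tm m w).
  have [j mj] : exists j : nat, N - j%:Z <= m by exists `|N - m|%N; lia.
  elim: j m mj => [|j IHj] m mj; first by apply: HN; lia.
  have [lt_m|] := ltP m (N - j%:Z); last exact: IHj.
  have [md|md] := boolP (nondeg m); last by rewrite tm_deg //; exact: submod0.
  by apply: down => // i mi; apply: IHj; lia.
pose B (x : L) := forall m, S (tm m x).
have B0 : B 0 by move=> m; rewrite tm0; exact: submod0.
have BD a (x x' : L) : B x -> B x' -> B (a *: x + x').
  by move=> h h' m; rewrite tm_linear; exact: submodD.
have BL b (x : L) : B x -> B (op L b x).
  case: b => [|n] h m; first by rewrite -tm_opC; exact: submod_op.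
  exact: S_shift.
have Ball x : B x by apply: (@L_simple (Submod B0 BD BL)); exists w.
by apply: tm_span => [a y' z' ? ?|m x]; [exact: submodD|exact: Ball].
Qed.

End Irreducible.

End IntermediateTensor.

(** * Highest weight modules *)

Lemma quot_lift (K : fieldType) (M : opMod K) (S : submod M) (W : lmodType K)
    (f : {linear M -> W}) :
  (forall u, S u -> f u = 0) ->
  exists g : {linear quotMod S -> W}, forall u, g (quot_pi S u) = f u.
Proof.
move=> fS; pose g0 (q : quotMod S) : W := f (repr (q : quot_car S)).
have g0E u : g0 (quot_pi S u) = f u.
  apply/eqP; rewrite -subr_eq0 -linearB; apply/eqP/fS/quot_piP.
  exact: quot_reprK.
have g0L : linear g0.
  move=> a p q; rewrite -[p]quot_reprK -[q]quot_reprK -linearP !g0E.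
  by rewrite linearP.
pose g : {linear quotMod S -> W} := HB.pack g0 (GRing.isLinear.Build _ _ _ _ g0 g0L).
by exists g.
Qed.

Section PositiveKernel.
Variables (K : fieldType) (M : virMod K) (c eta : K) (f : {scalar M}).
Hypothesis MC : forall u, op M VirC u = c *: u.
Hypothesis f_neg : forall (n : int) u, n < 0 -> f (op M (VirL n) u) = 0.
Hypothesis f_zero : forall u, f (op M (VirL 0) u) = eta * f u.

Definition pos_word (s : seq nat) (u : M) : M :=
  foldr (fun k => op M (VirL k.+1%:Z)) u s.

Lemma pos_word_linear s : linear (pos_word s).
Proof. by elim: s => [//|k s IHs] a u v; rewrite /= -/(pos_word _ _) IHs linearP. Qed.
HB.instance Definition _ s :=
  GRing.isLinear.Build K M M *:%R (pos_word s) (pos_word_linear s).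

Definition pos_ker_mem (u : M) := forall s, f (pos_word s u) = 0.

Lemma pos_ker0 : pos_ker_mem 0.
Proof. by move=> s; rewrite !linear0. Qed.

Lemma pos_kerD a u v : pos_ker_mem u -> pos_ker_mem v -> pos_ker_mem (a *: u + v).
Proof. by move=> fu fv s; rewrite !linearP /= fu fv mulr0 addr0. Qed.

Lemma pos_ker_pos (k : nat) u : pos_ker_mem u -> pos_ker_mem (op M (VirL k.+1) u).
Proof.
by move=> fu s; have := fu (rcons s k); rewrite /pos_word foldr_rcons.
Qed.

(** The operator of index n <= 0 is moved outwards through the word, where [f] kills it or turns it
    into a scalar. Each commutator leaves a shorter word applied to an operator of any sign; a
    positive one is absorbed into the word. *)
Lemma pos_ker_nonpos (n : int) u : n <= 0 -> pos_ker_mem u ->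
  pos_ker_mem (op M (VirL n) u).
Proof.
move=> n0 fu s; elim/last_ind: s n n0 u fu => [|s k IHs] n n0 u fu.
  have := n0; rewrite le_eqVlt => /predU1P[->|/f_neg->//].
  by rewrite f_zero; have /= -> := fu [::]; rewrite mulr0.
rewrite /pos_word foldr_rcons -/(pos_word _ _) vir_comm !linearD linearZ /=.
rewrite [f (_ *: _)]linearZ /=.
rewrite IHs //; last exact: pos_ker_pos.
have -> : f (pos_word s (op M (VirL (n + k.+1%:Z)) u)) = 0.
  have [m0|m0] := leP (n + k.+1%:Z) 0; first exact: IHs.
  have -> : n + k.+1%:Z = `|(n + k.+1%:Z)%R|%N.-1.+1%:Z by lia.
  exact: pos_ker_pos.
rewrite mulr0 !add0r; case: ifP => _; last by rewrite !linear0.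
by rewrite MC !linearZ /= fu !mulr0.
Qed.

Lemma pos_ker_op x u : pos_ker_mem u -> pos_ker_mem (op M x u).
Proof.
case: x => [|n] fu.
  by rewrite MC => s; rewrite !linearZ /= fu mulr0.
have [n0|n0] := leP n 0; first exact: pos_ker_nonpos.
have -> : n = `|n|%N.-1.+1%:Z by lia.
exact: pos_ker_pos.
Qed.

(* The largest submodule contained in the kernel of [f]. *)
Definition pos_ker : submod M := Submod pos_ker0 pos_kerD pos_ker_op.

End PositiveKernel.

Section HighestWeightCyclic.
Variables (K : numFieldType) (c h : K) (M : virMod K) (v : M).
Hypothesis vC : op M VirC v = c *: v.
Hypothesis v0 : op M (VirL 0) v = h *: v.
Hypothesis vpos : forall n : int, 0 < n -> op M (VirL n) v = 0.
Hypothesis cyclic : forall S : submod M, S v -> forall u, S u.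

Lemma central_charge u : op M VirC u = c *: u.
Proof.
pose P (u : M) := op M VirC u = c *: u.
have P0 : P 0 by rewrite /P linear0 scaler0.
have PD a y z : P y -> P z -> P (a *: y + z).
  by rewrite /P linearP => -> ->; rewrite scalerDr !scalerA mulrC.
have Pop x y : P y -> P (op M x y).
  by rewrite /P => E; case: x => [|n]; rewrite -?vir_commC E linearZ /= ?E.
by apply: (@cyclic (Submod P0 PD Pop)).
Qed.

Lemma hw_loc_nilp u : eventually (fun n => op M (VirL n) u = 0).
Proof.
pose P (u : M) := eventually (fun n => op M (VirL n) u = 0).
have P0 : P 0 by exists 0%N => n _; rewrite linear0.
have PD a y z : P y -> P z -> P (a *: y + z).
  move=> Py Pz; have [N HN] := eventually_and Py Pz; exists N => n /HN[yn zn].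
  by rewrite linearP yn zn scaler0 addr0.
have Pop x y : P y -> P (op M x y).
  move=> [N HN]; case: x => [|m].
    by exists N => n Nn; rewrite vir_commC HN // linear0.
  exists (N + `|m|).+1 => n Nn; rewrite vir_comm HN ?linear0 ?add0r; last by lia.
  have [k E Nk] : exists2 k : nat, m + n%:Z = k%:Z & (N <= k)%N.
    by exists `|(m + n%:Z)%R|%N; lia.
  rewrite E HN // scaler0 add0r; case: eqP => // Em.
  by move: Nn; rewrite Em; lia.
by apply: (@cyclic (Submod P0 PD Pop)); exists 1%N => n n0; apply: vpos; lia.
Qed.

Definition neg_word (s : seq nat) : M :=
  foldr (fun k => op M (VirL (- k.+1%:Z))) v s.

Definition word_deg (s : seq nat) : nat := sumn (map succn s).

(** The words are not ordered, so only spanning is claimed. [X] is the linear span, written as the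
    intersection of all linear sets that contain the words; it is a submodule because L_n can be
    commuted to the right through a word, by induction on the word for all n at once. *)
Lemma neg_word_span (P : M -> Prop) :
  P 0 -> (forall a y z, P y -> P z -> P (a *: y + z)) ->
  (forall s, P (neg_word s)) -> forall u, P u.
Proof.
pose closed (P : M -> Prop) :=
  P 0 /\ (forall a y z, P y -> P z -> P (a *: y + z)).
pose X (u : M) := forall P, closed P -> (forall s, P (neg_word s)) -> P u.
have X0 : X 0 by move=> Q [].
have XD a y z : X y -> X z -> X (a *: y + z).
  by move=> Xy Xz Q QD Qs; apply: QD.2; [exact: Xy|exact: Xz].
have Xlin (f : {linear M -> M}) y :
    (forall s, X (f (neg_word s))) -> X y -> X (f y).
  move=> Xf Xy; apply: (Xy (fun u => X (f u))) => //; split.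
    by rewrite linear0.
  by move=> a u u'; rewrite linearP; exact: XD.
have Xneg k y : X y -> X (op M (VirL (- k.+1%:Z)) y).
  by apply: Xlin => s Q _ Qs; exact: (Qs (k :: s)).
have XZ a y : X y -> X (a *: y) by move=> Xy; rewrite -[_ *: _]addr0; exact: XD.
have Xadd y z : X y -> X z -> X (y + z).
  by move=> Xy; rewrite -[y in y + _]scale1r; exact: XD.
have Xw n s : X (op M (VirL n) (neg_word s)).
  elim: s n => [|k s IHs] n.
    have [n0|n0|->] := ltrgtP n 0; last by rewrite v0; apply: XZ => Q _ /(_ [::]).
      have -> : n = - `|n|%N.-1.+1%:Z by lia.
      by apply: Xneg => Q _ /(_ [::]).
    by rewrite vpos.
  rewrite /= -/(neg_word s) vir_comm; apply: (Xadd _ _ _ _).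
    by apply: (Xadd _ _ (Xneg _ _ (IHs _)) (XZ _ _ (IHs _))).
  by case: ifP => // _; rewrite central_charge; apply: (XZ _ _ (XZ _ _ _)) => Q _ /(_ s).
have Xop x y : X y -> X (op M x y).
  case: x => [|n] Xy; first by rewrite central_charge; exact: XZ.
  by apply: Xlin.
have Xall u : X u.
  by apply: (@cyclic (Submod X0 XD Xop)) => Q _ /(_ [::]).
by move=> P0 PD Ps u; exact: Xall.
Qed.

Lemma neg_word_weight s :
  op M (VirL 0) (neg_word s) = (h + (word_deg s)%:R) *: neg_word s.
Proof.
elim: s => [|k s IHs]; first by rewrite /= addr0.
rewrite /= -/(neg_word s) vir_comm IHs linearZ /= sub0r opprK !addr0 -scalerDl.
rewrite /word_deg /= -/(word_deg s) natrD; congr (_ *: _).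
by rewrite -[_%:~R]/(k.+1%:R) -addrA [_ + k.+1%:R]addrC.
Qed.

Section Projection.
Variable f : {scalar M}.
Hypothesis f_neg : forall (n : int) u, n < 0 -> f (op M (VirL n) u) = 0.
Hypothesis f_v : f v = 1.

(* [proj J] kills the weights h + 1, ..., h + J and is nonzero on weight h. *)
Definition proj (J : nat) (u : M) : M :=
  iteri J (fun j u => op M (VirL 0) u - (h + j.+1%:R) *: u) u.

Definition proj_coef (J : nat) (d : K) : K :=
  iteri J (fun j a => (d - j.+1%:R) * a) 1.

Lemma proj_linear J : linear (proj J).
Proof.
elim: J => [//|J IHJ] a u u'; rewrite /proj /= -!/(proj _ _) IHJ linearP.
by rewrite scalerBr !scalerDr opprD addrACA !scalerA [a * _]mulrC.
Qed.
HB.instance Definition _ J :=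
  GRing.isLinear.Build K M M *:%R (proj J) (proj_linear J).

Lemma proj_eigen J d u : op M (VirL 0) u = (h + d) *: u ->
  proj J u = proj_coef J d *: u.
Proof.
move=> ud; elim: J => [|J IHJ]; first by rewrite scale1r.
rewrite /proj /= -/(proj _ _) IHJ linearZ /= ud !scalerA -scalerBl.
by congr (_ *: _); rewrite /proj_coef /= -/(proj_coef _ _); ring.
Qed.

Lemma proj_coef_eq0 J d : (0 < d <= J)%N -> proj_coef J d%:R = 0.
Proof.
elim: J => [|J IHJ] /andP[d0]; first by rewrite leqNgt d0.
rewrite /proj_coef /= -/(proj_coef _ _) leq_eqVlt => /predU1P[->|dJ].
  by rewrite subrr mul0r.
by rewrite IHJ ?d0 // mulr0.
Qed.

Lemma proj_coef_neq0 J : proj_coef J 0 != 0.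
Proof.
elim: J => [|J IHJ]; first exact: oner_neq0.
by rewrite /proj_coef /= mulf_neq0 // sub0r oppr_eq0 pnatr_eq0.
Qed.

Lemma projE u : eventually (fun J => proj J u = (proj_coef J 0 * f u) *: v).
Proof.
move: u; apply: neg_word_span => [|a y z Hy Hz|[|k s]].
- by exists 0%N => J _; rewrite !linear0 mulr0 scale0r.
- have [J0 HJ] := eventually_and Hy Hz; exists J0 => J /HJ[Ey Ez].
  rewrite proj_linear Ey Ez linearP /= scalerA -scalerDl; congr (_ *: _).
  by ring.
- by exists 0%N => J _; rewrite f_v mulr1 (@proj_eigen _ 0) ?addr0.
(* A non-empty word has weight h + d with d > 0; once J >= d the projection kills it, and so does
   [f]. *)
- exists (word_deg (k :: s)) => J leJ.
  rewrite (proj_eigen _ (neg_word_weight _)) proj_coef_eq0; last first.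
    by rewrite leJ andbT /word_deg /=.
  by rewrite /= f_neg ?mulr0 ?scale0r // oppr_lt0.
Qed.

(** A polynomial in L_0 maps u to a non-zero multiple of [f u *: v]. Hence a submodule that avoids
    [v] is contained in the kernel of [f]. *)
Lemma submod_proj (S : submod M) u : S u -> f u != 0 -> S v.
Proof.
move=> Su fu; have [J HJ] := projE u.
have Sproj : S (proj J u).
  elim: J {HJ} => [//|J IHJ]; rewrite /proj /= -/(proj _ _).
  by apply: submodB; [exact: submod_op|exact: submodZ].
apply: submod_scaleI (_ : S ((proj_coef J 0 * f u) *: v)).
  by rewrite mulf_neq0 ?proj_coef_neq0.
by rewrite -HJ.
Qed.

End Projection.
End HighestWeightCyclic.

(** * The Verma module and its universal property *)

Section Verma.
Variables (K : numFieldType) (c h : K).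
Local Notation V := (verma c h).

Definition verma_gen : V := quot_pi (gen (@verma_rel K c h)) (free_gen K).
Local Notation v := verma_gen.

Lemma verma_relE u : verma_rel c h u -> quot_pi (gen (@verma_rel K c h)) u = 0.
Proof. by move=> ru; apply/quot_pi0/mem_gen. Qed.

Lemma verma_opE x u :
  op V x (quot_pi _ u) = quot_pi (gen (@verma_rel K c h)) (op (freeMod K) x u).
Proof. exact: quot_opE. Qed.

Lemma verma_genC : op V VirC v = c *: v.
Proof.
rewrite verma_opE; apply/subr0_eq; rewrite -(verma_relE (VermaC c h)).
by rewrite linearB /= -quot_scaleE.
Qed.

Lemma verma_gen0 : op V (VirL 0) v = h *: v.
Proof.
rewrite verma_opE; apply/subr0_eq; rewrite -(verma_relE (VermaL0 c h)).
by rewrite linearB /= -quot_scaleE.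
Qed.

Lemma verma_gen_pos (n : int) : 0 < n -> op V (VirL n) v = 0.
Proof. by move=> n0; rewrite verma_opE verma_relE //; exact: VermaLpos. Qed.

Lemma verma_cyclic (S : submod V) : S v -> forall u, S u.
Proof.
move=> Sv u; rewrite -[u]quot_reprK; move: (repr u) => {}u.
have Sw w : S (quot_pi (gen (@verma_rel K c h)) (<< w >> : freeMod K)).
  elim: w => [//|x w IHw].
  have -> : (<< x :: w >> : freeMod K) = op (freeMod K) x << w >>.
    by rewrite /= /free_op lextU.
  by rewrite -verma_opE; exact: submod_op.
rewrite [u]monalgE linear_sum; elim/big_rec: _ => [|w y _ Sy]; first exact: submod0.
have -> : << u@_w *g w >> = u@_w *: (<< w >> : freeMod K).
  by apply/malgP => k; rewrite mcoeffZ !mcoeffU mulrnAr mulr1.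
by rewrite linearZ; apply: submodD => //; exact: Sw.
Qed.

Section Universal.
Variables (F : virMod K) (o : F).
Hypothesis oC : op F VirC o = c *: o.
Hypothesis o0 : op F (VirL 0) o = h *: o.
Hypothesis opos : forall n : int, 0 < n -> op F (VirL n) o = 0.

Definition free_eval : freeMod K -> F := lext (foldr (op F) o).
HB.instance Definition _ := GRing.Linear.on free_eval.

Lemma free_eval_gen : free_eval (free_gen K) = o.
Proof. by rewrite /free_eval lextU. Qed.

Lemma free_eval_op x u : free_eval (op (freeMod K) x u) = op F x (free_eval u).
Proof.
move: u; apply: malg_linear_ext => [a y z|a y z|w]; rewrite ?linearP //.
by rewrite /= /free_op /free_eval !lextU.
Qed.

Lemma free_eval_bracket x y u :
  free_eval (bracket_act x y u) = bracket_act x y (free_eval u).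
Proof.
rewrite /bracket_act /lext linear_sum; apply: eq_bigr => z _.
by rewrite linearZ /= free_eval_op.
Qed.

(** The kernel of evaluation at [o] is a submodule, so it suffices to check the defining
    relations. *)
Lemma free_eval_rel u : gen (@verma_rel K c h) u -> free_eval u = 0.
Proof.
pose P (u : freeMod K) := free_eval u = 0.
have P0 : P 0 by rewrite /P linear0.
have PD a y z : P y -> P z -> P (a *: y + z).
  by rewrite /P => Py Pz; rewrite linearP /= Py Pz scaler0 addr0.
have Pop x y : P y -> P (op (freeMod K) x y).
  by rewrite /P free_eval_op => ->; rewrite linear0.
move=> gu; apply: (gu (Submod P0 PD Pop)) => _ [x y z|||n n0];
  rewrite -[submod_mem _ _]/(free_eval _ = 0).
- have feB a b : free_eval (a - b) = free_eval a - free_eval b by exact: linearB.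
  have fe2 a b : free_eval (op (freeMod K) a (op (freeMod K) b z)) =
      op F a (op F b (free_eval z)).
    exact: eq_trans (free_eval_op _ _) (congr1 _ (free_eval_op _ _)).
  apply: (eq_trans (feB _ _)); apply/eqP; rewrite subr_eq0; apply/eqP.
  apply: (eq_trans (feB _ _)); apply: eq_trans (esym (free_eval_bracket _ _ _)).
  by apply: eq_trans (f_equal2 (fun a b => a - b) (fe2 x y) (fe2 y x)) (virModP _ _ _).
- by rewrite linearB linearZ /= free_eval_op free_eval_gen oC subrr.
- by rewrite linearB linearZ /= free_eval_op free_eval_gen o0 subrr.
- by rewrite free_eval_op free_eval_gen opos.
Qed.

Lemma verma_universal : exists g : {linear V -> F},
  g v = o /\ forall x u, g (op V x u) = op F x (g u).
Proof.
have [g gE] := quot_lift free_eval_rel; exists g; split.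
  by rewrite /verma_gen gE; exact: free_eval_gen.
move=> x u; rewrite -[u]quot_reprK verma_opE !gE; exact: free_eval_op.
Qed.

End Universal.
End Verma.

(** * Matrix elements of primary fields *)

Section PrimaryFamilies.
Variable K : numFieldType.

Definition hw_vector (M : virMod K) (c h : K) (v : M) :=
  [/\ op M VirC v = c *: v, op M (VirL 0) v = h *: v &
      forall n : int, 0 < n -> op M (VirL n) v = 0].

(* [phi j] is a matrix element of a primary field of weight 1 - beta between a
   fixed highest weight vector and vectors of level j. *)
Definition primary (M : virMod K) (v : M) (h gamma beta : K)
    (phi : int -> {scalar M}) :=
  [/\ forall j, phi j v = (j == 0)%:R,
      forall (j : int) x, j < 0 -> phi j x = 0,
      forall j x, phi j (op M (VirL 0) x) = (h + j%:~R) * phi j x &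
      forall (k : nat) j x, phi j (op M (VirL (- k.+1%:Z)) x) =
        (j%:~R + gamma - k.+1%:R * beta) * phi (j - k.+1%:Z) x].

(* Consequence of a null vector of level at most 2 in the dual of the target. *)
Definition level_determined (M : virMod K) (phi : int -> {scalar M}) :=
  forall (j : int) x, 0 < j ->
    phi (j - 1) (op M (VirL 1) x) = 0 ->
    phi (j - 2) (op M (VirL 1) (op M (VirL 1) x)) = 0 ->
    phi (j - 2) (op M (VirL 2) x) = 0 -> phi j x = 0.

Lemma primary_neg (M : virMod K) (v : M) h g b phi : primary v h g b phi ->
  forall (n : int) u, n < 0 -> phi 0 (op M (VirL n) u) = 0.
Proof.
move=> [_ phi_neg _ phi_op] n u n0; have -> : n = - `|n|%N.-1.+1%:Z by lia.
by rewrite phi_op phi_neg ?mulr0 //; lia.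
Qed.

Lemma primary_pullback (M N : virMod K) (t : {linear M -> N}) (v : M) (o : N)
    h g b (phi : int -> {scalar N}) :
  t v = o -> (forall x u, t (op M x u) = op N x (t u)) ->
  primary o h g b phi -> level_determined phi ->
  exists2 psi : int -> {scalar M}, primary v h g b psi & level_determined psi.
Proof.
move=> tv t_op [p1 p2 p3 p4] pdet.
have psiL j : scalar (fun u => phi j (t u)) by move=> a x y; rewrite !linearP.
pose psi j : {scalar M} :=
  HB.pack (fun u => phi j (t u)) (GRing.isLinear.Build _ _ _ _ _ (psiL j)).
exists psi; first split => [j|j x|j x|k j x]; rewrite /psi /=.
- by rewrite tv p1.
- exact: p2.
- by rewrite t_op p3.
- by rewrite t_op p4.
by move=> j x j0 /=; rewrite !t_op; exact: pdet.
Qed.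

End PrimaryFamilies.

(** * The radical and the simple quotient *)

Section SimpleQuotient.
Variables (K : numFieldType) (c h : K) (M : virMod K) (v : M).
Hypothesis v_hw : hw_vector c h v.
Hypothesis cyclic : forall S : submod M, S v -> forall u, S u.
Variables (gamma beta : K) (phi : int -> {scalar M}).
Hypothesis phi_primary : primary v h gamma beta phi.

Variables (rad : submod M) (L : virMod K) (pi : {linear M -> L}).
Hypothesis rad_proper : forall S : submod M, ~ S v -> forall u, S u -> rad u.
Hypothesis rad_min : forall T : submod M,
  (forall (S : submod M) u, ~ S v -> S u -> T u) -> forall u, rad u -> T u.
Hypothesis pi_op : forall x u, pi (op M x u) = op L x (pi u).
Hypothesis pi_surj : forall q, exists u, q = pi u.
Hypothesis pi_ker : forall u, pi u = 0 <-> rad u.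

Lemma proper_phi0 (S : submod M) u : ~ S v -> S u -> phi 0 u = 0.
Proof.
move=> Sv Su; apply/eqP; apply: contra_notT Sv => pu.
have [vC v0 vpos] := v_hw; have [p1 _ _ _] := phi_primary.
apply: (submod_proj vC v0 vpos cyclic (primary_neg phi_primary) _ Su pu).
by rewrite p1.
Qed.

(** A proper submodule is killed by [phi 0] and stable under positive words, so it lies in the
    largest submodule contained in the kernel of [phi 0]. The same is then true of the sum of all
    proper submodules, which makes the radical proper. *)
Lemma rad_phi0 u : rad u -> phi 0 u = 0.
Proof.
have [vC v0 vpos] := v_hw; have [_ _ p3 _] := phi_primary.
have MC := central_charge vC cyclic.
have p0 w : phi 0 (op M (VirL 0) w) = h * phi 0 w by rewrite p3 addr0.
pose T := pos_ker MC (primary_neg phi_primary) p0.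
have propT (S : submod M) w : ~ S v -> S w -> T w.
  move=> Sv Sw s; apply: proper_phi0 Sv _; elim: s => [//|k s IHs].
  exact: submod_op.
by move=> /(rad_min propT) /(_ [::]).
Qed.

Lemma rad_gen : ~ rad v.
Proof.
by move=> /rad_phi0; have [-> _ _ _] := phi_primary; apply/eqP/oner_neq0.
Qed.

Lemma pi_gen_neq0 : pi v != 0.
Proof. by apply/negP => /eqP/pi_ker; exact: rad_gen. Qed.

Lemma pi_hw : hw_vector c h (pi v).
Proof.
have [vC v0 vpos] := v_hw; split; rewrite -?pi_op ?vC ?v0 ?linearZ //.
by move=> n n0; rewrite -pi_op vpos // linear0.
Qed.

Section Preimage.
Variable S : submod L.

Lemma preim0 : S (pi 0). Proof. by rewrite linear0; exact: submod0. Qed.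
Lemma preimD a u w : S (pi u) -> S (pi w) -> S (pi (a *: u + w)).
Proof. by rewrite linearP; exact: submodD. Qed.
Lemma preim_op x u : S (pi u) -> S (pi (op M x u)).
Proof. by rewrite pi_op; exact: submod_op. Qed.
Definition preim : submod M := Submod preim0 preimD preim_op.
End Preimage.

Lemma pi_cyclic (S : submod L) : S (pi v) -> forall q, S q.
Proof.
by move=> Sv q; have [u ->] := pi_surj q; exact: (@cyclic (preim S) Sv).
Qed.

Lemma pi_simple (S : submod L) : (exists2 q, q != 0 & S q) -> forall q, S q.
Proof.
move=> [q q0 Sq]; apply: pi_cyclic; apply: contrapT => Sv.
have [u qu] := pi_surj q; move: q0; rewrite qu => /negP; apply; apply/eqP/pi_ker.
by apply: (@rad_proper (preim S)) => //=; rewrite -qu.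
Qed.

(** Strong induction on j from [rad_phi0]: the radical contains L_1 u, L_1^2 u and L_2 u, on which
    the lower forms vanish. *)
Lemma rad_phi : level_determined phi -> forall j u, rad u -> phi j u = 0.
Proof.
have [_ phi_neg _ _] := phi_primary => phi_det j u.
have [j0 _|] := ltP j 0; first exact: phi_neg.
case: j => // j _; have [n] := ubnP j; elim: n => // n IHn in j u *.
case: j => [|j] ltj ru; first exact: rad_phi0.
have IH (i : int) w : i < j.+1%:Z -> rad w -> phi i w = 0.
  have [i0 _ _|] := ltP i 0; first exact: phi_neg.
  by case: i => // i _ lti; apply: IHn; lia.
apply: phi_det => //; apply: IH; (try lia); do ?apply: submod_op => //.
Qed.

Lemma primary_quotient : level_determined phi ->
  exists psi : int -> {scalar L}, primary (pi v) h gamma beta psi.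
Proof.
move=> phi_det; have [p1 p2 p3 p4] := phi_primary.
have repr q : {u | q = pi u} := cid (pi_surj q).
pose g j q := phi j (sval (repr q)).
have gE j u : g j (pi u) = phi j u.
  rewrite /g; case: (repr (pi u)) => w /= uw; apply/eqP; rewrite -subr_eq0.
  by rewrite -linearB rad_phi //; apply/pi_ker; rewrite linearB -uw subrr.
have gL j : scalar (g j).
  move=> a p q; have [u ->] := pi_surj p; have [w ->] := pi_surj q.
  by rewrite -linearP !gE linearP.
pose psi j : {scalar L} :=
  HB.pack (g j) (GRing.isLinear.Build _ _ _ _ _ (gL j)).
exists psi; split => [j|j q j0|j q|k j q]; rewrite /psi /=.
- by rewrite gE p1.
- by have [u ->] := pi_surj q; rewrite gE p2.
- by have [u ->] := pi_surj q; rewrite -pi_op !gE p3.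
- by have [u ->] := pi_surj q; rewrite -pi_op !gE p4.
Qed.

End SimpleQuotient.

Section SingularVectors.
Variables (K : numFieldType) (c h : K) (L : virMod K) (w : L).
Hypothesis w_hw : hw_vector c h w.
Hypothesis cyclic : forall S : submod L, S w -> forall u, S u.
Hypothesis simple : forall S : submod L,
  (exists2 u : L, u != 0 & S u) -> forall u, S u.
Variables (gamma beta : K) (phi : int -> {scalar L}).
Hypothesis phi_primary : primary w h gamma beta phi.

(** [y] lies in the largest submodule in the kernel of [phi 0]: positive words kill it, and
    evaluating [phi 0] on L_0 y in two ways gives d times [phi 0 y] equal to 0. Since [phi 0 w] is
    1, this submodule is not all of L, so by simplicity it is zero. *)
Lemma singular_eq0 (y : L) (d : nat) :
  (0 < d)%N -> op L (VirL 0) y = (h + d%:R) *: y ->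
  op L (VirL 1) y = 0 -> op L (VirL 2) y = 0 -> y = 0.
Proof.
move=> d0 y0 y1 y2; apply/eqP/negPn/negP => y_neq0.
have [wC _ _] := w_hw; have [p1 _ p3 _] := phi_primary.
have LC := central_charge wC cyclic.
have p0 u : phi 0 (op L (VirL 0) u) = h * phi 0 u by rewrite p3 addr0.
pose T := pos_ker LC (primary_neg phi_primary) p0.
have ypos (n : nat) : op L (VirL n.+1) y = 0.
  case: n => // n; elim: n => // n IHn.
  (* L_1 and L_2 generate the positive part: the commutator of L_1 and L_(n+2) is -(n + 1)
     L_(n+3). *)
  have := vir_comm 1 n.+2 y; rewrite y1 IHn !linear0 /= addr0 add0r.
  move=> /esym/eqP; rewrite scaler_eq0 intr_eq0 => /orP[|/eqP]; first by lia.
  by rewrite addrC.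
have py : phi 0 y = 0.
  have /eqP := p0 y; rewrite y0 linearZ /= mulrDl -subr_eq0 addrAC subrr add0r.
  by rewrite mulf_eq0 pnatr_eq0 eqn0Ngt d0 => /eqP.
have Ty : T y.
  move=> s; case/lastP: s => [//|s k].
  by rewrite /pos_word foldr_rcons ypos -/(pos_word s 0) !linear0.
have := @simple T (ex_intro2 _ _ y y_neq0 Ty) w [::].
by rewrite /= p1 => /eqP; rewrite oner_eq0.
Qed.

End SingularVectors.

(** * Virasoro action on a Heisenberg module *)

Section Heisenberg.
Variables (K : numFieldType) (F : lmodType K).
Variables (kappa lam tau : K) (a : int -> {linear F -> F}) (vac : F).
Variable phi : int -> {scalar F}.
Hypothesis kappa0 : kappa != 0.
Hypothesis a_comm : forall m n u, a m (a n u) =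
  a n (a m u) + (if m + n == 0 then kappa * m%:~R else 0) *: u.
Hypothesis a_zero : forall u, a 0 u = lam *: u.
Hypothesis a_vac : forall n : int, 0 < n -> a n vac = 0.
Hypothesis a_nilp : forall u, exists N : nat, forall n : int, N%:Z < n -> a n u = 0.
Hypothesis fock_ind : forall P : F -> Prop,
  P 0 -> (forall b u w, P u -> P w -> P (b *: u + w)) -> P vac ->
  (forall (k : nat) u, P u -> P (a (- k.+1%:Z) u)) -> forall u, P u.
Hypothesis vac_unique : forall u,
  (forall k : nat, a k.+1%:Z u = 0) -> u = phi 0 u *: vac.
Hypothesis phi_vac : forall j, phi j vac = (j == 0)%:R.
Hypothesis phi_neg : forall (j : int) u, j < 0 -> phi j u = 0.
Hypothesis phi_create : forall (k : nat) j u,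
  phi j (a (- k.+1%:Z) u) = phi (j - k.+1%:Z) u.

Definition lo (n : int) : int := if n < 0 then n else 0.
Definition hi (n : int) : int := if n < 0 then 0 else n.

Lemma lo_hi n : lo n + hi n = n.
Proof. by rewrite /lo /hi; case: ifP; rewrite ?addr0 ?add0r. Qed.

(* Truncation at N of the Sugawara sum (1 / 2 kappa) sum_i :a_i a_(n-i):
   with background charge tau; the terms with lo n <= i <= hi n are the finite
   second sum, the remaining ones occur in pairs and are normally ordered. *)
Definition sug (n : int) (N : nat) (u : F) : F :=
  kappa^-1 *: (\sum_(k < N) a (lo n - k.+1%:Z) (a (hi n + k.+1%:Z) u))
  + (2 * kappa)^-1 *: (\sum_(i < `|n|.+1) a (lo n + i%:Z) (a (hi n - i%:Z) u))
  + (tau * n%:~R) *: a n u - (if n == 0 then kappa * tau ^+ 2 / 2 else 0) *: u.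

Lemma sug_linear n N : linear (sug n N).
Proof.
pose s1 x := \sum_(k < N) a (lo n - k.+1%:Z) (a (hi n + k.+1%:Z) x).
pose s2 x := \sum_(i < `|n|.+1) a (lo n + i%:Z) (a (hi n - i%:Z) x).
have s1L : linear s1.
  move=> b u w; rewrite /s1 scaler_sumr -big_split; apply: eq_bigr => k _.
  by rewrite !linearP.
have s2L : linear s2.
  move=> b u w; rewrite /s2 scaler_sumr -big_split; apply: eq_bigr => k _.
  by rewrite !linearP.
move=> b u w; rewrite /sug -!/(s1 _) -!/(s2 _) s1L s2L linearP /=; module K.
Qed.

Definition vanish (u : F) (N : nat) := forall n : int, N%:Z < n -> a n u = 0.

Lemma sug_stable n u N N' : vanish u N -> vanish u N' -> sug n N u = sug n N' u.
Proof.
wlog leN : N N' / (N <= N')%N => [H vN vN'|vN _].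
  by case/orP: (leq_total N N') => h; [|symmetry]; apply: H.
rewrite /sug; suff -> : \sum_(k < N) a (lo n - k.+1%:Z) (a (hi n + k.+1%:Z) u) =
  \sum_(k < N') a (lo n - k.+1%:Z) (a (hi n + k.+1%:Z) u) by [].
rewrite -(subnKC leN); elim: (N' - N)%N => [|d IHd]; first by rewrite addn0.
rewrite addnS big_ord_recr /= -IHd vN ?linear0 ?addr0 //.
by rewrite /hi; case: ifP => //; lia.
Qed.

Lemma vanish_large u : eventually (vanish u).
Proof. by have [N HN] := a_nilp u; exists N => M NM n Mn; apply: HN; lia. Qed.

(** The truncation depends on the vector; linearity holds because, by [sug_stable], one larger N
    serves several vectors. *)
Lemma vir_op_spec : {V : int -> {linear F -> F} |
  forall n u N, vanish u N -> V n u = sug n N u}.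
Proof.
pose V0 (n : int) u := sug n (sval (cid (a_nilp u))) u.
have V0E n u N : vanish u N -> V0 n u = sug n N u.
  by move=> uN; apply: sug_stable => //; rewrite /vanish; case: cid.
have V0L n : linear (V0 n).
  move=> b u w; have [N HN] := eventually_and (vanish_large u) (vanish_large w).
  have [uN wN] := HN N (leqnn N).
  rewrite (V0E n u N uN) (V0E n w N wN) -sug_linear; apply: V0E => m Nm.
  by rewrite linearP uN // wN // scaler0 addr0.
pose V n : {linear F -> F} :=
  HB.pack (V0 n) (GRing.isLinear.Build _ _ _ _ _ (V0L n)).
by exists V => n u N; exact: V0E.
Qed.

Definition vir_op := sval vir_op_spec.

Lemma vir_opE n u N : vanish u N -> vir_op n u = sug n N u.
Proof. exact: (svalP vir_op_spec). Qed.

Lemma a_comm2 m n l u : a m (a n (a l u)) = a l (a m (a n u)) +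
  (if n + l == 0 then kappa * n%:~R else 0) *: a m u +
  (if m + l == 0 then kappa * m%:~R else 0) *: a n u.
Proof.
by rewrite (a_comm n l) linearD linearZ /= (a_comm m l) addrAC.
Qed.

Lemma sum_delta (N : nat) (z : int) (x : F) :
  \sum_(k < N) (if k%:Z == z then x else 0) =
  if (0 <= z) && (z < N%:Z) then x else 0.
Proof.
case: ifP => [/andP[z0 zN]|zN]; last first.
  by rewrite big1 // => k _; case: eqP => // kz; have := ltn_ord k; lia.
case: z z0 zN => // m _ mN; have {}mN : (m < N)%N by lia.
rewrite (bigD1 (Ordinal mN)) //= eqxx big1 ?addr0 // => k kN.
by rewrite ifN //; apply: contra kN => /eqP[km]; apply/eqP/val_inj.
Qed.

Lemma sug_a n l N u : (`|n| + `|l| < N)%N ->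
  sug n N (a l u) = a l (sug n N u) - l%:~R *: a (n + l) u
    + (if n + l == 0 then tau * kappa * n%:~R ^+ 2 else 0) *: u.
Proof.
move=> Nl; pose X := - (kappa * l%:~R) *: a (n + l) u.
pose S1 := \sum_(k < N) a (lo n - k.+1%:Z) (a (hi n + k.+1%:Z) u).
pose S2 := \sum_(i < `|n|.+1) a (lo n + i%:Z) (a (hi n - i%:Z) u).
pose e0 := if n == 0 then kappa * tau ^+ 2 / 2 else 0.
have s1 : \sum_(k < N) a (lo n - k.+1%:Z) (a (hi n + k.+1%:Z) (a l u)) = a l S1 +
    (if (l <= - hi n - 1) then X else 0) + (if (1 - lo n <= l) then X else 0).
  rewrite /S1 linear_sum /=.
  (* The indicator of a range of l becomes a sum over k, so that it matches the commutator terms one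
     by one. *)
  have -> : (if l <= - hi n - 1 then X else 0) =
      \sum_(k < N) (if k%:Z == - l - hi n - 1 then X else 0).
    by rewrite sum_delta; congr (if _ then _ else _); rewrite /hi; case: ifP; lia.
  have -> : (if 1 - lo n <= l then X else 0) =
      \sum_(k < N) (if k%:Z == lo n + l - 1 then X else 0).
    by rewrite sum_delta; congr (if _ then _ else _); rewrite /lo; case: ifP; lia.
  rewrite -!big_split; apply: eq_bigr => k _; rewrite a_comm2 /=; congr (_ + _ + _).
    have -> : (hi n + k.+1%:Z + l == 0) = (k%:Z == - l - hi n - 1) by lia.
    case: eqP => [kE|_]; last by rewrite scale0r.
    have -> : hi n + k.+1%:Z = - l by lia.
    have -> : lo n - k.+1%:Z = n + l by have := lo_hi n; lia.
    by rewrite /X rmorphN mulrN.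
  have -> : (lo n - k.+1%:Z + l == 0) = (k%:Z == lo n + l - 1) by lia.
  case: eqP => [kE|_]; last by rewrite scale0r.
  have -> : lo n - k.+1%:Z = - l by lia.
  have -> : hi n + k.+1%:Z = n + l by have := lo_hi n; lia.
  by rewrite /X rmorphN mulrN.
have s2 : \sum_(i < `|n|.+1) a (lo n + i%:Z) (a (hi n - i%:Z) (a l u)) = a l S2 +
    (if (- hi n <= l <= - lo n) then X else 0) +
    (if (- hi n <= l <= - lo n) then X else 0).
  have E1 : (if (- hi n <= l <= - lo n) then X else 0) =
      \sum_(k < `|n|.+1) (if k%:Z == hi n + l then X else 0).
    rewrite sum_delta; congr (if _ then _ else _); rewrite /hi /lo.
    by case: ifP; lia.
  have E2 : (if (- hi n <= l <= - lo n) then X else 0) =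
      \sum_(k < `|n|.+1) (if k%:Z == - l - lo n then X else 0).
    rewrite sum_delta; congr (if _ then _ else _); rewrite /hi /lo.
    by case: ifP; lia.
  rewrite /S2 linear_sum /= {1}E1 E2.
  rewrite -!big_split; apply: eq_bigr => k _; rewrite a_comm2 /=; congr (_ + _ + _).
    have -> : (hi n - k%:Z + l == 0) = (k%:Z == hi n + l) by lia.
    case: eqP => [kE|_]; last by rewrite scale0r.
    have -> : hi n - k%:Z = - l by lia.
    have -> : lo n + k%:Z = n + l by have := lo_hi n; lia.
    by rewrite /X rmorphN mulrN.
  have -> : (lo n + k%:Z + l == 0) = (k%:Z == - l - lo n) by lia.
  case: eqP => [kE|_]; last by rewrite scale0r.
  have -> : lo n + k%:Z = - l by lia.
  have -> : hi n - k%:Z = n + l by have := lo_hi n; lia.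
  by rewrite /X rmorphN mulrN.
have s3 : a n (a l u) = a l (a n u) +
    (if n + l == 0 then kappa * n%:~R else 0) *: u by exact: a_comm.
(* The position of l selects what contributes: outside the middle range exactly one term of the
   first sum, with weight 1/kappa, and inside it two terms of the second sum, with weight 1/(2
   kappa) each. The result is the same. *)
have E : kappa^-1 *: ((if (l <= - hi n - 1) then X else 0)
    + (if (1 - lo n <= l) then X else 0))
  + (2 * kappa)^-1 *: ((if (- hi n <= l <= - lo n) then X else 0) +
    (if (- hi n <= l <= - lo n) then X else 0)) = - l%:~R *: a (n + l) u.
  have XE : kappa^-1 *: X = - l%:~R *: a (n + l) u.
    by rewrite /X scalerA mulrN mulrA mulVf // mul1r.
  have lohi : lo n <= hi n by rewrite /lo /hi; case: ifP; lia.
  rewrite -XE; have [h1|h1] := leP l (- hi n - 1).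
    rewrite ifN; last by lia.
    by rewrite ifN ?addr0 ?scaler0 ?addr0 //; lia.
  have [h2|h2] := leP (1 - lo n) l.
    by rewrite ifN ?addr0 ?add0r ?scaler0 ?addr0 //; lia.
  rewrite ifT; last by lia.
  rewrite addr0 scaler0 add0r -mulr2n -scaler_nat scalerA invfM mulrAC mulVf ?mul1r //.
  by rewrite pnatr_eq0.
have aZ b x : a l (b *: x) = b *: a l x by exact: linearZ.
have s0 : a l (sug n N u) = kappa^-1 *: a l S1 + (2 * kappa)^-1 *: a l S2
    + (tau * n%:~R) *: a l (a n u) - e0 *: a l u.
  by rewrite /sug -/S1 -/S2 -/e0 linearB !linearD -!aZ.
rewrite s0 /sug s1 s2 s3 -/e0; clear s0 s1 s2 s3; clearbody X e0 S1 S2.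
move: E; set X1 := if l <= _ then _ else _; set X2 := if _ <= l then _ else _.
set X3 := if _ && _ then _ else _; clearbody X1 X2 X3; clear X.
move=> E; rewrite -[- (l%:~R *: _)]scaleNr -E.
case: (n + l == 0); module K.
Qed.

Definition anomaly (n l : int) : K :=
  if n + l == 0 then tau * kappa * n%:~R ^+ 2 else 0.

Lemma vir_op_a n l u : vir_op n (a l u) =
  a l (vir_op n u) - l%:~R *: a (n + l) u + anomaly n l *: u.
Proof.
have [N HN] := eventually_and (vanish_large u) (vanish_large (a l u)).
have [|uN alN] := HN (N + (`|n| + `|l|).+1)%N; first exact: leq_addr.
by rewrite (vir_opE n uN) (vir_opE n alN) sug_a // addnS ltnS leq_addl.
Qed.

(** The operators tau n a_n contribute - kappa tau^2 n^3 to the commutator of L_n and L_(-n). The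
    shift of L_0 by - kappa tau^2 / 2 completes n^3 to n^3 - n. *)
Definition central_charge_fock : K := 1 - 12 * kappa * tau ^+ 2.
Definition weight_fock : K := lam ^+ 2 / (2 * kappa) - kappa * tau ^+ 2 / 2.
Local Notation c := central_charge_fock.
Local Notation h := weight_fock.

Definition vir_defect (n m : int) (u : F) : F :=
  vir_op n (vir_op m u) - vir_op m (vir_op n u) - (n - m)%:~R *: vir_op (m + n) u
  - (if m == - n then (n ^+ 3 - n)%:~R / 12%:R * c else 0) *: u.

Lemma vir_op2_a n m l u : vir_op n (vir_op m (a l u)) =
  a l (vir_op n (vir_op m u)) - l%:~R *: a (n + l) (vir_op m u)
  + anomaly n l *: vir_op m u
  - l%:~R *: (a (m + l) (vir_op n u) - (m + l)%:~R *: a (n + m + l) u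
              + anomaly n (m + l) *: u)
  + anomaly m l *: vir_op n u.
Proof.
have oD x y : vir_op n (x + y) = vir_op n x + vir_op n y by exact: linearD.
have oB x y : vir_op n (x - y) = vir_op n x - vir_op n y by exact: linearB.
have oZ b x : vir_op n (b *: x) = b *: vir_op n x by exact: linearZ.
rewrite vir_op_a oD oB !oZ [vir_op n (a l _)]vir_op_a.
rewrite [vir_op n (a (m + l) u)]vir_op_a [n + (m + l)]addrA.
by [].
Qed.

(** This avoids commuting two infinite quadratic sums. A defect that commutes with all a_l is
    determined by its value on [vac]; that value is killed by the positive modes, so it is a
    multiple of [vac], which [phi 0] detects. *)
Lemma vir_defect_a n m l u : vir_defect n m (a l u) = a l (vir_defect n m u).
Proof.
have aB x y : a l (x - y) = a l x - a l y by exact: linearB.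
have aZ b x : a l (b *: x) = b *: a l x by exact: linearZ.
rewrite /vir_defect; set C := if _ then _ else _; clearbody C.
have -> : a l (vir_op n (vir_op m u) - vir_op m (vir_op n u)
      - (n - m)%:~R *: vir_op (m + n) u - C *: u) =
    a l (vir_op n (vir_op m u)) - a l (vir_op m (vir_op n u))
    - (n - m)%:~R *: a l (vir_op (m + n) u) - C *: a l u by rewrite -!aZ -!aB.
rewrite (vir_op2_a n m) (vir_op2_a m n) (vir_op_a (m + n)) [m + n]addrC.
have -> : anomaly n (m + l) = if n + m + l == 0 then tau * kappa * n%:~R ^+ 2 else 0.
  by rewrite /anomaly addrA.
have -> : anomaly m (n + l) = if n + m + l == 0 then tau * kappa * m%:~R ^+ 2 else 0.
  by rewrite /anomaly addrA [m + n]addrC.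
have -> : anomaly (n + m) l =
  if n + m + l == 0 then tau * kappa * (n + m)%:~R ^+ 2 else 0 by [].
case: eqP => [/eqP|_]; last first.
  module K.
move=> nml; have lE : l = - (n + m) by lia.
have {}lE : l%:~R = - (n%:~R + m%:~R) :> K by rewrite lE rmorphN rmorphD.
have iD (i j : int) : (i + j)%:~R = i%:~R + j%:~R :> K by exact: rmorphD.
have iN (i : int) : (- i)%:~R = - i%:~R :> K by exact: rmorphN.
rewrite !iD iN lE; module K.
Qed.

Lemma phi0_neg (n : int) u : n < 0 -> phi 0 (a n u) = 0.
Proof.
move=> n0; have -> : n = - `|n|%N.-1.+1%:Z by lia.
by rewrite phi_create phi_neg //; lia.
Qed.

Lemma phi0_vir_neg (n : int) u : n < 0 -> phi 0 (vir_op n u) = 0.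
Proof.
move=> n0; have [N HN] := vanish_large u.
rewrite (vir_opE n (HN N (leqnn N))) /sug ifN ?lt_eqF // scale0r subr0.
rewrite !linearD !linearZ /= phi0_neg // mulr0 addr0 !linear_sum /=.
rewrite big1 ?mulr0 ?add0r => [|k _]; last first.
  by rewrite phi0_neg // /lo n0; lia.
rewrite big1 ?mulr0 // => i _; rewrite /lo /hi n0.
have [i_n|i_n] := ltnP i `|n|%N; first by rewrite phi0_neg //; lia.
have -> : n + i%:Z = 0 by have := ltn_ord i; lia.
by rewrite a_zero linearZ /= phi0_neg ?mulr0 //; lia.
Qed.

Lemma vanish_vac : vanish vac 0.
Proof. by move=> n n0; exact: a_vac. Qed.

Lemma vir_vac_pos (n : int) : 0 < n -> vir_op n vac = 0.
Proof.
move=> n0; rewrite (vir_opE n vanish_vac) /sug big_ord0 a_vac // ifN ?gt_eqF //.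
rewrite !scaler0 scale0r subr0 add0r addr0 big1 ?scaler0 // => i _.
have n0' : (n < 0) = false by lia.
rewrite /lo /hi n0' /= add0r; have [i_n|i_n] := ltnP i `|n|%N.
  have -> : a (n - i%:Z) vac = 0 by apply: a_vac; lia.
  by rewrite linear0.
have -> : n - i%:Z = 0 by clear n0'; have := ltn_ord i; lia.
by rewrite a_zero linearZ /= [a i vac]a_vac ?scaler0 //; clear n0'; lia.
Qed.

Lemma vir_vac0 : vir_op 0 vac = h *: vac.
Proof.
rewrite (vir_opE 0 vanish_vac) /sug big_ord0 eqxx big_ord1 /lo /hi /=.
rewrite [in a (0 - _)]subr0 ?[in a (0 + _)]addr0.
rewrite !a_zero mulr0 /weight_fock; module K.
Qed.

Lemma vir_op0_a l u : vir_op 0 (a l u) = a l (vir_op 0 u) - l%:~R *: a l u.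
Proof.
by rewrite vir_op_a /anomaly add0r expr0n /= mulr0 if_same scale0r addr0.
Qed.

Lemma phi_vir0 (j : int) u : phi j (vir_op 0 u) = (h + j%:~R) * phi j u.
Proof.
move: u j; apply: fock_ind => [j|b u w IHu IHw j|j|k u IHu j].
- by rewrite !linear0 mulr0.
- by rewrite !linearP /= IHu IHw; ring.
- rewrite vir_vac0 linearZ /= phi_vac.
  by case: eqP => [->|_]; rewrite ?addr0 // !mulr0.
- rewrite vir_op0_a linearB linearZ /= !phi_create IHu !rmorphD rmorphN /=.
  by ring.
Qed.

Lemma vir_defect_linear n m : linear (vir_defect n m).
Proof. by move=> b u w; rewrite /vir_defect !linearP /=; module K. Qed.

Lemma vir_defect_eq0 n m u : phi 0 (vir_defect n m vac) = 0 -> vir_defect n m u = 0.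
Proof.
have d0 : vir_defect n m 0 = 0.
  by have := vir_defect_linear n m (-1) 0 0; rewrite !scaleN1r oppr0 addr0 addNr.
move=> p0; have dvac : vir_defect n m vac = 0.
  rewrite [LHS]vac_unique ?p0 ?scale0r // => k.
  by rewrite -vir_defect_a a_vac.
move: u; apply: fock_ind => // [b u w du dw|k u du].
  by rewrite vir_defect_linear du dw scaler0 addr0.
by rewrite vir_defect_a du linear0.
Qed.

Lemma vir_op_relation n m u : phi 0 (vir_defect n m vac) = 0 ->
  vir_op n (vir_op m u) = vir_op m (vir_op n u) + (n - m)%:~R *: vir_op (m + n) u
  + (if m == - n then (n ^+ 3 - n)%:~R / 12%:R * c else 0) *: u.
Proof.
have key (x y p q : F) : x - y - p - q = 0 -> x = y + p + q.
  by move/eqP; rewrite !subr_eq add0r => /eqP ->; rewrite addrC [q + p]addrC addrA.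
by move=> /(@vir_defect_eq0 n m u)/key.
Qed.

Lemma phi0_vir_defect n m : phi 0 (vir_defect n m vac) =
  phi 0 (vir_op n (vir_op m vac)) - phi 0 (vir_op m (vir_op n vac))
  - (n - m)%:~R * phi 0 (vir_op (m + n) vac)
  - (if m == - n then (n ^+ 3 - n)%:~R / 12%:R * c else 0).
Proof.
have pB x y : phi 0 (x - y) = phi 0 x - phi 0 y by exact: linearB.
have pZ b x : phi 0 (b *: x) = b * phi 0 x by exact: linearZ.
by rewrite /vir_defect !pB !pZ phi_vac eqxx mulr1.
Qed.

(** Established before the general relation, because the weight argument in [phi0_vir2] relies on
    it. *)
Lemma vir_relation0 m u :
  vir_op 0 (vir_op m u) = vir_op m (vir_op 0 u) - m%:~R *: vir_op m u.
Proof.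
have c0 : (if m == - 0 then (0 ^+ 3 - 0)%:~R / 12%:R * c else 0 : K) = 0.
  by rewrite expr0n subr0 !mul0r if_same.
rewrite vir_op_relation; last first.
  rewrite phi0_vir_defect c0 vir_vac0 linearZ [phi 0 (_ *: _)]linearZ /=.
  rewrite phi_vir0 addr0 addr0 sub0r.
  have [m0|m0|->] := ltrgtP m 0; last by rewrite oppr0; ring.
    by rewrite phi0_vir_neg // !mulr0 !subr0.
  by rewrite vir_vac_pos // linear0 !mulr0 !subr0.
by rewrite c0 sub0r addr0 rmorphN scaleNr scale0r addr0.
Qed.

Lemma sum_mul_sub (n N : nat) :
  \sum_(i < N) (i%:R * (n%:R - i%:R)) =
  (n%:R * N%:R * (N%:R - 1) / 2 - (N%:R - 1) * N%:R * (2 * N%:R - 1) / 6 : K).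
Proof.
elim: N => [|N IHN]; first by rewrite big_ord0; field.
by rewrite big_ord_recr /= IHN -addn1 natrD; field.
Qed.

(** Only the finite sum and the background term contribute. The products i (n - i) add up to (n^3 -
    n)/6, which gives the part 1 of the central charge; the end terms i = 0 and i = n involve a_0 =
    lam. *)
Lemma phi0_vir_pos_neg (n : nat) : (0 < n)%N ->
  phi 0 (vir_op n%:Z (vir_op (- n%:Z) vac)) =
  2 * n%:R * h + (n%:R ^+ 3 - n%:R) / 12 * c.
Proof.
move=> n0; pose W := vir_op (- n%:Z) vac.
have aW l : 0 < l -> a l W = l%:~R *: a (l - n%:Z) vac - anomaly (- n%:Z) l *: vac.
  move=> l0; have /eqP := vir_op_a (- n%:Z) l vac.
  rewrite a_vac // linear0 eq_sym -addrA addr_eq0 => /eqP ->.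
  by rewrite opprD opprK [- n%:Z + l]addrC.
have aWn : a n%:Z W = (n%:R * lam - tau * kappa * n%:R ^+ 2) *: vac.
  rewrite aW // subrr a_zero /anomaly addNr eqxx rmorphN sqrrN scalerA -scalerBl.
  by [].
have aWi (i : nat) : (i <= n)%N -> phi 0 (a i%:Z (a (n%:Z - i%:Z) W)) =
    kappa * (i%:R * (n%:R - i%:R)) + (if i == 0 then 1 else 0)
      * (lam * (n%:R * lam - tau * kappa * n%:R ^+ 2))
    + (if i == n then 1 else 0) * (lam * (n%:R * lam - tau * kappa * n%:R ^+ 2)).
  case: i => [|i] le_in.
    rewrite subr0 aWn a_zero !linearZ /= phi_vac eqxx ltn_eqF //.
    by rewrite /=; ring.
  have [->|in_neq] := eqVneq i.+1 n.
    rewrite subrr a_zero linearZ /= aWn !linearZ /= phi_vac !eqxx gtn_eqF //=.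
    by ring.
  rewrite aW; last by lia.
  have -> : n%:Z - i.+1%:Z - n%:Z = - i.+1%:Z by lia.
  rewrite /anomaly ifN; last by lia.
  rewrite scale0r subr0 linearZ /= a_comm subrr eqxx a_vac // linear0 add0r.
  rewrite !linearZ /= phi_vac eqxx rmorphB /=.
  by rewrite -[i.+1%:~R]/(i.+1%:R) -[n%:~R]/(n%:R); ring.
have [N HN] := vanish_large W.
rewrite -/W (vir_opE n%:Z (HN N (leqnn N))) /sug ifN; last by lia.
rewrite scale0r subr0 !linearD !linearZ /= aWn linearZ /= phi_vac eqxx mulr1.
rewrite [X in kappa^-1 * X](_ : _ = 0); last first.
  by rewrite linear_sum big1 // => k _; rewrite phi0_neg.
rewrite mulr0 add0r linear_sum /=.
rewrite (eq_bigr (fun i : 'I_n.+1 => phi 0 (a i%:Z (a (n%:Z - i%:Z) W)))); last first.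
  by move=> i _; rewrite add0r.
rewrite (eq_bigr _ (fun (i : 'I_n.+1) _ => aWi i (leq_ord i))) !big_split /= -!mulr_suml.
rewrite -mulr_sumr sum_mul_sub.
rewrite big_ord_recl /= big1 // addr0.
rewrite big_ord_recr /= eqxx big1 ?add0r; last first.
  by move=> i _; rewrite ltn_eqF //=.
rewrite !mul1r /weight_fock /central_charge_fock -[n%:~R]/(n%:R) -addn1 natrD.
by field.
Qed.

Lemma phi0_vir_vac (n : int) : n != 0 -> phi 0 (vir_op n vac) = 0.
Proof.
rewrite neq_lt => /orP[n0|n0]; first exact: phi0_vir_neg.
by rewrite vir_vac_pos // linear0.
Qed.

Lemma cubeE (n : int) : (n ^+ 3 - n)%:~R = n%:~R ^+ 3 - n%:~R :> K.
Proof. by rewrite rmorphB rmorphXn. Qed.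

(** For q different from -p the vector has L_0-weight h - q - p, different from h, and [phi 0]
    vanishes on it. *)
Lemma phi0_vir2 (p q : int) : 0 < p -> q < 0 ->
  phi 0 (vir_op p (vir_op q vac)) = (p - q)%:~R * phi 0 (vir_op (q + p) vac)
    + (if q == - p then (p ^+ 3 - p)%:~R / 12%:R * c else 0).
Proof.
move=> p0 q0; have [->|qp] := eqVneq q (- p).
  case: p p0 => // n n0; rewrite addNr vir_vac0 linearZ /= phi_vac eqxx /=.
  rewrite phi0_vir_pos_neg // opprK cubeE rmorphD /=.
  by rewrite -[n%:~R]/(n%:R); ring.
rewrite phi0_vir_vac; last by rewrite addr_eq0.
rewrite mulr0 addr0; set x := phi 0 _.
have E : vir_op 0 (vir_op p (vir_op q vac)) =
    (h - q%:~R - p%:~R) *: vir_op p (vir_op q vac).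
  have oB y z : vir_op p (y - z) = vir_op p y - vir_op p z by exact: linearB.
  have oZ n b y : vir_op n (b *: y) = b *: vir_op n y by exact: linearZ.
  rewrite vir_relation0 [vir_op 0 (vir_op q _)]vir_relation0 vir_vac0 oB !oZ.
  by module K.
have xE : (p + q)%:~R * x = 0.
  have := phi_vir0 0 (vir_op p (vir_op q vac)); rewrite E linearZ /= -/x addr0.
  move=> {}E; rewrite rmorphD /=.
  have -> : (p%:~R + q%:~R) * x = h * x - (h - q%:~R - p%:~R) * x by ring.
  by rewrite E subrr.
by move/eqP: xE; rewrite mulf_eq0 intr_eq0 addrC addr_eq0 (negPf qp) => /eqP.
Qed.

Lemma phi0_vir_defect_eq0 n m : phi 0 (vir_defect n m vac) = 0.
Proof.
rewrite phi0_vir_defect.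
have [n0|n0|->] := ltrgtP n 0; last first.
- have -> : (if m == - 0 then (0 ^+ 3 - 0)%:~R / 12%:R * c else 0 : K) = 0.
    by rewrite expr0n subr0 !mul0r if_same.
  rewrite vir_vac0 phi_vir0 linearZ [phi 0 (_ *: _)]linearZ /= !addr0 subrr.
  have [->|m0] := eqVneq m 0; first by rewrite subrr mul0r !subr0.
  by rewrite phi0_vir_vac // mulr0 !subr0.
- rewrite [vir_op n vac]vir_vac_pos // linear0 linear0 subr0.
  have [m0|m0|->] := ltrgtP m 0.
  + by rewrite phi0_vir2 //; ring.
  + rewrite !vir_vac_pos ?addr_gt0 // !linear0 mulr0 ifN ?subr0 //.
    by lia.
  + rewrite add0r vir_vac0 linearZ [phi 0 (_ *: _)]linearZ /=.
    rewrite phi0_vir_vac ?gt_eqF //; last by lia.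
    by rewrite !mulr0 !subr0.
rewrite phi0_vir_neg // sub0r; have [m0|m0|->] := ltrgtP m 0.
- rewrite !phi0_vir_neg //; last by lia.
  by rewrite mulr0 ifN ?subr0 ?oppr0 //; lia.
- rewrite phi0_vir2 // [n + m]addrC.
  have -> : (n == - m) = (m == - n) by lia.
  case: eqP => [->|_]; last by rewrite !rmorphB /=; ring.
  by rewrite !cubeE !rmorphB !rmorphN /=; ring.
- rewrite phi_vir0 add0r !phi0_vir_neg // !mulr0 oppr0.
  by case: eqP => [|_]; [lia|rewrite addr0 subr0].
Qed.

Lemma vir_relation n m u :
  vir_op n (vir_op m u) = vir_op m (vir_op n u) + (n - m)%:~R *: vir_op (m + n) u
  + (if m == - n then (n ^+ 3 - n)%:~R / 12%:R * c else 0) *: u.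
Proof. exact/vir_op_relation/phi0_vir_defect_eq0. Qed.

Definition scale_op (u : F) : F := c *: u.
Lemma scale_op_linear : linear scale_op.
Proof. by move=> b u w; rewrite /scale_op scalerDr !scalerA mulrC. Qed.
HB.instance Definition _ :=
  GRing.isLinear.Build K F F *:%R scale_op scale_op_linear.

Definition fock_op (x : vir_basis) : {linear F -> F} :=
  if x is VirL n then vir_op n else scale_op.

Definition fockMod : opMod K := OpMod fock_op.

Lemma fock_axiom : vir_axiom fockMod.
Proof.
case=> [|n] [|m] u; rewrite /bracket_act /vir_bracket ?lext0.
- by rewrite subrr.
- by rewrite -[op _ _ _]/(scale_op _) /scale_op linearZ subrr.
- by rewrite -[op _ VirC u]/(scale_op _) /scale_op linearZ subrr.
have key (x y z : F) : x + y + z - x = y + z by rewrite addrC !addrA addNr add0r.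
rewrite linearD /= lextZU /= vir_relation key.
congr (_ + _); case: ifP => _; last by rewrite lext0 scale0r.
by rewrite lextZU /= /scale_op scalerA.
Qed.

Definition fock : virMod K := VirMod fock_axiom.

Lemma fock_hw : hw_vector (M := fock) c h vac.
Proof. by split=> // [|n n0]; [exact: vir_vac0|exact: vir_vac_pos]. Qed.

(* Euler's formula sum_k k x_k d/dx_k = degree, evaluated by [phi]. *)
Lemma phi_euler u : eventually (fun N => forall j : int,
  \sum_(i < N) phi (j - i.+1%:Z) (a i.+1%:Z u) = kappa * j%:~R * phi j u).
Proof.
move: u; apply: fock_ind => [|b u w Hu Hw||k u [N HN]].
- exists 0%N => N _ j; rewrite linear0 mulr0 big1 // => i _.
  by rewrite !linear0.
- have [N HN] := eventually_and Hu Hw; exists N => n /HN[Eu Ew] j.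
  rewrite linearP /= mulrDr mulrCA -Eu -Ew mulr_sumr -big_split /=.
  by apply: eq_bigr => i _; rewrite !linearP.
- exists 0%N => N _ j; rewrite phi_vac big1 => [|i _]; last first.
    by rewrite a_vac // linear0.
  by case: eqP => [->|_]; rewrite ?mulr0 ?mul0r.
- exists (N + k.+1)%N => n Nn j.
  rewrite (eq_bigr (fun i : 'I_n => phi (j - k.+1%:Z - i.+1%:Z) (a i.+1%:Z u)
    + (if i%:Z == k%:Z then kappa * k.+1%:R * phi (j - k.+1%:Z) u else 0))).
    rewrite big_split /= HN; last by lia.
    have -> : \sum_(i < n) (if i%:Z == k%:Z
         then kappa * k.+1%:R * phi (j - k.+1%:Z) u else 0)
        = kappa * k.+1%:R * phi (j - k.+1%:Z) u :> K.
      have kn : (k < n)%N by lia.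
      rewrite (bigD1 (Ordinal kn)) //= eqxx big1 ?addr0 // => i ik.
      by rewrite ifN //; apply: contra ik => /eqP[ik]; apply/eqP/val_inj.
    by rewrite phi_create rmorphB /= -[k.+1%:~R]/(k.+1%:R); ring.
  move=> i _; rewrite a_comm linearD linearZ /= phi_create; congr (_ + _).
    by congr (phi _ _); lia.
  have -> : (i.+1%:Z - k.+1%:Z == 0) = (i%:Z == k%:Z) by lia.
  case: eqP => [[->]|_]; last by rewrite mul0r.
  by [].
Qed.

Lemma phi_a_neg (n j : int) u : n < 0 -> phi j (a n u) = phi (j + n) u.
Proof.
by move=> n0; have -> : n = - `|n|%N.-1.+1%:Z by lia; rewrite phi_create.
Qed.

(** With n = k + 1, the infinite sum gives j - n by Euler's formula. In the finite sum the two end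
    terms contribute lam each and the other n - 1 terms 1 each, to be divided by 2 kappa; the
    background term gives - tau n. *)
Lemma phi_vir_neg (k : nat) j u : phi j (vir_op (- k.+1%:Z) u) =
  (j%:~R + (lam / kappa - (2 * kappa)^-1) - k.+1%:R * (1 + tau - (2 * kappa)^-1))
    * phi (j - k.+1%:Z) u.
Proof.
have [N HN] := eventually_and (vanish_large u) (phi_euler u).
have [uN eul] := HN N (leqnn N); rewrite (vir_opE _ uN) /sug /=.
have n0 : - k.+1%:Z < 0 by [].
rewrite scale0r subr0 !linearD !linearZ /= phi_create /lo /hi n0 !linear_sum /=.
rewrite (eq_bigr (fun i : 'I_N => phi (j - k.+1%:Z - i.+1%:Z) (a i.+1%:Z u))); last first.
  by move=> i _; rewrite phi_a_neg ?add0r; [congr (phi _ _)|]; lia.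
rewrite eul big_ord_recl big_ord_recr /= addr0 subr0 a_zero linearZ linearZ /= phi_create.
rewrite (eq_bigr (fun=> phi (j - k.+1%:Z) u)); last first.
  move=> i _; have ik := ltn_ord i; rewrite phi_a_neg; last by rewrite /bump /=; lia.
  rewrite phi_a_neg; last by rewrite /bump /=; lia.
  by congr (phi _ _); rewrite /bump /=; lia.
rewrite sumr_const card_ord.
have -> : - k.+1%:Z + (bump 0 k)%:Z = 0 by rewrite /bump /=; lia.
rewrite sub0r a_zero linearZ /= phi_a_neg; last by rewrite /bump /=; lia.
have -> : j - (bump 0 k)%:Z = j - k.+1%:Z by rewrite /bump /=; lia.
set f := phi (j - k.+1%:Z) u; rewrite !rmorphB !rmorphN /= -[f *+ k]mulr_natl.
rewrite -[k.+1%:~R]/(k.+1%:R) -addn1 natrD.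
by field.
Qed.

Lemma phi_vir1 (j : int) u : phi (j - 1) (vir_op 1 u) =
  j%:~R * phi j u + (lam + kappa * tau - 1) / kappa * phi (j - 1) (a 1 u).
Proof.
have [N HN] := eventually_and (vanish_large u) (phi_euler u).
have [uN _] := HN N (leqnn N); have [_ /(_ j)] := HN N.+1 (leqnSn N).
rewrite (vir_opE _ uN) /sug /= scale0r subr0 big_ord_recl /= => eul.
rewrite !linearD !linearZ /= /lo /hi /= !linear_sum /= !big_ord_recl big_ord0 /=.
rewrite (eq_bigr (fun i : 'I_N =>
  phi (j - (bump 0 i).+1%:Z) (a (bump 0 i).+1%:Z u))) => [|i _]; last first.
  rewrite phi_a_neg; last by lia.
  by congr (phi _ (a _ _)); rewrite /bump /=; lia.
have -> : \sum_(i < N) phi (j - (bump 0 i).+1%:Z) (a (bump 0 i).+1%:Z u) =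
  kappa * j%:~R * phi j u - phi (j - 1) (a 1 u) by rewrite -eul addrC addKr.
rewrite /bump /= subr0 subrr addr0 add0r !a_zero !linearZ /= addr0.
by field.
Qed.

Lemma phi_vir2 (j : int) u : phi (j - 2) (vir_op 2 u) =
  j%:~R * phi j u - phi (j - 1) (a 1 u) / kappa
  + (lam + 2 * kappa * tau - 1) / kappa * phi (j - 2) (a 2 u)
  + phi (j - 2) (a 1 (a 1 u)) / (2 * kappa).
Proof.
have [N HN] := eventually_and (vanish_large u) (phi_euler u).
have [uN _] := HN N (leqnn N).
have [|_ /(_ j)] := HN N.+2 _; first by lia.
rewrite (vir_opE _ uN) /sug /= scale0r subr0 !big_ord_recl /= => eul.
rewrite big_ord0 addr0 !linearD !linearZ /= /lo /hi /= linear_sum /=.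
rewrite (eq_bigr (fun i : 'I_N =>
  phi (j - (bump 0 (bump 0 i)).+1%:Z) (a (bump 0 (bump 0 i)).+1%:Z u))) => [|i _]; last first.
  rewrite phi_a_neg; last by lia.
  by congr (phi _ (a _ _)); rewrite /bump /=; lia.
have -> : \sum_(i < N) phi (j - (bump 0 (bump 0 i)).+1%:Z)
      (a (bump 0 (bump 0 i)).+1%:Z u) =
    kappa * j%:~R * phi j u - phi (j - 1) (a 1 u) - phi (j - 2) (a 2 u).
  by rewrite -eul /bump /=; ring.
rewrite /bump /= [phi _ (a _ (a (2 - 0%Z) u))](_ : _ = lam * phi (j - 2) (a 2 u)).
  rewrite [phi _ (a _ (a (2 - (1 + 0)%N%:Z) u))](_ : _ = phi (j - 2) (a 1 (a 1 u))) //.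
  rewrite [phi _ (a _ (a (2 - (1 + (1 + 0))%N%:Z) u))](_ : _ = lam * phi (j - 2) (a 2 u)).
    by field.
  by rewrite -[LHS]/(phi (j - 2) (a 2 (a 0 u))) a_zero !linearZ.
by rewrite -[LHS]/(phi (j - 2) (a 0 (a 2 u))) a_zero linearZ.
Qed.

Lemma fock_primary :
  primary (M := fock) vac h (lam / kappa - (2 * kappa)^-1) (1 + tau - (2 * kappa)^-1) phi.
Proof.
by split=> // [j x|k j x]; [exact: phi_vir0|exact: phi_vir_neg].
Qed.

(** The target weight is a multiple of A = lam + kappa tau - 1. For A = 0 it is 0, and the level one
    null vector of the target makes L_1 suffice. *)
Lemma fock_determined1 : lam + kappa * tau = 1 ->
  level_determined (M := fock) phi.
Proof.
move=> A0 j u j0 E _ _; have := phi_vir1 j u; rewrite [phi _ _]E A0 subrr !mul0r.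
rewrite addr0 => /esym/eqP; rewrite mulf_eq0 intr_eq0 gt_eqF //= => /eqP.
by [].
Qed.

(** The hypotheses give three linear relations between [f], [u1], [u2], [u11]. After elimination of
    [u2] the coefficient of [u11] vanishes exactly because 2 A B = kappa, and [u1] is a multiple of
    [f]. What is left is j (A + 1 + B (j - 1)) f = 0. *)
Lemma fock_determined2 (A := lam + kappa * tau - 1) (B := lam + 2 * kappa * tau - 1) :
  2 * A * B = kappa -> (forall n : nat, A + 1 + B * n%:R != 0) ->
  level_determined (M := fock) phi.
Proof.
move=> AB nz j u j0 E1 E2 E3.
have /eqP := AB; rewrite eq_sym => /eqP kE.
have A0 : A != 0 by apply: contraNneq kappa0 => A0; rewrite -AB A0 mulr0 mul0r.
have B0 : B != 0 by apply: contraNneq kappa0 => B0; rewrite -AB B0 mulr0.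
set f := phi j u; set u1 := phi (j - 1) (a 1 u); set u2 := phi (j - 2) (a 2 u).
set u11 := phi (j - 2) (a 1 (a 1 u)).
have F1 : j%:~R * f + A / kappa * u1 = 0 by rewrite -phi_vir1; exact: E1.
have F3 : j%:~R * f - u1 / kappa + B / kappa * u2 + u11 / (2 * kappa) = 0.
  by rewrite -phi_vir2; exact: E3.
(* L_1 is expanded twice by [phi_vir1]; exchanging a_1 and L_1 in between produces the a_2 term. *)
have F2 : A / kappa * ((j - 1)%:~R * u1 + A / kappa * u11 + u2) = 0.
  have j2 : j - 2 = j - 1 - 1 by rewrite -addrA.
  have := phi_vir1 (j - 1) (vir_op 1 u); rewrite -j2 [phi _ _]E2 [phi (j - 1) _]E1.
  rewrite mulr0 add0r => /esym; have := vir_op_a 1 1 u; rewrite /anomaly /=.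
  rewrite scale0r addr0 scale1r => /esym/eqP; rewrite subr_eq => /eqP ->.
  rewrite linearD /= {1}j2 phi_vir1 -j2 => <-.
  by rewrite /u1 /u2 /u11.
have f0 : j%:~R * f * (A + 1 + B * (j - 1)%:~R) = 0.
  have u1E : u1 = - (kappa / A) * (j%:~R * f).
    apply/eqP; rewrite -subr_eq0; apply/eqP.
    have -> : u1 - - (kappa / A) * (j%:~R * f) = kappa / A * (j%:~R * f + A / kappa * u1).
      by field; rewrite kappa0.
    by rewrite F1 mulr0.
  have u2E : u2 = - ((j - 1)%:~R * u1 + A / kappa * u11).
    apply/eqP; rewrite -subr_eq0 opprK addrC; apply/eqP.
    move/eqP: F2; rewrite mulf_eq0 [_ / _ == 0]mulf_eq0 invr_eq0 (negPf A0).
    by rewrite (negPf kappa0) /= => /eqP.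
  have := congr1 ( *%R A) F3; rewrite u2E u1E mulr0 kE => {}F3.
  by rewrite -{}F3; field; rewrite A0 B0.
move/eqP: f0; rewrite !mulf_eq0 intr_eq0 gt_eqF //= => /orP[/eqP //|].
have -> : (j - 1)%:~R = `|j - 1|%N%:R :> K.
  by rewrite -[in LHS](gez0_abs (_ : 0 <= j - 1)) //; lia.
by rewrite (negPf (nz _)).
Qed.

End Heisenberg.

(** * The polynomial Fock module *)

(* The Fock space of polynomials in x_0, x_1, ..., with x_k of degree k + 1.
   Only the monomial basis is used; the underlying module is kept abstract. *)
Section PolynomialFock.
Variables (K : numFieldType) (kappa lam : K).
Local Notation I := (cmonom nat).
Variables (F : lmodType K) (bas : I -> F) (coef : I -> {scalar F}).
Hypothesis bas_ext : forall (V : lmodType K) (f : I -> V),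
  {g : {linear F -> V} | forall m, g (bas m) = f m}.
Hypothesis bas_ind : forall P : F -> Prop,
  P 0 -> (forall b u w, P u -> P w -> P (b *: u + w)) -> (forall m, P (bas m)) ->
  forall u, P u.
Hypothesis coef_bas : forall p m, coef p (bas m) = (m == p)%:R.
Hypothesis coef_inj : forall u, (forall p, coef p u = 0) -> u = 0.
Implicit Types (m p : I) (k l : nat).

Let var k : I := ucm k.

Lemma linear_bas_eq (V : lmodType K) (f g : F -> V) :
  linear f -> linear g -> (forall m, f (bas m) = g (bas m)) -> f =1 g.
Proof.
move=> fL gL fg; apply: bas_ind => // [|b u w Eu Ew]; last by rewrite fL gL Eu Ew.
pose f' : {linear F -> V} := HB.pack f (GRing.isLinear.Build _ _ _ _ f fL).
pose g' : {linear F -> V} := HB.pack g (GRing.isLinear.Build _ _ _ _ g gL).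
by rewrite -[f 0]/(f' 0) -[g 0]/(g' 0) !linear0.
Qed.

Lemma var_divK k m : (0 < m k)%N -> (mulcm (var k) (divcm m (var k))) = m.
Proof.
move=> mk; apply/eqP/cmP => i; rewrite mulcmE divcmE ucmE.
by case: eqP => [<-|_]; rewrite ?subn0 // subnKC.
Qed.

Lemma div_varK k m : divcm (mulcm (var k) m) (var k) = m.
Proof. by apply/eqP/cmP => i; rewrite divcmE mulcmE addKn. Qed.

(** On polynomials, a_(-k-1) is multiplication by x_k, a_(k+1) is kappa (k + 1) d/dx_k, and a_0 is
    the scalar lam. *)
Definition fock_basis (n : int) (m : I) : F :=
  match n with
  | Posz 0 => lam *: bas m
  | Posz k.+1 => (kappa * k.+1%:R * (m k)%:R) *: bas (divcm m (var k))
  | Negz k => bas (mulcm (var k) m)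
  end.

Definition fock_a n : {linear F -> F} := sval (bas_ext (fock_basis n)).

Lemma fock_aU n m : fock_a n (bas m) = fock_basis n m.
Proof. exact: (svalP (bas_ext (fock_basis n))). Qed.

Lemma fock_a_zero u : fock_a 0 u = lam *: u.
Proof.
by move: u; apply: linear_bas_eq => [||m];
  [exact: linearP|exact: linearP|exact: fock_aU].
Qed.

Lemma fock_aZ n b u : fock_a n (b *: u) = b *: fock_a n u.
Proof. exact: linearZ. Qed.

Lemma fock_a_posU k m :
  fock_a k.+1 (bas m) = (kappa * k.+1%:R * (m k)%:R) *: bas (divcm m (var k)).
Proof. exact: fock_aU. Qed.

Lemma fock_a_negU k m : fock_a (Negz k) (bas m) = bas (mulcm (var k) m).
Proof. exact: fock_aU. Qed.

Lemma div_var_mul k l m : k != l ->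
  divcm (mulcm (var l) m) (var k) = mulcm (var l) (divcm m (var k)).
Proof.
move=> kl; apply/eqP/cmP => i; rewrite mulcmE !divcmE mulcmE !ucmE.
by have [ki|_] := eqVneq k i; rewrite ?subn0 // -ki eq_sym (negPf kl).
Qed.

Lemma fock_a_pos_neg k l m :
  fock_a k.+1 (fock_a (Negz l) (bas m)) = fock_a (Negz l) (fock_a k.+1 (bas m)) +
  (if k == l then kappa * k.+1%:~R else 0) *: bas m.
Proof.
rewrite fock_a_negU !fock_a_posU fock_aZ fock_a_negU mulcmE ucmE.
have [->|kl] := eqVneq k l; last first.
  by rewrite scale0r addr0 div_var_mul.
rewrite div_varK.
have -> : (kappa * l.+1%:R * (m l)%:R) *: bas (mulcm (var l) (divcm m (var l))) =
    (kappa * l.+1%:R * (m l)%:R) *: bas m :> F.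
  by have [->|/var_divK ->//] := posnP (m l); rewrite mulr0 !scale0r.
rewrite -scalerDl natrD; congr (_ *: _).
by rewrite -[(l.+1)%:~R]/(l.+1%:R) -[(nat_of_bool true)%:R]/(1 : K); ring.
Qed.

Lemma fock_a_comm n n' u : fock_a n (fock_a n' u) = fock_a n' (fock_a n u) +
  (if n + n' == 0 then kappa * n%:~R else 0) *: u.
Proof.
move: u; apply: linear_bas_eq => [b u w|b u w|m]; rewrite ?linearP //=.
  by rewrite !scalerDr addrACA !scalerA [X in (X *: u)]mulrC.
case: n n' => [[|k]|k] [[|l]|l].
- by rewrite fock_a_zero mulr0 scale0r addr0.
- by rewrite fock_a_zero scale0r addr0 [fock_a 0 (bas m)]fock_a_zero fock_aZ.
- by rewrite fock_a_zero scale0r addr0 [fock_a 0 (bas m)]fock_a_zero fock_aZ.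
- by rewrite scale0r addr0 [RHS]fock_a_zero [fock_a 0 (bas m)]fock_a_zero fock_aZ.
- rewrite scale0r addr0 !fock_a_posU !fock_aZ !fock_a_posU !scalerA.
  have [->//|kl] := eqVneq k l.
  have -> : divcm (divcm m (var k)) (var l) = divcm (divcm m (var l)) (var k).
    by apply/eqP/cmP => i; rewrite !divcmE subnAC.
  rewrite !divcmE !ucmE (negPf kl) eq_sym (negPf kl) !subn0.
  by congr (_ *: _); ring.
- by rewrite fock_a_pos_neg; have -> : (Posz k.+1 + Negz l == 0) = (k == l) by lia.
- by rewrite scale0r addr0 [RHS]fock_a_zero [fock_a 0 (bas m)]fock_a_zero fock_aZ.
- rewrite fock_a_pos_neg; have -> : (Negz k + Posz l.+1 == 0) = (l == k) by lia.
  rewrite -addrA -scalerDl; case: eqP => [->|_]; last by rewrite addr0 scale0r addr0.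
  by rewrite NegzE rmorphN mulrN subrr scale0r addr0.
- have -> : (Negz k + Negz l == 0) = false by lia.
  by rewrite scale0r addr0 !fock_a_negU mulcmA [(mulcm (var k) _)]mulcmC -mulcmA.
Qed.

Definition wdeg (m : I) : nat := (\sum_(i <- finsupp m) i.+1 * m i)%N.

Lemma wdegE m (d : {fset nat}) : (finsupp m `<=` d)%fset ->
  wdeg m = (\sum_(i <- d) i.+1 * m i)%N.
Proof.
move=> md; apply: big_fset_incl => // i _ im.
by rewrite fsfun_dflt ?muln0.
Qed.

Lemma wdeg_var k m : wdeg (mulcm (var k) m) = (k.+1 + wdeg m)%N.
Proof.
pose d := (finsupp (mulcm (var k) m) `|` finsupp m `|` [fset k])%fset.
rewrite (@wdegE _ d) ?(@wdegE m d); last 2 first.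
- by apply/fsubsetP => i im; rewrite !in_fsetE im orbT.
- by apply/fsubsetP => i im; rewrite !in_fsetE im.
have kd : k \in d by rewrite !in_fsetE eqxx orbT.
under eq_bigr do rewrite mulcmE mulnDr.
rewrite big_split /=; congr (_ + _)%N.
rewrite (big_fsetD1 k) //= ucmE eqxx muln1 big_seq big1 ?addn0 // => i.
by rewrite in_fsetD1 ucmE eq_sym => /andP[/negPf -> _]; rewrite muln0.
Qed.

Lemma wdeg1 : wdeg (onecm nat) = 0%N.
Proof. by rewrite /wdeg big1 // => i _; rewrite onecmE muln0. Qed.

Lemma cmonom_neq1 m : m != onecm nat -> exists k, (0 < m k)%N.
Proof.
move=> m1; apply: contrapT => H; case/negP: m1; apply/cmP => i.
by rewrite onecmE; apply/eqP; rewrite -leqn0 leqNgt; apply/negP => mi; apply: H; exists i.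
Qed.

Definition fock_phi (j : int) : {scalar F} :=
  sval (bas_ext (fun m => ((wdeg m)%:Z == j)%:R : K^o)).

Lemma fock_phiU j m : fock_phi j (bas m) = ((wdeg m)%:Z == j)%:R.
Proof. exact: (svalP (bas_ext (fun m => ((wdeg m)%:Z == j)%:R : K^o))). Qed.

Definition fock_vac : F := bas (onecm nat).

Lemma fock_a_vac (n : int) : 0 < n -> fock_a n fock_vac = 0.
Proof.
by case: n => // -[//|k] _; rewrite fock_aU /= onecmE mulr0 scale0r.
Qed.

Lemma fock_a_nilp u : exists N : nat, forall n : int, N%:Z < n -> fock_a n u = 0.
Proof.
move: u; apply: bas_ind => [|b u w [N HN] [N' HN']|m].
- by exists 0%N => n _; rewrite linear0.
- by exists (N + N')%N => n Nn; rewrite linearP /= HN ?HN' ?scaler0 ?addr0 //; lia.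
exists (wdeg m) => -[[//|k]|//] mk; rewrite fock_aU /=.
have [->|km] := posnP (m k); first by rewrite mulr0 scale0r.
by move: mk; rewrite -(var_divK km) wdeg_var; lia.
Qed.

Lemma fock_poly_ind (P : F -> Prop) :
  P 0 -> (forall b u w, P u -> P w -> P (b *: u + w)) -> P fock_vac ->
  (forall k u, P u -> P (fock_a (- k.+1%:Z) u)) -> forall u, P u.
Proof.
move=> P0 PD Pv Pa; apply: bas_ind => // m.
have [n] := ubnP (wdeg m); elim: n => // n IHn in m *.
have [->//|/cmonom_neq1[k mk]] := eqVneq m (onecm nat).
rewrite -(var_divK mk) wdeg_var => lt_n.
have -> : bas (mulcm (var k) (divcm m (var k))) =
    fock_a (- k.+1%:Z) (bas (divcm m (var k))).
  by rewrite fock_aU.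
by apply/Pa/IHn; lia.
Qed.

Lemma fock_a_coef k p u : coef p (fock_a k.+1 u) =
  kappa * k.+1%:R * (p k).+1%:R * coef (mulcm (var k) p) u.
Proof.
move: u; apply: (@linear_bas_eq K^o (fun u => coef p (fock_a k.+1 u))
   (fun u => kappa * k.+1%:R * (p k).+1%:R * coef (mulcm (var k) p) u)).
- by move=> b u w; rewrite !linearP.
- by move=> b u w; rewrite linearP /= mulrDr mulrCA.
move=> m; rewrite fock_a_posU linearZ /= !coef_bas; have [mk|mk] := posnP (m k).
  rewrite mk mulr0 mul0r; case: eqP => [mE|_]; last by rewrite mulr0.
  by move: mk; rewrite mE mulcmE ucmE eqxx.
have -> : (divcm m (var k) == p) = (m == mulcm (var k) p).
  by apply/eqP/eqP => [<-|->]; rewrite ?var_divK ?div_varK.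
by case: eqP => [->|_]; rewrite ?mulr0 // mulcmE ucmE eqxx.
Qed.

(** In characteristic 0 a polynomial whose partial derivatives all vanish is constant. *)
Lemma fock_vac_unique u : kappa != 0 ->
  (forall k, fock_a k.+1 u = 0) -> u = fock_phi 0 u *: fock_vac.
Proof.
move=> kappa0 au; have um m : m != onecm nat -> coef m u = 0.
  move=> /cmonom_neq1[k mk]; have := fock_a_coef k (divcm m (var k)) u.
  rewrite au linear0 var_divK // => /esym/eqP.
  by rewrite !mulf_eq0 !pnatr_eq0 (negPf kappa0) /= => /eqP.
have uE : u = coef (onecm nat) u *: fock_vac.
  apply/eqP; rewrite -subr_eq0; apply/eqP/coef_inj => m.
  rewrite linearB linearZ /= coef_bas eq_sym.
  by have [->|/um ->] := eqVneq m (onecm nat); rewrite ?mulr1 ?mulr0 subrr.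
by rewrite {2}uE linearZ /= fock_phiU wdeg1 eqxx mulr1.
Qed.

Lemma fock_phi_vac j : fock_phi j fock_vac = (j == 0)%:R.
Proof. by rewrite fock_phiU wdeg1 eq_sym. Qed.

Lemma fock_phi_neg (j : int) u : j < 0 -> fock_phi j u = 0.
Proof.
move=> j0; move: u; apply: bas_ind => [|b u w Hu Hw|m].
- exact: linear0.
- by rewrite linearP /= Hu Hw mulr0 addr0.
- by rewrite fock_phiU; case: eqP => // mj; lia.
Qed.

Lemma fock_phi_create k (j : int) u :
  fock_phi j (fock_a (- k.+1%:Z) u) = fock_phi (j - k.+1%:Z) u.
Proof.
move: u; apply: bas_ind => [|b u w Hu Hw|m].
- by rewrite !linear0.
- by rewrite !linearP /= Hu Hw.
rewrite fock_aU /= !fock_phiU wdeg_var; congr (nat_of_bool _)%:R.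
by lia.
Qed.

Lemma poly_fock_exists (tau : K)
    (A := lam + kappa * tau - 1) (B := lam + 2 * kappa * tau - 1) :
  kappa != 0 ->
  A = 0 \/ (2 * A * B = kappa /\ forall n : nat, A + 1 + B * n%:R != 0) ->
  exists (M : virMod K) (o : M) (phi : int -> {scalar M}),
  [/\ hw_vector (1 - 12 * kappa * tau ^+ 2)
        (lam ^+ 2 / (2 * kappa) - kappa * tau ^+ 2 / 2) o,
      primary o (lam ^+ 2 / (2 * kappa) - kappa * tau ^+ 2 / 2)
        (lam / kappa - (2 * kappa)^-1) (1 + tau - (2 * kappa)^-1) phi &
      level_determined phi].
Proof.
move=> kappa0 AB.
have vu u : (forall k, fock_a k.+1 u = 0) -> u = fock_phi 0 u *: fock_vac.
  exact: fock_vac_unique.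
exists (fock tau kappa0 fock_a_comm fock_a_zero fock_a_vac
  fock_a_nilp fock_poly_ind vu fock_phi_vac fock_phi_neg fock_phi_create).
exists fock_vac, fock_phi.
split; [exact: fock_hw|exact: fock_primary|].
case: AB => [/subr0_eq A0|[AB nz]]; first exact: fock_determined1.
exact: fock_determined2.
Qed.

End PolynomialFock.

Lemma malg_lin_ind (K : fieldType) (I : choiceType) (P : {malg K[I]} -> Prop) :
  P 0 -> (forall b u w, P u -> P w -> P (b *: u + w)) -> (forall i, P << i >>) ->
  forall u, P u.
Proof.
move=> P0 PD Pi u; rewrite [u]monalgE; elim/big_rec: _ => // i w _ Pw.
have -> : << u@_i *g i >> = u@_i *: << i >> :> {malg K[I]}.
  by apply/malgP => k; rewrite mcoeffZ !mcoeffU mulrnAr mulr1.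
exact: PD.
Qed.

Lemma fock_exists (K : numFieldType) (kappa lam tau : K)
    (A := lam + kappa * tau - 1) (B := lam + 2 * kappa * tau - 1) :
  kappa != 0 ->
  A = 0 \/ (2 * A * B = kappa /\ forall n : nat, A + 1 + B * n%:R != 0) ->
  exists (M : virMod K) (o : M) (phi : int -> {scalar M}),
  [/\ hw_vector (1 - 12 * kappa * tau ^+ 2)
        (lam ^+ 2 / (2 * kappa) - kappa * tau ^+ 2 / 2) o,
      primary o (lam ^+ 2 / (2 * kappa) - kappa * tau ^+ 2 / 2)
        (lam / kappa - (2 * kappa)^-1) (1 + tau - (2 * kappa)^-1) phi &
      level_determined phi].
Proof.
pose F : lmodType K := {malg K[cmonom nat]}.
pose bas (m : cmonom nat) : F := << m >>.
have coefL p : scalar (fun u : F => (u : {malg K[cmonom nat]})@_p).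
  by move=> b u w; rewrite mcoeffD mcoeffZ.
pose coef p : {scalar F} := HB.pack (fun u : F => (u : {malg K[cmonom nat]})@_p)
  (GRing.isLinear.Build _ _ _ _ _ (coefL p)).
apply: (@poly_fock_exists _ _ _ F bas coef).
- by move=> V f; exists (lext f) => m; exact: lextU.
- by move=> P P0 PD Pm u; exact: malg_lin_ind.
- by move=> p m; rewrite /coef /= mcoeffU.
- by move=> u u0; apply/malgP => p; rewrite mcoeff0; exact: u0.
Qed.

(** * Null vectors of irreducible highest weight modules *)

Section IrreducibleQuotient.
Variables (K : numFieldType) (c h : K).

Definition simple_hw (L : virMod K) (w : L) :=
  [/\ hw_vector c h w, w != 0, forall S : submod L, S w -> forall u, S u &
      forall S : submod L, (exists2 u : L, u != 0 & S u) -> forall u, S u].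

Lemma irr_hw_primary (F : virMod K) (o : F) gamma beta (phi : int -> {scalar F}) :
  hw_vector c h o -> primary o h gamma beta phi -> level_determined phi ->
  exists (w : irr_hw c h) (psi : int -> {scalar irr_hw c h}),
    simple_hw w /\ primary w h gamma beta psi.
Proof.
move=> [oC o0 opos] o_primary o_det.
have [t [tv t_op]] := verma_universal oC o0 opos.
have [phi' v_primary v_det] := primary_pullback tv t_op o_primary o_det.
have v_hw : hw_vector c h (verma_gen c h).
  by split; [exact: verma_genC|exact: verma_gen0|exact: verma_gen_pos].
have cyc := @verma_cyclic K c h.
pose rad := verma_radical c h.
pose pi : {linear verma c h -> irr_hw c h} := GRing.Linear.clone _ _ _ _ (quot_pi rad) _.
have rad_proper (S : submod (verma c h)) :
    ~ S (verma_gen c h) -> forall u, S u -> rad u.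
  by move=> Sv u Su; apply: mem_gen; exists S; split=> // /(_ (verma_gen c h)).
have rad_min (T : submod (verma c h)) :
    (forall (S : submod (verma c h)) u, ~ S (verma_gen c h) -> S u -> T u) ->
    forall u, rad u -> T u.
  move=> ST u; apply=> w [S [Sw]]; apply: ST => Sv; apply: Sw; exact: cyc.
have pi_op x u : pi (op (verma c h) x u) = op (irr_hw c h) x (pi u).
  by apply/esym; exact: quot_opE.
have pi_surj q : exists u, q = pi u by exists (repr q); rewrite [RHS]quot_reprK.
have pi_ker u : pi u = 0 <-> rad u.
  rewrite -[pi u]/(quot_pi rad u) -{1}[0](linear0 pi) -[pi 0]/(quot_pi rad 0).
  by split=> [/quot_piP|ru]; rewrite ?subr0 //; apply/quot_piP; rewrite subr0.
have [psi L_primary] := primary_quotient v_hw cyc v_primary rad_min pi_op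
  pi_surj pi_ker v_det.
exists (pi (verma_gen c h)), psi; split=> //; split.
- exact: (pi_hw v_hw pi_op).
- exact: (pi_gen_neq0 v_hw cyc v_primary rad_min pi_ker).
- exact: (pi_cyclic cyc pi_op pi_surj).
- exact: (pi_simple cyc rad_proper pi_op pi_surj pi_ker).
Qed.

End IrreducibleQuotient.

Section NullVectors.
Variables (K : numFieldType) (c h : K) (L : virMod K) (w : L).
Hypothesis w_hw : simple_hw c h w.
Variables (gamma beta : K) (phi : int -> {scalar L}).
Hypothesis phi_primary : primary w h gamma beta phi.
Local Notation Lop n := (op L (VirL n)).

Let LC u : op L VirC u = c *: u.
Proof. by have [[wC _ _] _ cyc _] := w_hw; exact: (central_charge wC cyc). Qed.

(** The resulting index and scalar are parameters, so that they can be stated as literals and match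
    in later rewriting. *)
Lemma vir_comm_neq n m (k : int) (d : K) u :
  m + n = k -> (n - m)%:~R = d -> m != - n ->
  Lop n (Lop m u) = Lop m (Lop n u) + d *: Lop k u.
Proof. by move=> <- <- /negPf mn; rewrite vir_comm mn addr0. Qed.

Lemma vir_comm22 u :
  Lop 2 (Lop (-2) u) = Lop (-2) (Lop 2 u) + 4 *: Lop 0 u + (c / 2) *: u.
Proof.
rewrite vir_comm LC scalerA; congr (_ + _ + _ *: _).
by rewrite -[(2 ^+ 3 - 2)%:~R]/(6%:R : K); field.
Qed.

Lemma vir_comm11 u : Lop 1 (Lop (-1) u) = Lop (-1) (Lop 1 u) + 2 *: Lop 0 u.
Proof. by rewrite vir_comm subrr mul0r scale0r addr0. Qed.

Let w0 : Lop 0 w = h *: w. Proof. by have [[]] := w_hw. Qed.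
Let wpos (n : int) : 0 < n -> Lop n w = 0.
Proof. by have [[_ _ wp] _ _ _] := w_hw; exact: wp. Qed.

Lemma weight_lower (k : nat) u d : Lop 0 u = (h + d%:R) *: u ->
  Lop 0 (Lop (- k.+1%:Z) u) = (h + (d + k.+1)%:R) *: Lop (- k.+1%:Z) u.
Proof.
move=> u0; rewrite (@vir_comm_neq _ _ (- k.+1%:Z) k.+1%:R) ?addr0 ?sub0r ?opprK //.
by rewrite u0 linearZ -scalerDl natrD addrA.
Qed.

Let w0' : Lop 0 w = (h + 0%:R) *: w. Proof. by rewrite w0 addr0. Qed.
Let LZ n b u : Lop n (b *: u) = b *: Lop n u. Proof. exact: linearZ. Qed.
Let LD n u u' : Lop n (u + u') = Lop n u + Lop n u'. Proof. exact: linearD. Qed.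
Let LN n u : Lop n (- u) = - Lop n u. Proof. exact: linearN. Qed.
Let L0 n : Lop n 0 = 0. Proof. exact: linear0. Qed.

Let z1 : Lop 0 (Lop (-1) w) = (h + 1) *: Lop (-1) w.
Proof. exact: (weight_lower 0 w0'). Qed.
Let z2 : Lop 0 (Lop (-2) w) = (h + 2) *: Lop (-2) w.
Proof. exact: (weight_lower 1 w0'). Qed.

Let e1_1 : Lop 1 (Lop (-1) w) = (2 * h) *: w.
Proof. by rewrite vir_comm11 wpos // L0 w0 add0r scalerA. Qed.
Let e1_11 : Lop 1 (Lop (-1) (Lop (-1) w)) = (4 * h + 2) *: Lop (-1) w.
Proof. by rewrite vir_comm11 e1_1 z1 LZ; module K. Qed.
Let e1_2 : Lop 1 (Lop (-2) w) = 3 *: Lop (-1) w.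
Proof. by rewrite (@vir_comm_neq 1 (-2) (-1) 3) // wpos // L0 add0r. Qed.
Let e2_1 : Lop 2 (Lop (-1) w) = 0.
Proof. by rewrite (@vir_comm_neq 2 (-1) 1 3) // !wpos // L0 scaler0 addr0. Qed.
Let e2_11 : Lop 2 (Lop (-1) (Lop (-1) w)) = (6 * h) *: w.
Proof.
by rewrite (@vir_comm_neq 2 (-1) 1 3) // e2_1 e1_1 L0; module K.
Qed.
Let e2_2 : Lop 2 (Lop (-2) w) = (4 * h + c / 2) *: w.
Proof. by rewrite vir_comm22 wpos // L0 w0; module K. Qed.
Let e1_3 : Lop 1 (Lop (-3) w) = 4 *: Lop (-2) w.
Proof. by rewrite (@vir_comm_neq 1 (-3) (-2) 4) // wpos // L0 add0r. Qed.
Let e1_21 : Lop 1 (Lop (-2) (Lop (-1) w)) =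
  3 *: Lop (-1) (Lop (-1) w) + (2 * h) *: Lop (-2) w.
Proof. by rewrite (@vir_comm_neq 1 (-2) (-1) 3) // e1_1 LZ addrC. Qed.
Let e2_3 : Lop 2 (Lop (-3) w) = 5 *: Lop (-1) w.
Proof. by rewrite (@vir_comm_neq 2 (-3) (-1) 5) // wpos // L0 add0r. Qed.
Let e2_21 : Lop 2 (Lop (-2) (Lop (-1) w)) = (4 * (h + 1) + c / 2) *: Lop (-1) w.
Proof. by rewrite vir_comm22 e2_1 L0 z1; module K. Qed.
Let e1_4 : Lop 1 (Lop (-4) w) = 5 *: Lop (-3) w.
Proof. by rewrite (@vir_comm_neq 1 (-4) (-3) 5) // wpos // L0 add0r. Qed.
Let e1_31 : Lop 1 (Lop (-3) (Lop (-1) w)) =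
  4 *: Lop (-2) (Lop (-1) w) + (2 * h) *: Lop (-3) w.
Proof. by rewrite (@vir_comm_neq 1 (-3) (-2) 4) // e1_1 LZ addrC. Qed.
Let e1_22 : Lop 1 (Lop (-2) (Lop (-2) w)) =
  6 *: Lop (-2) (Lop (-1) w) + 3 *: Lop (-3) w.
Proof.
rewrite (@vir_comm_neq 1 (-2) (-1) 3) // e1_2 LZ.
rewrite (@vir_comm_neq (-1) (-2) (-3) 1) //.
by module K.
Qed.
Let e2_4 : Lop 2 (Lop (-4) w) = 6 *: Lop (-2) w.
Proof. by rewrite (@vir_comm_neq 2 (-4) (-2) 6) // wpos // L0 add0r. Qed.
Let e2_31 : Lop 2 (Lop (-3) (Lop (-1) w)) = 5 *: Lop (-1) (Lop (-1) w).
Proof. by rewrite (@vir_comm_neq 2 (-3) (-1) 5) // e2_1 L0 add0r. Qed.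
Let e2_22 : Lop 2 (Lop (-2) (Lop (-2) w)) = (8 * h + 8 + c) *: Lop (-2) w.
Proof.
rewrite vir_comm22 e2_2 z2 LZ.
have -> : 8 * h + 8 + c = (4 * h + c / 2) + 4 * (h + 2) + c / 2 by field.
by module K.
Qed.

(** The two equations say that L_1 and L_2 kill the difference of both sides, which is then a
    singular vector of L. They overdetermine t, which ties c to h. *)
Lemma singular2 (t : K) :
  3 * t = 4 * h + 2 -> 6 * h = t * (4 * h + c / 2) ->
  Lop (-1) (Lop (-1) w) = t *: Lop (-2) w.
Proof.
move=> t1 t2; apply/eqP; rewrite -subr_eq0; apply/eqP.
have [hw _ cyc simp] := w_hw.
apply: (singular_eq0 hw cyc simp phi_primary (d := 2)) => //.
- rewrite LD LN LZ z2 (weight_lower 0 (weight_lower 0 w0')).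
  by rewrite -[- 1%:Z]/(-1); module K.
- rewrite LD LN LZ e1_11 e1_2 -t1; module K.
- rewrite LD LN LZ e2_11 e2_2 t2; module K.
Qed.

(** The vector is singular only modulo the level two relation, by which L_(-1)^2 w is replaced; this
    is why two terms suffice. The equations express that L_1 and L_2 kill it. *)
Lemma singular3 (t b : K) :
  Lop (-1) (Lop (-1) w) = t *: Lop (-2) w ->
  3 * t + 2 * h + 4 * b = 0 -> 4 * (h + 1) + c / 2 + 5 * b = 0 ->
  Lop (-2) (Lop (-1) w) + b *: Lop (-3) w = 0.
Proof.
move=> w2 b1 b2; have [hw _ cyc simp] := w_hw.
apply: (singular_eq0 hw cyc simp phi_primary (d := 3)) => //.
- rewrite LD LZ (weight_lower 1 (weight_lower 0 w0')) (weight_lower 2 w0').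
  by rewrite -[- 1%:Z]/(-1) -[- 2%:Z]/(-2) -[- 3%:Z]/(-3); module K.
- rewrite LD LZ e1_21 e1_3 w2 -(scale0r (Lop (-2) w)) -b1; module K.
- rewrite LD LZ e2_21 e2_3 -(scale0r (Lop (-1) w)) -b2; module K.
Qed.

(** Again the level two relation is used, in the image under L_2. The first two equations come from
    L_1, the third from L_2. *)
Lemma singular4 (t a b : K) :
  Lop (-1) (Lop (-1) w) = t *: Lop (-2) w ->
  6 + 4 * a = 0 -> 3 + 2 * h * a + 5 * b = 0 ->
  8 * h + 8 + c + 5 * t * a + 6 * b = 0 ->
  Lop (-2) (Lop (-2) w) + a *: Lop (-3) (Lop (-1) w) + b *: Lop (-4) w = 0.
Proof.
move=> w2 a1 b1 b2; have [hw _ cyc simp] := w_hw.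
apply: (singular_eq0 hw cyc simp phi_primary (d := 4)) => //.
- rewrite !LD !LZ (weight_lower 1 (weight_lower 1 w0')) (weight_lower 3 w0').
  rewrite (weight_lower 2 (weight_lower 0 w0')).
  by rewrite -[- 1%:Z]/(-1) -[- 2%:Z]/(-2) -[- 3%:Z]/(-3) -[- 4%:Z]/(-4); module K.
- rewrite !LD !LZ e1_22 e1_31 e1_4.
  have -> : 0 = 0 *: Lop (-2) (Lop (-1) w) + 0 *: Lop (-3) w.
    by rewrite !scale0r addr0.
  by rewrite -{1}a1 -b1; module K.
- rewrite !LD !LZ e2_22 e2_31 e2_4 w2 -(scale0r (Lop (-2) w)) -b2; module K.
Qed.

End NullVectors.

(** * Linear forms on tensor products *)

Section TensorForm.
Variables (K : fieldType) (V L : virMod K).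

Definition bilinear_form (B : V -> L -> K^o) :=
  (forall x, linear (B^~ x)) /\ (forall u, linear (B u)).

Definition pair_form (B : V -> L -> K^o) : {linear pairMod V L -> K^o} :=
  lext (fun p => B p.1 p.2).

Lemma pair_formE B u x : pair_form B (pair_vec u x) = B u x.
Proof. exact: lextU. Qed.

Lemma pair_form_op B b u : pair_form B (op (pairMod V L) b u) =
  pair_form (fun v x => B (op V b v) x + B v (op L b x)) u.
Proof.
move: u; apply: malg_linear_ext => [a u u'|a u u'|[v x]]; rewrite ?linearP //.
rewrite [RHS]lextU /= /pair_op lextU /=.
by rewrite linearD !pair_formE.
Qed.

(** The kernel of a single form need not be stable under the action. The common kernel of all
    bilinear forms is, since moving an operator onto a form gives another bilinear form. *)
Lemma pair_form_rel B u : bilinear_form B -> tensor_rel V L u -> pair_form B u = 0.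
Proof.
pose P (u : pairMod V L) := forall B, bilinear_form B -> pair_form B u = 0.
have P0 : P 0 by move=> B' _; exact: linear0.
have PD a y z : P y -> P z -> P (a *: y + z).
  by move=> Py Pz B' B'b; rewrite linearP Py // Pz // scaler0 addr0.
have Pop b y : P y -> P (op (pairMod V L) b y).
  move=> Py B' [Bl Br]; rewrite pair_form_op; apply: Py; split=> [x a v v'|v a x x'].
    by rewrite linearP !Bl addrACA -scalerDr.
  by rewrite linearP !Br addrACA -scalerDr.
move=> Bb /(_ (Submod P0 PD Pop)) H; apply: H B Bb => _ [a v v' x|a v x x'] B [Bl Br].
- rewrite linearB /= linearP !pair_formE Bl subrr; exact: erefl.
- rewrite linearB /= linearP !pair_formE Br subrr; exact: erefl.
Qed.

Lemma tensor_form (B : V -> L -> K^o) : bilinear_form B ->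
  exists f : {scalar tensor V L}, forall u x, f (tensor_mk u x) = B u x.
Proof.
move=> Bb; have [f fE] := quot_lift (fun u => @pair_form_rel B u Bb).
by exists f => u x; rewrite /tensor_mk fE pair_formE.
Qed.

End TensorForm.

(** * Intermediate series modules *)

Section SeriesBasis.
Variable K : numFieldType.

(** Only a spanning family, with zero vectors at degenerate indices, so that the quotient V'_{0,0}
    and the submodule V'_{0,1} fit in. The last clause replaces linear independence: it suffices to
    show that tensor products are non-zero. *)
Definition series_basis (V : virMod K) (alpha beta : K) (e : int -> V) :=
  [/\ forall n m, op V (VirL n) (e m) = - wt alpha beta n m *: e (m + n),
      forall m, op V VirC (e m) = 0,
      forall P : V -> Prop, P 0 -> (forall a u v, P u -> P v -> P (a *: u + v)) ->
        (forall m, P (e m)) -> forall v, P v,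
      forall k, ~~ nondeg alpha beta k -> e k = 0 &
      exists (eps : {scalar V}) (v : V), eps v != 0].

Section SeriesTensor.
Variables (V L : virMod K) (alpha beta : K) (e : int -> V).
Hypothesis V_basis : series_basis alpha beta e.

Lemma series_tensor_op n k x : op (tensor V L) (VirL n) (tensor_mk (e k) x) =
  - wt alpha beta n k *: tensor_mk (e (k + n)) x + tensor_mk (e k) (op L (VirL n) x).
Proof. by have [eL _ _ _ _] := V_basis; rewrite tensor_mk_op eL tensor_mkZl. Qed.

Lemma series_tensor_opC k x :
  op (tensor V L) VirC (tensor_mk (e k) x) = tensor_mk (e k) (op L VirC x).
Proof.
by have [_ eC _ _ _] := V_basis; rewrite tensor_mk_op eC tensor_mk0l add0r.
Qed.

Lemma series_tensor_ind (P : tensor V L -> Prop) :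
  (forall a y z, P y -> P z -> P (a *: y + z)) ->
  (forall m x, P (tensor_mk (e m) x)) -> forall z, P z.
Proof.
have [_ _ e_span _ _] := V_basis.
move=> PD Pe; apply: tensor_ind => // u x; move: u; apply: e_span => [|a u u' Pu Pu'|m].
- by have := PD (-1) _ _ (Pe 0 x) (Pe 0 x); rewrite scaleN1r addNr tensor_mk0l.
- by rewrite tensor_mk_linearl; exact: PD.
- exact: Pe.
Qed.

End SeriesTensor.

Lemma tensor_irreducible (V L : virMod K) (alpha beta : K) (e : int -> V)
    (c h : K) (w : L) (gamma beta' : K) (phi : int -> {scalar L}) :
  series_basis alpha beta e -> beta != 1 -> simple_hw c h w ->
  primary w h gamma beta' phi ->
  (forall (S : submod (tensor V L)) k, nondeg alpha beta k ->
     (forall m, k < m -> S (tensor_mk (e m) w)) -> S (tensor_mk (e k) w)) ->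
  irreducible (tensor V L).
Proof.
move=> Ve beta1 [[_ _ wpos] w0 cyc simp] [phi1 _ _ _] down.
have [_ _ _ e_deg [eps [v epsv]]] := Ve; split.
  (* The product of [eps] and [phi 0] is a form that does not vanish on v (x) w, so the tensor
     product is non-zero. *)
  have [|f fE] := @tensor_form _ V L (fun u x => eps u * phi 0 x).
    split=> [x a u u'|u a x x']; rewrite linearP /=.
      by rewrite mulrDl -mulrA.
    by rewrite mulrDr mulrCA.
  exists (tensor_mk v w); apply: contraNneq epsv => vw0.
  have := fE v w; rewrite vw0 linear0 phi1 eqxx mulr1 => <-.
  exact: eqxx.
pose tm k x : tensor V L := tensor_mk (e k) x.
apply: (@tm_irreducible K L (tensor V L) alpha beta tm) w0 down => //.
- by move=> k; exact: tensor_mk_linearr.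
- by move=> n k x; exact: series_tensor_op.
- by move=> k x; exact: series_tensor_opC Ve _ _.
- exact: (series_tensor_ind Ve).
- by move=> x; exact: (hw_loc_nilp wpos cyc).
- by move=> k x kd; rewrite /tm e_deg // tensor_mk0l.
Qed.

Lemma opZ (M : opMod K) b a (u : M) : op M b (a *: u) = a *: op M b u.
Proof. exact: linearZ. Qed.

Lemma normalize_alpha_mod (alpha : K) :
  exists k : int, alpha = normalize_alpha alpha + k%:~R.
Proof.
rewrite /normalize_alpha; case: asboolP => [[k ->]|_].
  by exists k; rewrite add0r.
by exists 0; rewrite addr0.
Qed.

Lemma normalize_alpha_int (alpha : K) (k : int) :
  k%:~R + normalize_alpha alpha = 0 -> normalize_alpha alpha = 0.
Proof.
rewrite /normalize_alpha; case: asboolP => // alphaN /eqP.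
by rewrite addrC addr_eq0 => /eqP alphaE; case: alphaN; exists (- k); rewrite rmorphN.
Qed.

Section Presentations.
Variables alpha beta : K.
Local Notation M := (inter alpha beta).

Lemma inter_op_ivec n m : op M (VirL n) (ivec K m : M) =
  - wt alpha beta n m *: (ivec K (m + n) : M).
Proof. by rewrite /= /inter_op lextU. Qed.

Lemma inter_opC_ivec m : op M VirC (ivec K m : M) = 0.
Proof. by rewrite /= /inter_op lextU. Qed.

Lemma inter_span (P : M -> Prop) :
  P 0 -> (forall a u v, P u -> P v -> P (a *: u + v)) ->
  (forall m, P (ivec K m)) -> forall v, P v.
Proof. exact: malg_lin_ind. Qed.

Definition inter_coef (k : int) (u : M) : K := (u : {malg K[int]})@_k.

Lemma inter_coef_linear k : scalar (inter_coef k).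
Proof. by move=> a u v; rewrite /inter_coef mcoeffD mcoeffZ. Qed.
HB.instance Definition _ k :=
  GRing.isLinear.Build K M K _ (inter_coef k) (inter_coef_linear k).

Lemma inter_coef_ivec k m : inter_coef k (ivec K m) = (m == k)%:R.
Proof. by rewrite /inter_coef mcoeffU. Qed.

Lemma inter_coef_neq0 k : inter_coef k (ivec K k) != 0.
Proof. by rewrite inter_coef_ivec eqxx oner_neq0. Qed.

End Presentations.

Lemma inter_basis (alpha beta : K) :
  (beta = 0 -> forall k : int, k%:~R + alpha != 0) ->
  series_basis alpha beta (fun k => ivec K k : inter alpha beta).
Proof.
move=> nd; split; [exact: inter_op_ivec|exact: inter_opC_ivec|exact: inter_span| |].
  by move=> k; rewrite /nondeg negb_or !negbK => /andP[/eqP/nd/(_ k)/negPf ->].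
exists (inter_coef (alpha := alpha) (beta := beta) 0), (ivec K 0).
exact: inter_coef_neq0.
Qed.

(* For beta = 1 the vectors (k + alpha) v_(k-1) satisfy the relations for
   beta = 0, so that beta = 1 need not be considered separately. *)
Lemma wt_shift (alpha : K) (n m : int) (V : lmodType K) (x : V) :
  (m%:~R + alpha) *: (- wt alpha 1 n (m - 1) *: x) =
  - wt alpha 0 n m *: (((m + n)%:~R + alpha) *: x).
Proof.
by rewrite !scalerA /wt !(rmorphD, rmorphN) /=; congr (_ *: _); ring.
Qed.

Lemma inter1_op (alpha : K) n m :
  op (inter alpha 1) (VirL n) ((m%:~R + alpha) *: ivec K (m - 1)) =
  - wt alpha 0 n m *: (((m + n)%:~R + alpha) *: ivec K (m + n - 1)).
Proof.
rewrite opZ inter_op_ivec -wt_shift.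
by congr (_ *: (_ *: ivec K _)); rewrite addrAC.
Qed.

Lemma inter1_basis (alpha : K) : (forall k : int, k%:~R + alpha != 0) ->
  series_basis alpha 0 (fun k => (k%:~R + alpha) *: ivec K (k - 1) : inter alpha 1).
Proof.
move=> nd; split=> [n m|m|P P0 PD Pe|k|].
- exact: inter1_op.
- by rewrite opZ inter_opC_ivec scaler0.
- apply: inter_span => // m.
  have := PD (((m + 1)%:~R + alpha)^-1) _ _ (Pe (m + 1)) P0.
  by rewrite addr0 scalerA mulVf // scale1r addrK.
- by rewrite /nondeg (negPf (nd k)) eqxx.
exists (inter_coef (alpha := alpha) (beta := 1) 0), (ivec K 0).
exact: inter_coef_neq0.
Qed.

Lemma inter00_basis :
  series_basis 0 0
    (fun k => quot_pi (inter00_triv K) (ivec K k) : quotVir (inter00_triv K)).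
Proof.
split=> [n m|m|P P0 PD Pe v|k|].
- by rewrite [LHS]quot_opE inter_op_ivec [LHS]linearZ.
- by rewrite [LHS]quot_opE inter_opC_ivec [LHS]linear0.
- rewrite -[v]quot_reprK; move: (repr v); apply: inter_span => //.
    by rewrite linear0.
  by move=> a u u' Pu Pu'; rewrite linearP; exact: PD.
- rewrite /nondeg eqxx addr0 /= negbK intr_eq0 => /eqP ->.
  by apply: quot_pi0; exists 1; rewrite scale1r.
pose f : {scalar inter 0 0} := inter_coef (alpha := 0) (beta := 0) 1.
have fZ a u : f (a *: u) = a * f u by exact: linearZ.
have [|eps epsE] := @quot_lift _ _ (inter00_triv K) K^o f.
  by move=> _ [a ->]; rewrite fZ [f _]inter_coef_ivec mulr0.
exists eps, (quot_pi (inter00_triv K) (ivec K 1)).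
rewrite epsE; exact: inter_coef_neq0.
Qed.

(* As in [inter1_basis] with alpha = 0, where now e 0 = 0. *)
Lemma inter01_subP (k : int) :
  k%:~R *: ivec K (k - 1) \in submod_pred (inter01_sub K).
Proof.
apply/asboolP; rewrite /= /inter01_sub_mem mcoeffZ mcoeffU.
have [->|k0] := eqVneq k 0; first by rewrite mul0r.
by rewrite (_ : k - 1 == -1 = false) ?mulr0 //; lia.
Qed.

Lemma inter01_basis :
  series_basis 0 0 (fun k => SubCar (inter01_subP k) : subVir (inter01_sub K)).
Proof.
split=> [n m|m|P P0 PD Pe [v vP]|k|].
- apply: val_inj; rewrite [RHS]linearZ.
  by have := inter1_op 0 n m; rewrite !addr0.
- apply: val_inj.
  by rewrite -[LHS]/(op (inter 0 1) VirC (m%:~R *: ivec K (m - 1))) opZ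
    inter_opC_ivec scaler0.
- pose e k : subVir (inter01_sub K) := SubCar (inter01_subP k).
  pose s := \sum_(i <- msupp v) (v@_i / (i + 1)%:~R) *: e (i + 1).
  suff -> : SubCar vP = s.
    by rewrite /s; elim/big_rec: _ => [//|i x _ Px]; exact: PD (Pe _) Px.
  apply: val_inj; rewrite /s raddf_sum /= {1}[v]monalgE.
  apply: eq_bigr => i _; rewrite scalerA addrK.
  have -> : << v@_i *g i >> = v@_i *: ivec K i.
    by apply/malgP => k; rewrite mcoeffZ !mcoeffU mulrnAr mulr1.
  (* At i = -1 the division by i + 1 yields 0, in agreement with the missing coefficient of
     v_(-1). *)
  congr (_ *: _); have [i1|i1] := eqVneq (i + 1) 0; last first.
    by rewrite mulfVK // intr_eq0.
  by rewrite i1 mulr0; move/asboolP: vP => /= <-; congr (v@__); lia.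
- rewrite /nondeg eqxx addr0 /= negbK intr_eq0 => /eqP ->.
  by apply: val_inj; rewrite /= scale0r.
have epsL : scalar (fun u : subVir (inter01_sub K) =>
    inter_coef (alpha := 0) (beta := 1) 0 (val u)).
  by move=> a u u'; exact: (@inter_coef_linear 0 1 0 a (val u) (val u')).
pose eps : {scalar subVir (inter01_sub K)} :=
  HB.pack
    (fun u : subVir (inter01_sub K) => inter_coef (alpha := 0) (beta := 1) 0 (val u))
    (GRing.isLinear.Build _ _ _ _ _ epsL).
exists eps, (SubCar (inter01_subP 1)).
by rewrite /= scale1r inter_coef_neq0.
Qed.

End SeriesBasis.

(** * Irreducibility and reducibility of tensor products *)

Section IrreducibleTensors.
Variable K : numFieldType.

Lemma inter'_basis (alpha beta : K) : exists e : int -> inter' alpha beta,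
  series_basis (normalize_alpha alpha) (if beta == 1 then 0 else beta) e.
Proof.
rewrite /inter'; have := @normalize_alpha_int K alpha.
case: eqVneq => [-> _|a0 aN] /=.
  have [->|b0] /= := eqVneq beta 0.
    by rewrite eq_sym oner_eq0; eexists; exact: inter00_basis.
  have [_|b1] /= := eqVneq beta 1; first by eexists; exact: inter01_basis.
  by eexists; apply: inter_basis => b0'; rewrite b0' eqxx in b0.
have aN0 (k : int) : k%:~R + normalize_alpha alpha != 0.
  by apply: contraNneq a0 => /aN ->.
have [->|b1] := eqVneq beta 1; first by eexists; exact: inter1_basis.
by eexists; exact: inter_basis.
Qed.

Section Descent.
Variables (L : virMod K) (w : L).

(** The polynomial [Q] of a null vector, as a function of r = k + alpha and beta. Two such
    polynomials without a common zero allow the descent at every index. *)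
Definition descends (Q : K -> K -> K) :=
  forall (V : virMod K) alpha beta (e : int -> V), series_basis alpha beta e ->
  forall (S : submod (tensor V L)) (k : int),
    (forall m, k < m -> S (tensor_mk (e m) w)) ->
    Q (k%:~R + alpha) beta != 0 -> S (tensor_mk (e k) w).

Let Lop n u := op L (VirL n) u.

Lemma descends2 (t : K) : Lop (-1) (Lop (-1) w) = t *: Lop (-2) w ->
  descends (fun r beta => (r + 2) * (r + 1) - t * (r + 2 - beta)).
Proof.
move=> w2 V alpha beta e Ve S k above.
apply: (@null_vector2 K L (tensor V L) alpha beta (fun k => tensor_mk (e k)))
  w2 => // [m|n m x]; [exact: tensor_mk_linearr|exact: series_tensor_op].
Qed.

Lemma descends3 (b : K) : Lop (-2) (Lop (-1) w) + b *: Lop (-3) w = 0 ->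
  descends (fun r beta => (r + 3 - beta) * (r + 1) + b * (r + 3 - 2 * beta)).
Proof.
move=> w3 V alpha beta e Ve S k above.
apply: (@null_vector3 K L (tensor V L) alpha beta (fun k => tensor_mk (e k)))
  w3 => // [m|n m x]; [exact: tensor_mk_linearr|exact: series_tensor_op].
Qed.

Lemma descends4 (a b : K) :
  Lop (-2) (Lop (-2) w) + a *: Lop (-3) (Lop (-1) w) + b *: Lop (-4) w = 0 ->
  descends (fun r beta => (r + 4 - beta) * (r + 2 - beta)
    + a * ((r + 4 - 2 * beta) * (r + 1)) + b * (r + 4 - 3 * beta)).
Proof.
move=> w4 V alpha beta e Ve S k above.
apply: (@null_vector4 K L (tensor V L) alpha beta (fun k => tensor_mk (e k)))
  w4 => // [m|n m x]; [exact: tensor_mk_linearr|exact: series_tensor_op].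
Qed.

Lemma inter'_tensor_irreducible (alpha beta c h gamma beta' : K)
    (phi : int -> {scalar L}) (Q1 Q2 : K -> K -> K) :
  simple_hw c h w -> primary w h gamma beta' phi ->
  descends Q1 -> descends Q2 ->
  (forall r, ~ (Q1 r 0 = 0 /\ Q2 r 0 = 0)) ->
  (beta != 1 -> forall k : int,
    ~ (Q1 (k%:~R + alpha) beta = 0 /\ Q2 (k%:~R + alpha) beta = 0)) ->
  irreducible (tensor (inter' alpha beta) L).
Proof.
move=> w_hw w_primary d1 d2 Q0 Qb; have [e Ve] := inter'_basis alpha beta.
apply: (tensor_irreducible Ve _ w_hw w_primary) => [|S k _ above].
  by case: ifP => [_|->//]; rewrite eq_sym oner_neq0.
have [q1|] := eqVneq
    (Q1 (k%:~R + normalize_alpha alpha) (if beta == 1 then 0 else beta)) 0;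
  last exact: d1 above.
have [q2|] := eqVneq
    (Q2 (k%:~R + normalize_alpha alpha) (if beta == 1 then 0 else beta)) 0;
  last exact: d2 above.
(* For beta = 1 the module is presented with parameter 0, so the polynomials are evaluated there. *)
have [b1|b1] := eqVneq beta 1.
  rewrite b1 eqxx in q1 q2.
  by case: (Q0 (k%:~R + normalize_alpha alpha)).
have [m alphaE] := normalize_alpha_mod alpha.
rewrite (negPf b1) in q1 q2; case: (Qb b1 (k - m)).
have -> : (k - m)%:~R + alpha = k%:~R + normalize_alpha alpha.
  by rewrite {1}alphaE rmorphB /=; ring.
by [].
Qed.

End Descent.

(** The first equation is linear in beta. Substituting its solution turns the second into a cubic in
    r with root r = -1, which corresponds to beta = 1; the other two roots are the exceptional
    ones. *)
Lemma level3_roots_15 (r beta : K) : beta != 1 ->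
  (r + 2) * (r + 1) - 2 / 5 * (r + 2 - beta) = 0 ->
  (r + 3 - beta) * (r + 1) + - (1 / 5) * (r + 3 - 2 * beta) = 0 ->
  beta = 6 / 5 /\ (r = - (2 / 5) - 1 \/ r = - (1 / 5) - 1).
Proof.
move=> b1 /eqP; rewrite subr_eq0 => /eqP q1.
have bE : beta = r + 2 - 5 / 2 * ((r + 2) * (r + 1)) by rewrite q1; field.
move=> q2.
have /eqP : 5 / 2 * ((r + 1) * ((r - (- (2 / 5) - 1)) * (r - (- (1 / 5) - 1)))) = 0.
  by rewrite -q2 bE; field.
rewrite !mulf_eq0 invr_eq0 !pnatr_eq0 /= !subr_eq0 addr_eq0.
case/or3P=> /eqP rE; [case/eqP: b1|split; last by left|split; last by right];
  by rewrite bE rE; field.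
Qed.

Lemma level3_roots_12 (r beta : K) : beta != 1 ->
  (r + 2) * (r + 1) - 4 / 3 * (r + 2 - beta) = 0 ->
  (r + 3 - beta) * (r + 1) + - (5 / 4) * (r + 3 - 2 * beta) = 0 ->
  beta = 1 / 2 /\ r = 0 \/ beta = 15 / 16 /\ r = 1 / 2 - 1.
Proof.
move=> b1 /eqP; rewrite subr_eq0 => /eqP q1.
have bE : beta = r + 2 - 3 / 4 * ((r + 2) * (r + 1)) by rewrite q1; field.
move=> q2; have /eqP : 3 / 4 * ((r + 1) * (r * (r - (1 / 2 - 1)))) = 0.
  by rewrite -q2 bE; field.
rewrite !mulf_eq0 invr_eq0 !pnatr_eq0 /= subr_eq0 addr_eq0.
case/or3P=> /eqP rE; [case/eqP: b1|left; split=> //|right; split=> //];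
  by rewrite bE rE; field.
Qed.

(** The same substitution gives a quartic in r: besides r = -1, where beta = 1, there are three
    exceptional roots. *)
Lemma level4_roots_116 (r beta : K) : beta != 1 ->
  (r + 2) * (r + 1) - 3 / 4 * (r + 2 - beta) = 0 ->
  (r + 4 - beta) * (r + 2 - beta) + - (3 / 2) * ((r + 4 - 2 * beta) * (r + 1))
    + - (9 / 16) * (r + 4 - 3 * beta) = 0 ->
  [\/ beta = 15 / 16 /\ r = 1 / 8 - 1, beta = 15 / 16 /\ r = - (3 / 8) - 1
    | beta = 1 / 2 /\ r = 1 / 2 - 1].
Proof.
move=> b1 /eqP; rewrite subr_eq0 => /eqP q1.
have bE : beta = r + 2 - 4 / 3 * ((r + 2) * (r + 1)) by rewrite q1; field.
move=> q2; have /eqP : 16 / 9 * ((r + 1) *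
    ((r - (1 / 8 - 1)) * ((r - (- (3 / 8) - 1)) * (r - (1 / 2 - 1))))) = 0.
  by rewrite -q2 bE; field.
rewrite !mulf_eq0 invr_eq0 !pnatr_eq0 /= !subr_eq0 addr_eq0.
case/or4P=> /eqP rE; [case/eqP: b1|constructor 1; split=> //
  |constructor 2; split=> //|constructor 3; split=> //]; by rewrite bE rE; field.
Qed.

End IrreducibleTensors.

(** * Reducibility at the exceptional pairs *)

Section ReducibleTensors.
Variables (K : numFieldType) (L T : virMod K) (alpha beta : K) (tm : int -> L -> T).
Hypothesis tm_linear : forall k, linear (tm k).
Hypothesis tm_op : forall n k x,
  op T (VirL n) (tm k x) = - wt alpha beta n k *: tm (k + n) x + tm k (op L (VirL n) x).
Hypothesis tm_opC : forall k x, op T VirC (tm k x) = tm k (op L VirC x).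
Hypothesis tm_span : forall P : T -> Prop,
  (forall a y z, P y -> P z -> P (a *: y + z)) ->
  (forall k x, P (tm k x)) -> forall z, P z.

Variables (c h gamma : K) (w : L) (phi : int -> {scalar L}) (n0 : int).
Hypothesis tm_forms : forall f : int -> {scalar L},
  exists F : {scalar T}, forall m x, F (tm m x) = f m x.
Hypothesis w_hw : simple_hw c h w.
Hypothesis w_primary : primary w h gamma beta phi.
Hypothesis gammaE : gamma = n0%:~R + alpha + beta.

Lemma tm_reducible : ~ irreducible T.
Proof.
case=> _ simp; have [[wC _ wpos] w0 cyc _] := w_hw.
have [phi1 phi_neg phi0 phi_op] := w_primary.
have [F FE] := tm_forms (fun m => phi (m - n0)).
have FD a y z : F (a *: y + z) = a * F y + F z by exact: linearP.
have TC z : op T VirC z = c *: z.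
  move: z; apply: tm_span => [a y z yC zC|m x].
    by rewrite [LHS]linearP yC zC scalerDr !scalerA mulrC.
  by rewrite tm_opC (central_charge wC cyc) (tmZ tm_linear).
have F_neg (n : int) z : n < 0 -> F (op T (VirL n) z) = 0.
  move=> n0'; have -> : n = - `|n|%N.-1.+1%:Z by lia.
  move: {n n0'}(`|n|%N.-1) => k; move: z.
  apply: tm_span => [a y z y0 z0|m x].
    have -> : op T (VirL (- k.+1%:Z)) (a *: y + z) =
      a *: op T (VirL (- k.+1%:Z)) y + op T (VirL (- k.+1%:Z)) z.
      by exact: linearP.
    by rewrite FD y0 z0 mulr0 addr0.
  (* Both terms are multiples of the same value of [phi]; their coefficients cancel by the choice of
     [n0] in [gammaE]. *)
  rewrite tm_op FD !FE phi_op addrAC.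
  rewrite -mulrDl; apply/eqP; rewrite mulf_eq0; apply/orP; left; apply/eqP.
  by rewrite /wt gammaE !(rmorphB, rmorphN) /= -[k.+1%:~R]/(k.+1%:R); ring.
have F_zero z : F (op T (VirL 0) z) = (h - n0%:~R - alpha - beta) * F z.
  move: z; apply: tm_span => [a y z y0 z0|m x].
    have -> : op T (VirL 0) (a *: y + z) = a *: op T (VirL 0) y + op T (VirL 0) z.
      by exact: linearP.
    by rewrite !FD y0 z0; ring.
  rewrite tm_op FD !FE phi0 addr0 -mulrDl; congr (_ * _).
  by rewrite /wt rmorphB /=; ring.
pose S := pos_ker TC F_neg F_zero.
(* Positive operators kill w and only raise the index of e. Starting from n0 + 1, the index n0, the
   only one where F is non-zero on [tm m w], is never reached. *)
have word s m : exists a (m' : int), m <= m' /\ pos_word s (tm m w) = a *: tm m' w.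
  elim: s => [|k s [a [m' [mm' IHs]]]]; first by exists 1, m; rewrite scale1r.
  exists (a * - wt alpha beta k.+1%:Z m'), (m' + k.+1%:Z); split; first lia.
  by rewrite /= -/(pos_word _ _) IHs opZ tm_op wpos // (tm0 tm_linear)
    addr0 scalerA.
have S1 : S (tm (n0 + 1) w).
  move=> s; have [a [m' [mm' ->]]] := word s (n0 + 1).
  have -> : F (a *: tm m' w) = a * F (tm m' w) by exact: linearZ.
  by rewrite FE phi1 (_ : m' - n0 == 0 = false) ?mulr0 //; lia.
have [S0|ST] := simp S.
  (* A second form, independent of the index, shows that [tm (n0 + 1) w] is non-zero. *)
  have [G GE] := tm_forms (fun=> phi 0).
  have := GE (n0 + 1) w; rewrite (S0 _ S1) linear0 phi1 => /eqP.
  by rewrite eq_sym oner_eq0.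
have := ST (tm n0 w) [::]; rewrite /= FE subrr phi1 => /eqP.
by rewrite oner_eq0.
Qed.

End ReducibleTensors.

Lemma tensor_reducible (K : numFieldType) (V L : virMod K) (alpha beta : K)
    (e : int -> V) c h gamma (w : L) (phi : int -> {scalar L}) (n0 : int) :
  series_basis alpha beta e ->
  (forall f : int -> {scalar L},
    exists F : {scalar tensor V L}, forall m x, F (tensor_mk (e m) x) = f m x) ->
  simple_hw c h w -> primary w h gamma beta phi ->
  gamma = n0%:~R + alpha + beta -> ~ irreducible (tensor V L).
Proof.
move=> Ve forms w_hw w_primary gammaE.
pose tm k x : tensor V L := tensor_mk (e k) x.
apply: (@tm_reducible K L (tensor V L) alpha beta tm) w_hw w_primary gammaE => //.
- by move=> k; exact: tensor_mk_linearr.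
- by move=> n k x; exact: series_tensor_op.
- by move=> k x; exact: series_tensor_opC Ve _ _.
- exact: (series_tensor_ind Ve).
Qed.

Section InterForms.
Variables (K : numFieldType) (alpha beta : K) (L : virMod K).

Lemma inter_tensor_form (f : int -> {scalar L}) :
  exists F : {scalar tensor (inter alpha beta) L}, forall m x,
    F (tensor_mk (ivec K m : inter alpha beta) x) = f m x.
Proof.
pose B (u : inter alpha beta) x : K^o := lext (fun m => f m x : K^o) u.
have [|F FE] := @tensor_form _ _ _ B.
  split=> [x|u a x x']; first exact: lext_is_linear.
  rewrite /B /lext scaler_sumr -big_split /=; apply: eq_bigr => m _.
  by rewrite linearP /= scalerDr; congr (_ + _); exact: mulrCA.
by exists F => m x; rewrite FE /B lextU.
Qed.

Lemma inter_tensor_reducible c h gamma (w : L) (phi : int -> {scalar L}) (n0 : int) :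
  (beta = 0 -> forall k : int, k%:~R + alpha != 0) ->
  simple_hw c h w -> primary w h gamma beta phi ->
  gamma = n0%:~R + alpha + beta -> ~ irreducible (tensor (inter alpha beta) L).
Proof. by move=> nd; exact: tensor_reducible (inter_basis nd) inter_tensor_form. Qed.

End InterForms.

(** * The three highest weight modules *)

Section Main.
Variable K : numFieldType.

Lemma inter'_tensor_reducible (L : virMod K) (alpha beta a b c h gamma : K) (w : L)
    (phi : int -> {scalar L}) (n : int) :
  eq_modZ (alpha, beta) (a, b) -> b != 0 -> b != 1 ->
  simple_hw c h w -> primary w h gamma b phi -> gamma = a + b + n%:~R ->
  ~ irreducible (tensor (inter' alpha beta) L).
Proof.
move=> [[k /= kE] ->] b0 b1 w_hw w_primary gammaE.
have [m alphaE] := normalize_alpha_mod alpha.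
rewrite /inter' (negPf b0) (negPf b1) !andbF.
apply: inter_tensor_reducible w_hw w_primary _ => [b0'|].
  by rewrite b0' eqxx in b0.
(* Here alpha = a + k and alpha = [normalize_alpha alpha] + m, so the integer part of gamma is
   corrected by m - k. *)
rewrite gammaE; instantiate (1 := n - k + m).
rewrite !(rmorphD, rmorphN) /= -kE {1}alphaE; ring.
Qed.

(* Parametrization of [fock_exists] with q = 1 / (2 kappa) and T = kappa tau. *)
Lemma irr_hw_series (q T lam c h gamma b : K)
    (A := lam + T - 1) (B := lam + 2 * T - 1) :
  q != 0 -> c = 1 - 24 * q * T ^+ 2 -> h = q * (lam ^+ 2 - T ^+ 2) ->
  gamma = q * (2 * lam - 1) -> b = 1 - q * (1 - 2 * T) ->
  A = 0 \/ 4 * q * A * B = 1 /\ (forall n : nat, A + 1 + B * n%:R != 0) ->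
  exists (w : irr_hw c h) (psi : int -> {scalar irr_hw c h}),
    simple_hw c h w /\ primary w h gamma b psi.
Proof.
move=> q0 cE hE gammaE bE AB.
pose kappa := (2 * q)^-1; pose tau := 2 * q * T.
have kT : kappa * tau = T by rewrite /kappa /tau; field.
have [||M [o [phi [o_hw o_primary o_det]]]] := @fock_exists K kappa lam tau.
- by rewrite invr_eq0 mulf_neq0 ?pnatr_eq0.
- rewrite -[2 * kappa * tau]mulrA !kT; case: AB => [A0|[AB AB0]]; [by left|].
  right; split=> //.
  by rewrite /kappa -[RHS]mulr1 -[X in _ = _ * X]AB /A /B; field.
have cE' : c = 1 - 12 * kappa * tau ^+ 2 by rewrite cE /kappa /tau; field.
have hE' : h = lam ^+ 2 / (2 * kappa) - kappa * tau ^+ 2 / 2.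
  by rewrite hE /kappa /tau; field.
have gE : gamma = lam / kappa - (2 * kappa)^-1 by rewrite gammaE /kappa; field.
have bE' : b = 1 + tau - (2 * kappa)^-1 by rewrite bE /kappa /tau; field.
rewrite -cE' -hE' -gE -bE' in o_hw o_primary.
exact: irr_hw_primary o_hw o_primary o_det.
Qed.

Lemma eq_modZ_root (alpha beta a b : K) (k : int) :
  k%:~R + alpha = a - 1 -> beta = b -> eq_modZ (alpha, beta) (a, b).
Proof.
move=> aE ->; split=> //=; exists (- 1 - k).
rewrite rmorphB rmorphN1 /=; have -> : a = k%:~R + alpha + 1 by rewrite aE subrK.
by ring.
Qed.

Let natE := (pnatr_eq0, oner_eq0).

Lemma irreducible_15 (alpha beta : K) :
  irreducible (tensor (inter' alpha beta) (irr_hw (- (22 / 5)) (- (1 / 5)))) <->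
  ~ eq_modZ (alpha, beta) (- (2 / 5), 6 / 5) /\
  ~ eq_modZ (alpha, beta) (- (1 / 5), 6 / 5).
Proof.
have b0 : 6 / 5 != 0 :> K by rewrite mulf_eq0 invr_eq0 !natE.
have b1 : 6 / 5 != 1 :> K.
  by rewrite -subr_eq0 (_ : _ - 1 = 5^-1) ?invr_eq0 ?natE //; field.
have q0 : 1 / 10 != 0 :> K by rewrite mulf_eq0 invr_eq0 !natE.
(* Delta = -1/5 with target weight 0, so A = 0. This realization also provides the form used for the
   null vectors. *)
have [||||||w [phi [w_hw w_primary]]] := @irr_hw_series (1 / 10) (3 / 2) (- (1 / 2))
  (- (22 / 5)) (- (1 / 5)) (- (1 / 5)) (6 / 5) => //; try by field.
  by left; field.
split=> [irr|[n1 n2]].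
  split=> E; move: irr.
    apply: (inter'_tensor_reducible E b0 b1 w_hw w_primary (n := -1)).
    by rewrite rmorphN1; field.
  (* Changing the sign of lam keeps h but moves the target weight to -1/5. Now A = 1 and B = 5/2, so
     2 (A + 1 + B n) = 4 + 5 n. *)
  have [||||||w' [phi' [w'_hw w'_primary]]] := @irr_hw_series (1 / 10) (3 / 2) (1 / 2)
    (- (22 / 5)) (- (1 / 5)) 0 (6 / 5) => //; try by field.
    right; split=> [|n]; first by field.
    apply/eqP => E0; have /eqP : (4 + 5 * n)%:R = 0 :> K.
      by rewrite natrD natrM -(mulr0 2) -E0; field.
    by rewrite pnatr_eq0.
  apply: (inter'_tensor_reducible E b0 b1 w'_hw w'_primary (n := -1)).
  by rewrite rmorphN1; field.
(* The scalars are t = (4 h + 2)/3 and b = -(3 t + 2 h)/4. *)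
have w2 := @singular2 K _ _ _ w w_hw _ _ phi w_primary (2 / 5) _ _.
have w3 := @singular3 K _ _ _ w w_hw _ _ phi w_primary (2 / 5) (- (1 / 5)) _ _ _.
apply: (inter'_tensor_irreducible w_hw w_primary (descends2 _) (descends3 _)).
- by apply: w2; field.
- apply: w3; [apply: w2|..]; by field.
- move=> r [q1 q2]; have [|E _] := level3_roots_15 _ q1 q2.
    by rewrite eq_sym oner_eq0.
  by rewrite -E eqxx in b0.
move=> beta1 k [q1 q2]; have [bE [rE|rE]] := level3_roots_15 beta1 q1 q2.
  by apply: n1; exact: eq_modZ_root rE bE.
by apply: n2; exact: eq_modZ_root rE bE.
Qed.

Lemma irreducible_12 (alpha beta : K) :
  irreducible (tensor (inter' alpha beta) (irr_hw (1 / 2) (1 / 2))) <->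
  ~ eq_modZ (alpha, beta) (0, 1 / 2) /\
  ~ eq_modZ (alpha, beta) (1 / 2, 15 / 16).
Proof.
have b0 : 1 / 2 != 0 :> K by rewrite mulf_eq0 invr_eq0 !natE.
have b1 : 1 / 2 != 1 :> K.
  by rewrite -subr_eq0 (_ : _ - 1 = - 2^-1) ?oppr_eq0 ?invr_eq0 ?natE //; field.
have b0' : 15 / 16 != 0 :> K by rewrite mulf_eq0 invr_eq0 !natE.
have b1' : 15 / 16 != 1 :> K.
  by rewrite -subr_eq0 (_ : _ - 1 = - 16^-1) ?oppr_eq0 ?invr_eq0 ?natE //; field.
have q0 : 3 / 4 != 0 :> K by rewrite mulf_eq0 invr_eq0 !natE.
have q0' : 3 / 16 != 0 :> K by rewrite mulf_eq0 invr_eq0 !natE.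
have [||||||w [phi [w_hw w_primary]]] := @irr_hw_series (3 / 4) (1 / 6) (5 / 6)
  (1 / 2) (1 / 2) (1 / 2) (1 / 2) => //; try by field.
  by left; field.
split=> [irr|[n1 n2]].
  split=> E; move: irr.
    apply: (inter'_tensor_reducible E b0 b1 w_hw w_primary (n := 0)).
    by rewrite add0r addr0.
  (* Delta = 1/16 with target weight 1/16; here A = 1 and B = 4/3. The field of weight 1/16 requires
     another q than the one of weight 1/2. *)
  have [||||||w' [phi' [w'_hw w'_primary]]] := @irr_hw_series (3 / 16) (1 / 3) (5 / 3)
    (1 / 2) (1 / 2) (7 / 16) (15 / 16) => //; try by field.
    right; split=> [|n]; first by field.
    apply/eqP => E0; have /eqP : (6 + 4 * n)%:R = 0 :> K.
      by rewrite natrD natrM -(mulr0 3) -E0; field.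
    by rewrite pnatr_eq0.
  apply: (inter'_tensor_reducible E b0' b1' w'_hw w'_primary (n := -1)).
  by rewrite rmorphN1; field.
have w2 := @singular2 K _ _ _ w w_hw _ _ phi w_primary (4 / 3) _ _.
have w3 := @singular3 K _ _ _ w w_hw _ _ phi w_primary (4 / 3) (- (5 / 4)) _ _ _.
apply: (inter'_tensor_irreducible w_hw w_primary (descends2 _) (descends3 _)).
- by apply: w2; field.
- apply: w3; [apply: w2|..]; by field.
- move=> r [q1 q2]; have [|[E _]|[E _]] := level3_roots_12 _ q1 q2.
  + by rewrite eq_sym oner_eq0.
  + by rewrite -E eqxx in b0.
  + by rewrite -E eqxx in b0'.
move=> beta1 k [q1 q2]; have [[bE rE]|[bE rE]] := level3_roots_12 beta1 q1 q2.
  (* The root is r = 0 rather than a - 1 = -1, hence the index k - 1. *)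
  by apply: n1; apply: (eq_modZ_root (k := k - 1)) bE; rewrite -rE rmorphB /=; ring.
by apply: n2; exact: eq_modZ_root rE bE.
Qed.

Lemma irreducible_116 (alpha beta : K) :
  irreducible (tensor (inter' alpha beta) (irr_hw (1 / 2) (1 / 16))) <->
  [/\ ~ eq_modZ (alpha, beta) (1 / 8, 15 / 16),
      ~ eq_modZ (alpha, beta) (- (3 / 8), 15 / 16)
    & ~ eq_modZ (alpha, beta) (1 / 2, 1 / 2)].
Proof.
have b0 : 1 / 2 != 0 :> K by rewrite mulf_eq0 invr_eq0 !natE.
have b1 : 1 / 2 != 1 :> K.
  by rewrite -subr_eq0 (_ : _ - 1 = - 2^-1) ?oppr_eq0 ?invr_eq0 ?natE //; field.
have b0' : 15 / 16 != 0 :> K by rewrite mulf_eq0 invr_eq0 !natE.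
have b1' : 15 / 16 != 1 :> K.
  by rewrite -subr_eq0 (_ : _ - 1 = - 16^-1) ?oppr_eq0 ?invr_eq0 ?natE //; field.
have q0 : 3 / 16 != 0 :> K by rewrite mulf_eq0 invr_eq0 !natE.
have q0' : 1 / 3 != 0 :> K by rewrite mulf_eq0 invr_eq0 !natE.
have [||||||w [phi [w_hw w_primary]]] := @irr_hw_series (3 / 16) (1 / 3) (2 / 3)
  (1 / 2) (1 / 16) (1 / 16) (15 / 16) => //; try by field.
  by left; field.
split=> [irr|[n1 n2 n3]].
  split=> E; move: irr.
  - apply: (inter'_tensor_reducible E b0' b1' w_hw w_primary (n := -1)).
    by rewrite rmorphN1; field.
  (* Opposite lam: the target weight becomes 1/2, with A = -4/3 and B = -1. *)
  - have [||||||w' [phi' [w'_hw w'_primary]]] := @irr_hw_series (3 / 16) (1 / 3)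
      (- (2 / 3)) (1 / 2) (1 / 16) (- (7 / 16)) (15 / 16) => //; try by field.
      right; split=> [|n]; first by field.
      apply/eqP => E0; have /eqP : (1 + 3 * n)%:R = 0 :> K.
        by rewrite natrD natrM -(mulr0 (-3)) -E0; field.
      by rewrite pnatr_eq0.
    apply: (inter'_tensor_reducible E b0' b1' w'_hw w'_primary (n := -1)).
    by rewrite rmorphN1; field.
  (* Delta = 1/2 with target weight 1/16; A = -3/4 and B = -1, so A + 1 + B n = 1/4 - n is never
     zero. *)
  have [||||||w' [phi' [w'_hw w'_primary]]] := @irr_hw_series (1 / 3) (- (1 / 4))
    (1 / 2) (1 / 2) (1 / 16) 0 (1 / 2) => //; try by field.
    right; split=> [|n]; first by field.
    apply/eqP => E0; have /eqP : (4 * n)%:R = 1%:R :> K.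
      apply/eqP; rewrite -subr_eq0 natrM; apply/eqP.
      by rewrite -(mulr0 (-4)) -E0; field.
    by rewrite eqr_nat; lia.
  apply: (inter'_tensor_reducible E b0 b1 w'_hw w'_primary (n := -1)).
  by rewrite rmorphN1; field.
have w2 := @singular2 K _ _ _ w w_hw _ _ phi w_primary (3 / 4) _ _.
have w4 := @singular4 K _ _ _ w w_hw _ _ phi w_primary (3 / 4) (- (3 / 2)) (- (9 / 16))
  _ _ _ _.
apply: (inter'_tensor_irreducible w_hw w_primary (descends2 _) (descends4 _)).
- by apply: w2; field.
- apply: w4; [apply: w2|..]; by field.
- move=> r [q1 q2]; have [|[E _]|[E _]|[E _]] := level4_roots_116 _ q1 q2.
  + by rewrite eq_sym oner_eq0.
  + by rewrite -E eqxx in b0'.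
  + by rewrite -E eqxx in b0'.
  + by rewrite -E eqxx in b0.
move=> beta1 k [q1 q2].
have [[bE rE]|[bE rE]|[bE rE]] := level4_roots_116 beta1 q1 q2.
- by apply: n1; exact: eq_modZ_root rE bE.
- by apply: n2; exact: eq_modZ_root rE bE.
- by apply: n3; exact: eq_modZ_root rE bE.
Qed.

End Main.

Local Open Scope complex_scope.

Theorem proposition5p8 (R : realType) (alpha beta : R[i]) :
  [/\ irreducible
        (tensor (inter' alpha beta) (irr_hw (- (22 / 5)) (- (1 / 5)))) <->
      ~ eq_modZ (alpha, beta) (- (2 / 5), 6 / 5) /\
      ~ eq_modZ (alpha, beta) (- (1 / 5), 6 / 5),
      irreducible
        (tensor (inter' alpha beta) (irr_hw (1 / 2) (1 / 2))) <->
      ~ eq_modZ (alpha, beta) (0, 1 / 2) /\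
      ~ eq_modZ (alpha, beta) (1 / 2, 15 / 16)
    & irreducible
        (tensor (inter' alpha beta) (irr_hw (1 / 2) (1 / 16))) <->
      [/\ ~ eq_modZ (alpha, beta) (1 / 8, 15 / 16),
          ~ eq_modZ (alpha, beta) (- (3 / 8), 15 / 16)
        & ~ eq_modZ (alpha, beta) (1 / 2, 1 / 2)] ].
Proof.
by split; [exact: irreducible_15|exact: irreducible_12|exact: irreducible_116].
Qed.
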